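(* Let $K\subset\mathbb S^2$ be a proper spherical convex body of class $\mathcal C^2_+$ that is symmetric about a point $\mathbf o\in\mathbb S^2$. Then $$E^s(K)\ge E^s(C_K)=-\frac12\log\frac{4\pi\,\mathrm{vol}_2^s(K)-\mathrm{vol}_2^s(K)^2}{(2\pi-\mathrm{vol}_2^s(K))^2}.$$ In particular, $E^s(K)\ge0$ if $\mathrm{vol}_2^s(K)\le\mathrm{vol}_2^s(C(\pi/4))=(2-\sqrt2)\pi$, or if $\operatorname{diam}K\le\frac\pi2$.
   Context: $\mathbb S^2$ is the unit sphere in $\mathbb R^3$ with geodesic distance and area measure $\mathrm{vol}_2^s$; $\operatorname{diam}$ is taken with respect to the geodesic distance. A spherical convex body is a closed set $K\subset\mathbb S^2$ with non-empty interior that contains, with any two non-antipodal points, the minimal geodesic arc joining them; it is proper if it is contained in an open half-sphere. $K$ is symmetric about $\mathbf o$ if it is invariant under the point reflection $\mathbf u\mapsto 2(\mathbf u\cdot\mathbf o)\mathbf o-\mathbf u$. $K$ is of class $\mathcal C^2_+$ if $\partial K$ is a $\mathcal C^2$-smooth embedded curve with everywhere strictly positive geodesic curvature. $C(\alpha)$ is a geodesic ball of radius $\alpha$; $C_K$ is a geodesic ball with $\mathrm{vol}_2^s(C_K)=\mathrm{vol}_2^s(K)$. Dual body: $K^*=\{\mathbf v\in\mathbb S^2:\mathbf v\cdot\mathbf u\ge0\ \forall\mathbf u\in K\}$. Spherical curvature entropy ($d=2$): $E^s(K)=-\log\mathcal E^s(K)$ with $\mathcal E^s(K)=\lim_{q\to0^+}\left(\frac{\Omega_q^s(K^*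 )}{P^s(K^* )}\right)^{1+\frac 2q}$, where $P^s$ is the length of the boundary, and $\Omega_q^s(L)=\int_{\partial L}H_1^s(L,\mathbf u)^{\frac{q}{2+q}}\,\mathrm{vol}_{\partial L}^s(d\mathbf u)$ with $H_1^s(L,\cdot)$ the geodesic curvature of $\partial L$ and $\mathrm{vol}^s_{\partial L}$ its length measure. *)

(* Defs.v *)
From HB Require Import structures.
From mathcomp Require Export all_boot all_order all_algebra.
From mathcomp Require Export all_classical all_reals all_analysis.

Set Implicit Arguments.
Unset Strict Implicit.
Unset Printing Implicit Defensive.

Export Order.TTheory GRing.Theory Num.Theory.
Export numFieldNormedType.Exports.

Local Open Scope classical_set_scope.
Local Open Scope ring_scope.

Section SphericalConvexity.
Context {R : realType}.
Implicit Types (u v w c o : 'rV[R]_3) (K L A : set 'rV[R]_3).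
Implicit Types (g : R -> 'rV[R]_3).

Definition dot u v : R := \sum_(i < 3) u 0 i * v 0 i.

(* The library's norm on matrices is the sup norm. *)
Definition enorm u : R := Num.sqrt (dot u u).

Definition triple u v w : R := \det (\matrix_(i < 3) nth 0 [:: u; v; w] i).

Definition sphere : set 'rV[R]_3 := [set u | enorm u = 1].

Definition geod_dist u v : R := acos (dot u v).

Definition geod_diam A : R := sup [set geod_dist p.1 p.2 | p in A `*` A].

Definition geod_ball c (alpha : R) : set 'rV[R]_3 :=
  [set u | sphere u /\ geod_dist c u <= alpha].

(* The area of A is the surface integral over A in spherical coordinates
   (theta, phi), with area element sin theta dtheta dphi. *)
Definition spherical_coord (p : R * R) : 'rV[R]_3 :=
  \row_(i < 3) nth 0 [:: sin p.1 * cos p.2; sin p.1 * sin p.2; cos p.1] i.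

Definition area A : R :=
  Rintegral (lebesgue_measure \x lebesgue_measure)%E
    ((`[0, pi] `*` `[0, pi *+ 2]) `&` spherical_coord @^-1` A)
    (fun p : R * R => sin p.1).

(* Interior and boundary are relative to the sphere, not to R^3. *)
Definition sph_interior A : set 'rV[R]_3 :=
  [set u | sphere u /\ \forall v \near within sphere (nbhs u), A v].

Definition sph_boundary A : set 'rV[R]_3 := closure A `\` sph_interior A.

(* The minimal geodesic arc joining the non-antipodal points u and v of the
   sphere: the part of the sphere in the convex cone spanned by u and v. *)
Definition geod_arc u v : set 'rV[R]_3 :=
  [set w | sphere w /\
     exists a b : R, [/\ 0 <= a, 0 <= b & w = a *: u + b *: v]].

Definition sph_convex_body K : Prop :=
  [/\ K `<=` sphere, closed K, sph_interior K !=set0 &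
      forall u v, K u -> K v -> v != - u -> geod_arc u v `<=` K].

Definition sph_proper K : Prop :=
  exists2 e, sphere e & forall u, K u -> 0 < dot e u.

Definition point_reflection o u : 'rV[R]_3 := (2 * dot u o) *: o - u.

Definition symmetric_about o K : Prop := point_reflection o @` K = K.

Definition sph_dual K : set 'rV[R]_3 :=
  [set v | sphere v /\ forall u, K u -> 0 <= dot v u].

Definition C2 g : Prop :=
  [/\ forall t : R, derivable g t 1, forall t : R, derivable (derive1 g) t 1 &
      continuous (derive1 (derive1 g))].

Definition speed g (t : R) : R := enorm (derive1 g t).

(* Geodesic curvature, for a regular parametrization, with respect to the
   unit normal (g x g') / |g'|. *)
Definition geod_curvature g (t : R) : R :=
  triple (g t) (derive1 g t) (derive1 (derive1 g) t) / speed g t ^+ 3.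

(* g is a regular C^2 parametrization, of period 1, of the boundary of the
   convex body L as a simple closed curve.  In the last clause g x g' is the
   normal of the supporting great circle of L at g t, on the side of L: thus
   (g x g') / |g'| is the inner normal, and curvature is positive for discs
   smaller than a half-sphere. *)
Definition boundary_curve L g : Prop :=
  [/\ C2 g /\ (forall t, speed g t != 0),
      (forall t, g (t + 1) = g t) /\ {in `[0, 1[ &, injective g},
      range g = sph_boundary L &
      forall t u, L u -> 0 <= triple (g t) (derive1 g t) u].

Definition C2plus K : Prop :=
  exists2 g, boundary_curve K g & forall t, 0 < geod_curvature g t.

(* Geodesic curvature of the boundary at a point, and integral over the
   boundary with respect to its length measure.  Neither depends on the
   parametrization; both are 0 if the boundary has none. *)
Definition geod_H1 L u : R :=
  xget 0 [set k | exists g t,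
    [/\ boundary_curve L g, g t = u & k = geod_curvature g t]].

Definition boundary_integral L (f : 'rV[R]_3 -> R) : R :=
  xget 0 [set I | exists2 g, boundary_curve L g &
    I = Rintegral lebesgue_measure `[0, 1] (fun t => f (g t) * speed g t)].

Definition perimeter L : R := boundary_integral L (fun=> 1).

Definition Omega (q : R) L : R :=
  boundary_integral L (fun u => geod_H1 L u `^ (q / (2 + q))).

Definition entropy_power K : R :=
  lim ((Omega q (sph_dual K) / perimeter (sph_dual K)) `^ (1 + 2 / q)
       @[q --> (0 : R)^'+]).

Definition entropy K : R := - ln (entropy_power K).

End SphericalConvexity.

(* Main.v *)
Require Import Defs.
From mathcomp Require Import ring lra measurable_realfun.

(* Symmetry and properness put the centre o of K (up to sign) inside K and K inside the
   open half-sphere around o, so that in gnomonic polar coordinates about o the boundary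
   of K is w |-> (cos w, sin w, f w) / s with s = sqrt (1 + f^2), where f > 0 is
   pi-periodic and f + f'' > 0.  The boundary of K^* is the curve of unit normals of K,
   with curvature 1 / kappa and length element dmu = kappa ds, so that
   E(K) = (int ln kappa dmu) / M with M = int dmu.  By Gauss-Bonnet
   M = int f / s dw = 2 pi - vol K; put m = M / (2 pi), which is cos alpha for a cap of
   radius alpha and the same area.
   To bound int ln (1 / kappa) dmu from above, apply ln x <= x - 1 to two quantities that
   are constant for the cap.  The integral of the first is at most its cap value by a
   tangent line estimate in f / s.  The integral of the second is, after integration by
   parts, at most int (eta^2 - eta'^2) dw - 2 pi with eta^2 = s (s + f); here
   int eta^-2 = 2 pi (1 - m), so the integral of eta^2 - eta'^2 is at most
   2 pi / (1 - m) by the symmetric Blaschke-Santalo inequality in the plane, which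
   follows from Wirtinger's inequality.
   The area is defined in fixed spherical coordinates; its rotation invariance is
   obtained by mollifying intersections of half-spaces and differentiating under the
   integral, infinitesimal rotations being divergence free. *)

Set Implicit Arguments.
Unset Strict Implicit.
Unset Printing Implicit Defensive.

Local Open Scope classical_set_scope.
Local Open Scope ring_scope.

(** * Calculus on the real line *)

(** The two quantities are dictated by the derivatives of f. With W^2 = 1 + f^2 + f'^2, the
    curvature contains f'' and W, so ln kappa is accessible only through quantities X for which X
    dmu is free of derivatives or linear in f''. A multiple of 1 / (W kappa sqrt (1 + f / s)) is of
    the first kind, since dmu / (W kappa) = dw / s^2; a multiple of W^2 (1 + f / s) is of the
    second, since W^2 dmu = s (f + f'') dw. The square of the first times the second is a multiple
    of kappa^-2.

    A second difficulty is regularity. The curve of normals involves f' and is merely C^1 in w; it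
    becomes C^2 in a parameter proportional to a primitive of f + f''. Moreover curvature and
    boundary integrals of K^* are read off an arbitrary admissible parametrization, so every
    boundary curve of K^* has to be recognized as a reparametrization of the curve of normals. *)

Section Calculus.
Context {R : realType}.
Implicit Types (f g h : R -> R) (x a b : R).

Lemma is_derive_cstfun (c x : R) : is_derive x 1 (fun=> c) 0.
Proof. exact: is_derive_cst. Qed.

Lemma is_derive_idfun x : is_derive x 1 (fun t : R => t) 1.
Proof. exact: is_derive_id. Qed.

Lemma is_derive_add f g x df dg : is_derive x 1 f df -> is_derive x 1 g dg ->
  is_derive x 1 (fun t => f t + g t) (df + dg).
Proof. by move=> ? ?; exact: is_deriveD. Qed.

Lemma is_derive_opp f x df : is_derive x 1 f df ->
  is_derive x 1 (fun t => - f t) (- df).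
Proof. by move=> fd; exact: (@is_deriveN _ _ _ f x 1 df fd). Qed.

Lemma is_derive_mul f g x df dg : is_derive x 1 f df -> is_derive x 1 g dg ->
  is_derive x 1 (fun t => f t * g t) (f x * dg + df * g x).
Proof. by move=> ? ?; rewrite [df * _]mulrC; exact: is_deriveM. Qed.

Lemma is_derive_exprn f x df n : is_derive x 1 f df ->
  is_derive x 1 (fun t => f t ^+ n.+1) (n.+1%:R * f x ^+ n * df).
Proof.
move=> fd; elim: n => [|n IHn].
  by rewrite expr0 mulr1 mul1r; under eq_fun do rewrite expr1.
under eq_fun do rewrite exprS.
have D := is_derive_mul fd IHn; apply: (is_derive_eq D).
by rewrite -[n.+2%:R]natr1 [f x ^+ n.+1]exprS; ring.
Qed.

Lemma is_derive_inv f x df : f x != 0 -> is_derive x 1 f df ->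
  is_derive x 1 (fun t => (f t)^-1) (- df / f x ^+ 2).
Proof.
move=> f0 fd; have := @is_deriveV _ f x df 1 f0 fd.
by rewrite -[_ *: df]/(_ * df) mulNr mulrC mulNr.
Qed.

Lemma is_derive_compfun f g x df dg : is_derive (g x) 1 f df ->
  is_derive x 1 g dg -> is_derive x 1 (fun t => f (g t)) (df * dg).
Proof. by move=> ? ?; exact: is_derive1_comp. Qed.

Lemma is_derive_sinf f x df : is_derive x 1 f df ->
  is_derive x 1 (fun t => sin (f t)) (cos (f x) * df).
Proof. by move=> ?; apply: is_derive_compfun. Qed.

Lemma is_derive_cosf f x df : is_derive x 1 f df ->
  is_derive x 1 (fun t => cos (f t)) (- sin (f x) * df).
Proof. by move=> ?; apply: is_derive_compfun. Qed.

Lemma is_derive_expRf f x df : is_derive x 1 f df ->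
  is_derive x 1 (fun t => expR (f t)) (expR (f x) * df).
Proof. by move=> ?; apply: is_derive_compfun. Qed.

Lemma is_derive_atanf f x df : is_derive x 1 f df ->
  is_derive x 1 (fun t => atan (f t)) ((1 + f x ^+ 2)^-1 * df).
Proof. by move=> ?; apply: is_derive_compfun. Qed.

Lemma is_derive_sqrtf f x df : 0 < f x -> is_derive x 1 f df ->
  is_derive x 1 (fun t => Num.sqrt (f t)) ((2 * Num.sqrt (f x))^-1 * df).
Proof.
by move=> f0 fd; apply: (is_derive_compfun _ fd); exact: is_derive1_sqrt.
Qed.

Lemma is_derive_continuous f f' : (forall x, is_derive x 1 f (f' x)) ->
  continuous f.
Proof.
move=> fd x; apply: differentiable_continuous; apply/derivable1_diffP.
by have [] := fd x.
Qed.

Lemma continuous_cstfun (c : R) : continuous (fun _ : R => c).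
Proof. by move=> x; exact: cvg_cst. Qed.

Lemma continuous_idfun : continuous (fun t : R => t).
Proof. by move=> x; exact: cvg_id. Qed.

Lemma continuous_add f g : continuous f -> continuous g ->
  continuous (fun t => f t + g t).
Proof. by move=> fc gc x; apply: cvgD; [exact: fc|exact: gc]. Qed.

Lemma continuous_opp f : continuous f -> continuous (fun t => - f t).
Proof. by move=> fc x; apply: cvgN; exact: fc. Qed.

Lemma continuous_mul f g : continuous f -> continuous g ->
  continuous (fun t => f t * g t).
Proof. by move=> fc gc x; apply: cvgM; [exact: fc|exact: gc]. Qed.

Lemma continuous_exprn f n : continuous f -> continuous (fun t => f t ^+ n).
Proof.
move=> fc; elim: n => [|n IHn]; first exact: continuous_cstfun.
under eq_fun do rewrite exprS.
exact: continuous_mul.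
Qed.

Lemma continuous_inv f : (forall x, f x != 0) -> continuous f ->
  continuous (fun t => (f t)^-1).
Proof. by move=> f0 fc x; apply: cvgV => //; exact: fc. Qed.

Lemma continuous_compfun f g : continuous f -> continuous g ->
  continuous (fun t => f (g t)).
Proof. by move=> fc gc x; apply: continuous_comp; [exact: gc|exact: fc]. Qed.

Lemma continuous_sinf f : continuous f -> continuous (fun t => sin (f t)).
Proof. by apply: continuous_compfun; exact: continuous_sin. Qed.

Lemma continuous_cosf f : continuous f -> continuous (fun t => cos (f t)).
Proof. by apply: continuous_compfun; exact: continuous_cos. Qed.

Lemma continuous_sqrtf f : continuous f -> continuous (fun t => Num.sqrt (f t)).
Proof. by apply: continuous_compfun; exact: sqrt_continuous. Qed.

Lemma continuous_expRf f : continuous f -> continuous (fun t => expR (f t)).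
Proof. by apply: continuous_compfun; exact: continuous_expR. Qed.

Lemma continuous_lnf f : (forall x, 0 < f x) -> continuous f ->
  continuous (fun t => ln (f t)).
Proof.
move=> f0 fc x; apply: continuous_comp; first exact: fc.
exact: continuous_ln.
Qed.

End Calculus.

(** [is_derive] is a type class; [notypeclasses] keeps instance search from choosing the derivative.
    The premises stay as goals for [isder], which builds it structurally, and the comparison with
    the claimed derivative is left to [ring] or [field]. *)
Ltac isderE := notypeclasses refine (is_derive_eq _ _).

Ltac isder :=
  lazymatch goal with
  | |- is_derive _ _ (fun _ => ?c) _ => exact: is_derive_cstfun
  | |- is_derive _ _ (fun t => t) _ => exact: is_derive_idfun
  | |- is_derive _ _ (fun t => @?f t + @?g t) _ =>
      notypeclasses refine (@is_derive_add _ f g _ _ _ _ _); isder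
  | |- is_derive _ _ (fun t => - @?f t) _ => notypeclasses refine (@is_derive_opp _ f _ _ _); isder
  | |- is_derive _ _ (fun t => @?f t * @?g t) _ =>
      notypeclasses refine (@is_derive_mul _ f g _ _ _ _ _); isder
  | |- is_derive _ _ (fun t => @?f t ^+ _) _ =>
      notypeclasses refine (@is_derive_exprn _ f _ _ _ _); isder
  | |- is_derive _ _ (fun t => (@?f t)^-1) _ => notypeclasses refine (@is_derive_inv _ f _ _ _ _); isder
  | |- is_derive _ _ (fun t => sin (@?f t)) _ => notypeclasses refine (@is_derive_sinf _ f _ _ _); isder
  | |- is_derive _ _ (fun t => cos (@?f t)) _ => notypeclasses refine (@is_derive_cosf _ f _ _ _); isder
  | |- is_derive _ _ (fun t => atan (@?f t)) _ => notypeclasses refine (@is_derive_atanf _ f _ _ _); isder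
  | |- is_derive _ _ (fun t => expR (@?f t)) _ => notypeclasses refine (@is_derive_expRf _ f _ _ _); isder
  | |- is_derive _ _ (fun t => Num.sqrt (@?f t)) _ =>
      notypeclasses refine (@is_derive_sqrtf _ f _ _ _ _); isder
  | |- is_derive _ _ _ _ =>
      match goal with H : forall x, is_derive x 1 _ _ |- _ => exact: H end
  | |- _ => cbn beta; try assumption; try match goal with H : forall _, _ |- _ => exact: H end
  end.

Ltac iscont :=
  lazymatch goal with
  | |- continuous (fun _ => ?c) => exact: continuous_cstfun
  | |- continuous (fun t => t) => exact: continuous_idfun
  | |- continuous (fun t => @?f t + @?g t) => apply: (@continuous_add _ f g); iscont
  | |- continuous (fun t => - @?f t) => apply: (@continuous_opp _ f); iscont
  | |- continuous (fun t => @?f t * @?g t) => apply: (@continuous_mul _ f g); iscont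
  | |- continuous (fun t => @?f t ^+ ?n) => apply: (@continuous_exprn _ f n); iscont
  | |- continuous (fun t => (@?f t)^-1) => apply: (@continuous_inv _ f); iscont
  | |- continuous (fun t => sin (@?f t)) => apply: (@continuous_sinf _ f); iscont
  | |- continuous (fun t => cos (@?f t)) => apply: (@continuous_cosf _ f); iscont
  | |- continuous (fun t => expR (@?f t)) => apply: (@continuous_expRf _ f); iscont
  | |- continuous (fun t => ln (@?f t)) => apply: (@continuous_lnf _ f); iscont
  | |- continuous (fun t => Num.sqrt (@?f t)) => apply: (@continuous_sqrtf _ f); iscont
  | |- continuous (fun t => ?h t) => first
     [ match goal with H : continuous ?f |- _ => constr_eq f h; exact: H end
     | match goal with H : forall x, is_derive x 1 ?f _ |- _ =>
         constr_eq f h; exact: (is_derive_continuous H) end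
     | assumption
     | match goal with H : forall x, is_derive x 1 ?f _ |- _ =>
         unify f h; exact: (is_derive_continuous H) end ]
  | |- continuous _ => first [assumption
     | match goal with H : forall x, is_derive x 1 ?f _ |- continuous ?g =>
         unify f g; exact: (is_derive_continuous H) end]
  | |- _ => cbn beta; try assumption; try match goal with H : forall _, _ |- _ => exact: H end
  end.

(** * Integrals and primitives of continuous functions *)

Section Integral.
Context {R : realType}.
Implicit Types (f g h : R -> R) (x a b : R).

Definition itg a b h : R := Rintegral (@lebesgue_measure R) `[a, b] h.

Lemma itg_FTC a b h H : a <= b -> continuous h ->
  (forall x, is_derive x 1 H (h x)) -> itg a b h = H b - H a.
Proof.
rewrite le_eqVlt => /predU1P[<-|ab] hc Hd.
  by rewrite /itg set_itv1 Rintegral_set1 subrr.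
have Hc := is_derive_continuous Hd.
rewrite /itg /Rintegral (@continuous_FTC2 _ h H)//.
- exact: continuous_subspaceT.
- split.
  + by move=> x _; have [] := Hd x.
  + by apply: cvg_at_right_filter; exact: Hc.
  + by apply: cvg_at_left_filter; exact: Hc.
- by move=> x _; rewrite derive1E; have [_ ->] := Hd x.
Qed.

Lemma continuous_integrable a b h : continuous h ->
  (@lebesgue_measure R).-integrable `[a, b] (EFin \o h).
Proof.
move=> hc; apply: continuous_compact_integrable; first exact: segment_compact.
exact: continuous_subspaceT.
Qed.

(** One primitive on the whole line turns integrals over different intervals into differences of the
    same function, which is what the periodicity arguments use. It is glued from integrals with
    finite base points. *)
Lemma continuous_primitive h : continuous h ->
  exists H, forall x, is_derive x 1 H (h x).
Proof.
move=> hc.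
pose F N x := itg (- N) x h.
have FN N x : - N < x -> is_derive x 1 (F N) (h x).
  move=> Nx; have x1 : x < x + 1 by rewrite ltrDl.
  have [Fd F'] := @continuous_FTC1_closed R h (- N) x (x + 1) x1
    (@continuous_integrable (- N) (x + 1) h hc) Nx (hc x).
  by apply: DeriveDef; [exact: Fd|rewrite -derive1E; exact: F'].
(* The integral from 0 to [x], with a base point to the left of both. By [cst] the choice of base
   point is immaterial, and the margin 2 keeps it admissible for all points within distance 1 of
   [x]. *)
pose G x := F (`|x| + 2) x - F (`|x| + 2) 0.
exists G => x.
have GE y N : 0 < N -> `|y| < N -> G y = F N y - F N 0.
  move=> N0 yN.
  have yN2 : - N < y by move: yN; rewrite ltr_norml => /andP[].
  have cst N' z z' : 0 < N' -> - N < z -> - N < z' ->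
     - N' < z -> - N' < z' ->
     F N z - F N' z = F N z' - F N' z'.
    move=> N'0.
    wlog zz : z z' / z < z'.
      move=> W h1 h2 h3 h4; have [zz|zz|->//] := ltgtP z z'; first exact: W.
      by apply/esym; exact: W.
    move=> h1 h2 h3 h4.
    have D w : w \in `]z, z'[ ->
        is_derive w 1 (fun t => F N t + - F N' t) (0 : R).
      rewrite in_itv/= => /andP[w1 w2].
      apply: is_derive_eq; last exact: (subrr (h w)).
      apply: is_derive_add; last apply: is_derive_opp.
        by apply: FN; lra.
      by apply: FN; lra.
    have D' w : w \in `[z, z'] ->
        derivable (fun t => F N t + - F N' t) w 1.
      rewrite in_itv/= => /andP[w1 w2].
      have [|] := @FN N w; first lra.
      move=> /derivableP d1 _; have [|] := @FN N' w; first lra.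
      move=> /derivableP d2 _.
      by have [] := is_derive_add d1 (is_derive_opp d2).
    have [c _ ] := @MVT R _ (fun=> 0) z z' zz D (derivable_within_continuous D').
    by rewrite mul0r => /eqP; rewrite subr_eq0 => /eqP.
  have := cst (`|y| + 2) y 0; rewrite /G.
  have n0 := normr_ge0 y; have n1 := ler_norm (- y); rewrite normrN in n1.
  by move=> cs; have := cs _ _ _ _ _; lra.
apply: (@near_eq_is_derive _ _ _ (fun t => F (`|x| + 2) t - F (`|x| + 2) 0)).
- near=> y; have G1 : 0 < `|x : R| + 2 by rewrite ltr_wpDl.
  have yx : `|(y : R) - x| < 1 by rewrite distrC; near: y; exact: cvgr_dist_lt.
  have G2 : `|y : R| < `|x : R| + 2.
    by have := ler_normD ((y : R) - x) x; rewrite subrK; lra.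
  by rewrite (GE y _ G1 G2).
- have xN : - (`|x : R| + 2) < x.
    by have := ler_norm (- (x : R)); rewrite normrN; lra.
  have D := is_derive_add (FN _ _ xN) (is_derive_cstfun (- F (`|x : R| + 2) 0) x).
  by apply: (is_derive_eq D); rewrite addr0.
Unshelve. all: by end_near. Qed.

Lemma itgD a b f g : continuous f -> continuous g ->
  itg a b (fun t => f t + g t) = itg a b f + itg a b g.
Proof. by move=> fc gc; apply: RintegralD => //; exact: continuous_integrable. Qed.

Lemma itgZ a b (k : R) f : continuous f ->
  itg a b (fun t => k * f t) = k * itg a b f.
Proof. by move=> fc; apply: RintegralZl => //; exact: continuous_integrable. Qed.

Lemma itg_cst a b (k : R) : a <= b -> itg a b (fun=> k) = k * (b - a).
Proof.
move=> ab; have D x : is_derive x 1 (fun t => k * t) k.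
  by isderE; [isder|cbn beta; ring].
by rewrite (itg_FTC ab (@continuous_cstfun R k) D); ring.
Qed.

Lemma le_itg a b f g : continuous f -> continuous g ->
  (forall x, f x <= g x) -> itg a b f <= itg a b g.
Proof.
by move=> fc gc fg; apply: le_Rintegral => //; exact: continuous_integrable.
Qed.

Lemma le_itg_cc a b f g : continuous f -> continuous g ->
  (forall x, a <= x <= b -> f x <= g x) -> itg a b f <= itg a b g.
Proof.
move=> fc gc fg; by apply: le_Rintegral => //; exact: continuous_integrable.
Qed.

Lemma itg_gt0 a b f : a < b -> continuous f -> (forall x, 0 < f x) ->
  0 < itg a b f.
Proof.
move=> ab fc f0.
have [H Hd] := continuous_primitive fc.
rewrite (itg_FTC (ltW ab) fc Hd).
have [|x _ ->] := @MVT R H f a b ab (fun x _ => Hd x).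
  by apply: continuous_subspaceT; exact: is_derive_continuous Hd.
by rewrite mulr_gt0// subr_gt0.
Qed.

Lemma eq_itg a b f g : f =1 g -> itg a b f = itg a b g.
Proof. by move=> fg; congr itg; exact/funext. Qed.

Lemma eq_derive_cst f g k : (forall x, is_derive x 1 f (k x)) ->
  (forall x, is_derive x 1 g (k x)) -> forall x y, f x - g x = f y - g y.
Proof.
move=> fd gd x y; apply: (@is_derive_0_is_cst R (fun t => f t - g t)) => z.
by apply: (is_derive_eq (is_derive_add (fd z) (is_derive_opp (gd z)))); rewrite subrr.
Qed.

Lemma primitive_periodic h H T : (forall x, is_derive x 1 H (h x)) ->
  (forall x, h (x + T) = h x) -> forall x y, H (x + T) - H x = H (y + T) - H y.
Proof.
move=> Hd hT; apply: (@eq_derive_cst (fun x => H (x + T)) H h) => // x.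
have D : is_derive x 1 (fun t => t + T) 1 by isderE; [isder|rewrite addr0].
have := @is_derive_compfun _ H (fun t => t + T) x _ _ (Hd (x + T)) D.
by rewrite mulr1 hT.
Qed.

Lemma itg_periodic h T a b : 0 <= T -> continuous h ->
  (forall x, h (x + T) = h x) -> itg a (a + T) h = itg b (b + T) h.
Proof.
move=> T0 hc hT; have [H Hd] := continuous_primitive hc.
by rewrite !(itg_FTC _ hc Hd) ?lerDl//; exact: primitive_periodic Hd hT _ _.
Qed.

Lemma itg_shift (h : R -> R) T c : 0 <= T -> continuous h -> (forall x, h (x + T) = h x) ->
  itg 0 T (fun y => h (y + c)) = itg 0 T h.
Proof.
move=> T0 hc hT; have [H Hd] := continuous_primitive hc.
have Dc (x : R) : is_derive x 1 (fun y => y + c) 1 by isderE; [isder|rewrite addr0].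
have Hd' (x : R) : is_derive x 1 (fun y => H (y + c)) (h (x + c)).
  by have := @is_derive_compfun _ H (fun y => y + c) x _ _ (Hd (x + c)) (Dc x); rewrite mulr1.
have hc' : continuous (fun y => h (y + c)).
  by apply: (@continuous_compfun _ h (fun y => y + c)) => //; exact: is_derive_continuous Dc.
rewrite (itg_FTC T0 hc' Hd') (itg_FTC T0 hc Hd) (addrC T) (addrC 0 c) addr0.
by rewrite (primitive_periodic Hd hT c 0) add0r.
Qed.

Lemma itg_cat a b c h : a <= b -> b <= c -> continuous h ->
  itg a c h = itg a b h + itg b c h.
Proof.
move=> ab bc hc; have [H Hd] := continuous_primitive hc.
by rewrite !(itg_FTC _ hc Hd) ?(le_trans ab)//; ring.
Qed.

Lemma derive_gt0_lt f f' : (forall x, is_derive x 1 f (f' x)) ->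
  (forall x, 0 < f' x) -> forall x y, x < y -> f x < f y.
Proof.
move=> fd f0 x y xy.
have [|z _ ] := @MVT R f f' x y xy (fun x _ => fd x).
  by apply: continuous_subspaceT; exact: is_derive_continuous fd.
by rewrite -[f x < _]subr_gt0 => ->; rewrite mulr_gt0// subr_gt0.
Qed.

Lemma derive_ge0_le f f' a b : a <= b -> (forall x, is_derive x 1 f (f' x)) ->
  (forall x, a <= x <= b -> 0 <= f' x) -> f a <= f b.
Proof.
rewrite le_eqVlt => /predU1P[->//|ab] fd f0.
have [|z + ] := @MVT R f f' a b ab (fun x _ => fd x).
  by apply: continuous_subspaceT; exact: is_derive_continuous fd.
rewrite in_itv/= => /andP[z1 z2].
rewrite -[f a <= _]subr_ge0 => ->; apply: mulr_ge0; last by rewrite subr_ge0 ltW.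
by apply: f0; rewrite !ltW.
Qed.

(* S(x + T) = S(x) + l makes S onto, hence a bijection of the line. *)
Lemma quasiperiodic_inverse (S S' : R -> R) (T l : R) : (forall x, is_derive x 1 S (S' x)) ->
  (forall x, 0 < S' x) -> 0 < T -> (forall x, S (x + T) = S x + l) ->
  exists s : R -> R, [/\ cancel S s, cancel s S,
    (forall y : R, is_derive y 1 s (S' (s y))^-1) & forall y, s (y + l) = s y + T].
Proof.
move=> Sd S0 T0 Sl.
have Sinc := derive_gt0_lt Sd S0.
have Sc := is_derive_continuous Sd.
have l0 : 0 < l.
  have : S 0 < S (0 + T) by apply: Sinc; lra.
  by rewrite Sl; lra.
have Sn n x : S (x + n%:R * T) = S x + n%:R * l.
  elim: n => [|n IHn]; first by rewrite !mul0r !addr0.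
  rewrite -natr1 [(_ + 1) * T]mulrDl mul1r addrA Sl IHn; ring.
have Ssurj y : exists x, S x = y.
  (* Over [n] periods [S] moves by more than the distance from [S 0] to [y], so [y] lies between the
     values at [- n T] and [n T]. *)
  pose n := (Num.truncn (`|y - S 0| / l)).+1.
  have nl : `|y - S 0| < n%:R * l.
    by rewrite -ltr_pdivrMr// /n truncnS_gt.
  have A1 : S (n%:R * T) = S 0 + n%:R * l by rewrite -{1}[_ * T]add0r Sn.
  have A2 : S 0 = S (- (n%:R * T)) + n%:R * l.
    by rewrite -Sn addNr.
  have nT : 0 <= n%:R * T by rewrite mulr_ge0// ltW.
  move: nl; rewrite ltr_norml => /andP[n1 n2].
  have [|||x _ xy] := @IVT R S (- (n%:R * T)) (n%:R * T) y.
  - lra.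
  - exact: continuous_subspaceT.
  - by rewrite ge_min le_max; apply/andP; split; apply/orP; [left|right]; lra.
  - by exists x.
pose s y := xget 0 [set x | S x = y].
have sK : cancel s S by move=> y; rewrite /s; case: xgetP => // /(_ _ _) H; have [x xy] := Ssurj y; case: (H x xy).
have Sinj : injective S.
  by move=> x y; have [/Sinc|/Sinc|//] := ltgtP x y; move=> + e; rewrite e ltxx.
have Ks : cancel S s by move=> x; apply: Sinj; rewrite sK.
exists s; split => // y.
- have nK : {near s y, cancel S s} by near=> z; exact: Ks.
  have nc : {near s y, continuous S} by near=> z; exact: Sc.
  have n0 : S' (s y) != 0 by rewrite gt_eqF.
  by have := is_derive_inverse nK nc (Sd (s y)) n0; rewrite sK.
- by apply: Sinj; rewrite sK Sl sK.
Unshelve. all: by end_near. Qed.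

End Integral.

(** * Wirtinger's inequality *)

Section Wirtinger.
Context {R : realType}.
Implicit Types (V eta g : R -> R).

Lemma cosDpi' (x : R) : cos (x + pi) = - cos x.
Proof. exact: cosDpi. Qed.

Lemma sinDpi' (x : R) : sin (x + pi) = - sin x.
Proof. exact: sinDpi. Qed.

(** The affine map sends [c, c + pi] onto a centred interval of length l pi strictly inside (0, pi).
    Hence [wirtinger_interval] can divide by this sine up to the endpoints; the sharp constant is
    recovered by letting [l] approach 1. *)
Lemma sin_gt0_interior (l c x : R) : 0 < l < 1 -> c <= x <= c + pi ->
  0 < sin (l * (x - c) + (1 - l) * pi / 2).
Proof.
move=> /andP[l0 l1] /andP[cx xc]; have p0 := pi_gt0 R.
apply: sin_gt0_pi; apply/andP; split.
  apply: ltr_wpDl; first by rewrite mulr_ge0// ?subr_ge0// ltW.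
  by rewrite divr_gt0// mulr_gt0// subr_gt0.
have : l * (x - c) <= l * pi by rewrite ler_pM2l//; lra.
move=> h; apply: (le_lt_trans (y := l * pi + (1 - l) * pi / 2)); first by lra.
rewrite -subr_gt0.
have -> : pi - (l * pi + (1 - l) * pi / 2) = (1 - l) * pi / 2 by lra.
by rewrite divr_gt0// mulr_gt0// subr_gt0.
Qed.

(* Picone: with k = l cot(l(x - c) + e) one has V'^2 - l^2 V^2 = (V' - k V)^2 + (k V^2)'. *)
Lemma wirtinger_interval V V' (c l : R) : (forall x : R, is_derive x 1 V (V' x)) ->
  continuous V' -> V c = 0 -> V (c + pi) = 0 -> 0 < l < 1 ->
  itg c (c + pi) (fun x => l ^+ 2 * V x ^+ 2) <= itg c (c + pi) (fun x => V' x ^+ 2).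
Proof.
move=> Vd V'c Vc Vcp l01; have p0 := pi_gt0 R.
have Vct := is_derive_continuous Vd.
pose S x := sin (l * (x - c) + (1 - l) * pi / 2).
pose C x := cos (l * (x - c) + (1 - l) * pi / 2).
have [P Pd] : exists P, forall x : R, is_derive x 1 P (V' x ^+ 2 - l ^+ 2 * V x ^+ 2).
  by apply: continuous_primitive; iscont.
have [Q Qd] : exists Q, forall x : R, is_derive x 1 Q (V' x ^+ 2).
  by apply: continuous_primitive; iscont.
have [N Nd] : exists N, forall x : R, is_derive x 1 N (l ^+ 2 * V x ^+ 2).
  by apply: continuous_primitive; iscont.
have cc : c <= c + pi by rewrite lerDl ltW.
rewrite (itg_FTC cc _ Nd); last by iscont.
rewrite (itg_FTC cc _ Qd); last by iscont.
have Sgt x : c <= x <= c + pi -> 0 < S x by exact: sin_gt0_interior.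
have Sd (x : R) : is_derive x 1 S (l * C x).
  by isderE; [rewrite /S; isder|cbn beta; rewrite /C; ring].
have Cd (x : R) : is_derive x 1 C (- (l * S x)).
  by isderE; [rewrite /C; isder|cbn beta; rewrite /S; ring].
pose G x := Q x - N x - l * C x * V x ^+ 2 / S x.
have Gd (x : R) : c <= x <= c + pi -> is_derive x 1 G ((V' x - l * C x / S x * V x) ^+ 2).
  move=> xc; have S0 : S x != 0 by rewrite gt_eqF// Sgt.
  isderE; first by rewrite /G; isder.
  cbn beta.
  by field.
have : G c <= G (c + pi).
  have cpi : c < c + pi by rewrite ltrDl.
  have D x : x \in `]c, (c + pi)[ ->
      is_derive (x : R) 1 G ((V' x - l * C x / S x * V x) ^+ 2).
    by rewrite in_itv/= => /andP[? ?]; apply: Gd; rewrite !ltW.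
  have W : {within `[c, c + pi], continuous G}.
    apply: derivable_within_continuous => x; rewrite in_itv/= => xc.
    by have [] := Gd x xc.
  have [z _ e] := MVT_segment cc D W.
  by rewrite -subr_ge0 e mulr_ge0 ?sqr_ge0//; lra.
rewrite /G Vc Vcp !expr0n/= !mulr0 !mul0r !subr0; lra.
Qed.

(** Antiperiodicity forces a zero [c], hence zero values at both ends of [c, c + pi]; as V^2 and
    V'^2 are pi-periodic, the full integrals are twice those over this interval. *)
Lemma wirtinger V V' : (forall x : R, is_derive x 1 V (V' x)) -> continuous V' ->
  (forall x, V (x + pi) = - V x) ->
  itg 0 (pi *+ 2) (fun x => V x ^+ 2) <= itg 0 (pi *+ 2) (fun x => V' x ^+ 2).
Proof.
move=> Vd V'c Vpi; have p0 := pi_gt0 R.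
have Vct := is_derive_continuous Vd.
have V'pi x : V' (x + pi) = - V' x.
  have d1 : is_derive x 1 (fun t => V (t + pi)) (V' (x + pi)).
    have D : is_derive x 1 (fun t : R => t + pi) 1 by isderE; [isder|rewrite addr0].
    by have := @is_derive_compfun _ V (fun t => t + pi) x _ _ (Vd (x + pi)) D; rewrite mulr1.
  have d2 : is_derive x 1 (fun t => V (t + pi)) (- V' x).
    by under eq_fun do rewrite Vpi; exact: is_derive_opp.
  by have [_ <-] := d1; have [_ <-] := d2.
have [c Vc] : exists c, V c = 0.
  have [||c _ Vc] := @IVT R V 0 pi 0 (ltW p0); last by exists c.
    exact: continuous_subspaceT.
  have -> : V pi = - V 0 by rewrite -Vpi add0r.
  by rewrite ge_min le_max; have [v0|v0] := leP 0 (V 0); apply/andP; split; apply/orP; lra.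
have dbl g : continuous g -> (forall x, g (x + pi) = g x) ->
    itg 0 (pi *+ 2) g = 2 * itg c (c + pi) g.
  move=> gc gp; have pp : pi <= pi *+ 2 :> R by rewrite mulr2n lerDl ltW.
  rewrite (itg_cat (ltW p0) pp gc).
  have := itg_periodic 0 c (ltW p0) gc gp; have := itg_periodic pi c (ltW p0) gc gp.
  by rewrite add0r mulr2n => -> ->; ring.
rewrite !dbl//; try by [iscont|move=> x; rewrite ?Vpi ?V'pi sqrrN].
rewrite ler_pM2l//.
set A := itg _ _ _; set B := itg _ _ _.
have A0 : 0 <= A.
  by rewrite /A /itg; apply: Rintegral_ge0 => x _; exact: sqr_ge0.
have lA l : 0 < l < 1 -> l ^+ 2 * A <= B.
  move=> l01; rewrite /A -itgZ; last by iscont.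
  by apply: wirtinger_interval => //; rewrite Vpi Vc oppr0.
rewrite leNgt; apply/negP => BA.
have A1 : 0 < A by apply: le_lt_trans BA; rewrite /B /itg; apply: Rintegral_ge0 => x _; exact: sqr_ge0.
(* If B < A, then l^2 lies strictly between B / A and 1, and l^2 A = (A + B) / 2 exceeds B. *)
pose l := Num.sqrt ((A + B) / (2 * A)).
have B0 : 0 <= B by rewrite /B /itg; apply: Rintegral_ge0 => x _; exact: sqr_ge0.
have q0 : 0 < (A + B) / (2 * A) by rewrite divr_gt0//; lra.
have l2 : l ^+ 2 = (A + B) / (2 * A) by rewrite sqr_sqrtr// ltW.
have q1 : (A + B) / (2 * A) < 1 by rewrite ltr_pdivrMr; lra.
have l0 : 0 < l by rewrite sqrtr_gt0.
have l1 : l < 1 by rewrite -[1]sqrtr1 ltr_sqrt.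
have := lA l; rewrite l0 l1 l2 => /(_ isT).
have -> : (A + B) / (2 * A) * A = (A + B) / 2 by field; rewrite gt_eqF.
lra.
Qed.

(* Wirtinger's inequality for eta sin(w tau) and eta cos(w tau), where tau' = eta^-2
   and w makes these functions change sign over a half period.  For eta the inverse
   of the support function this is the symmetric planar Blaschke-Santalo inequality. *)
Lemma santalo_weight eta eta' : (forall x : R, is_derive x 1 eta (eta' x)) ->
  continuous eta' -> (forall x, 0 < eta x) -> (forall x, eta (x + pi) = eta x) ->
  itg 0 (pi *+ 2) (fun x => eta x ^+ 2 - eta' x ^+ 2) <=
  4 * pi ^+ 2 / itg 0 (pi *+ 2) (fun x => (eta x ^+ 2)^-1).
Proof.
move=> ed e'c e0 epi; have p0 := pi_gt0 R.
have ec := is_derive_continuous ed.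
have en x : eta x != 0 by rewrite gt_eqF.
have e2n x : eta x ^+ 2 != 0 by rewrite expf_neq0.
have ivc : continuous (fun x => (eta x ^+ 2)^-1) by iscont.
have [tau td] := continuous_primitive ivc.
set T := itg _ _ (fun x => (eta x ^+ 2)^-1).
have pp : 0 < pi *+ 2 :> R by rewrite mulrn_wgt0.
have T0 : 0 < T by apply: itg_gt0 => // x; rewrite invr_gt0 exprn_gt0.
have taupi x : tau (x + pi) = tau x + T / 2.
  have h y : tau (y + pi) - tau y = tau (x + pi) - tau x.
    by apply: (primitive_periodic td) => z; rewrite epi.
  have : T = tau (pi *+ 2) - tau 0 by rewrite /T (itg_FTC _ ivc td)// ltW.
  have := h 0; have := h pi; rewrite add0r mulr2n; lra.
(* [tau] gains T / 2 over a half period, so this factor makes [w * tau] gain exactly pi. *)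
pose w := 2 * pi / T.
pose V1 x := eta x * sin (w * tau x); pose V2 x := eta x * cos (w * tau x).
pose V1' x := eta' x * sin (w * tau x) + w / eta x * cos (w * tau x).
pose V2' x := eta' x * cos (w * tau x) - w / eta x * sin (w * tau x).
have d1 (x : R) : is_derive x 1 V1 (V1' x).
  by isderE; [rewrite /V1; isder|cbn beta; rewrite /V1'; field].
have d2 (x : R) : is_derive x 1 V2 (V2' x).
  by isderE; [rewrite /V2; isder|cbn beta; rewrite /V2'; field].
have c1 : continuous V1' by rewrite /V1'; iscont.
have c2 : continuous V2' by rewrite /V2'; iscont.
have wT x : w * tau (x + pi) = w * tau x + pi.
  by rewrite taupi mulrDr; congr (_ + _); rewrite /w; field; rewrite gt_eqF.
have W1 := wirtinger d1 c1; have W2 := wirtinger d2 c2.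
have := lerD (W1 _) (W2 _).
rewrite -!itgD; try by iscont.
rewrite (@eq_itg _ _ _ _ (fun x => eta x ^+ 2)); last first.
  by move=> x; rewrite /V1 /V2 -[RHS]mulr1 -(cos2Dsin2 (w * tau x)); ring.
have -> : itg 0 (pi *+ 2) (fun t => V1' t ^+ 2 + V2' t ^+ 2) =
    itg 0 (pi *+ 2) (fun x => eta' x ^+ 2 + w ^+ 2 * (eta x ^+ 2)^-1).
  apply: eq_itg => x; rewrite /V1' /V2'.
  transitivity ((eta' x ^+ 2 + w ^+ 2 * (eta x ^+ 2)^-1) * (cos (w * tau x) ^+ 2 + sin (w * tau x) ^+ 2)).
    by field.
  by rewrite cos2Dsin2 mulr1.
move=> W.
have {}W : itg 0 (pi *+ 2) (fun x => eta x ^+ 2) <= itg 0 (pi *+ 2) (fun x => eta' x ^+ 2 + w ^+ 2 * (eta x ^+ 2)^-1).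
  apply: W => x.
    by rewrite /V1 epi wT sinDpi' mulrN.
  by rewrite /V2 epi wT cosDpi' mulrN.
move: W; rewrite itgD; [|by iscont|by iscont].
rewrite itgZ// -/T.
have -> : w ^+ 2 * T = 4 * pi ^+ 2 / T by rewrite /w; field; rewrite gt_eqF.
have -> : itg 0 (pi *+ 2) (fun x => eta x ^+ 2 - eta' x ^+ 2) =
    itg 0 (pi *+ 2) (fun x => eta x ^+ 2) - itg 0 (pi *+ 2) (fun x => eta' x ^+ 2).
  rewrite itgD; [|by iscont|by iscont]; congr (_ + _).
  rewrite (@eq_itg _ _ _ _ (fun x => -1 * eta' x ^+ 2)); last by move=> x; rewrite mulN1r.
  by rewrite itgZ; [rewrite mulN1r|iscont].
lra.
Qed.

End Wirtinger.

(** * The entropy inequality for the radial function *)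

Section RadialFunction.
Context {R : realType}.
Implicit Types (f g : R -> R).

Lemma derive_periodic f f' (T : R) : (forall x : R, is_derive x 1 f (f' x)) ->
  (forall x, f (x + T) = f x) -> forall x, f' (x + T) = f' x.
Proof.
move=> fd fT x.
have D : is_derive x 1 (fun t : R => t + T) 1 by isderE; [isder|rewrite addr0].
have d1 : is_derive x 1 (fun t => f (t + T)) (f' (x + T)).
  by have := @is_derive_compfun _ f (fun t => t + T) x _ _ (fd (x + T)) D; rewrite mulr1.
have d2 : is_derive x 1 (fun t => f (t + T)) (f' x).
  by under eq_fun do rewrite fT; exact: fd.
by have [_ <-] := d1; have [_ <-] := d2.
Qed.

Lemma itg_derive_periodic f f' (T : R) : 0 <= T ->
  (forall x : R, is_derive x 1 f (f' x)) -> continuous f' ->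
  (forall x, f (x + T) = f x) -> itg 0 T f' = 0.
Proof.
by move=> T0 fd f'c fT; rewrite (itg_FTC T0 f'c fd) -[T]add0r fT subrr.
Qed.

Lemma ln_le_subr1 (x : R) : 0 < x -> ln x <= x - 1.
Proof.
by move=> x0; have := @le_ln1Dx R (x - 1); rewrite (addrC 1) subrK; apply; lra.
Qed.

(* The boundary of the body is (cos w, sin w, f w) / slant f w in a frame with
   third vector o: 1 / f is the radial function of the gnomonic image.  curvds is
   curvature times speed. *)
Definition slant f (x : R) : R := Num.sqrt (1 + f x ^+ 2).

Definition slant2 f f' (x : R) : R := Num.sqrt (1 + f x ^+ 2 + f' x ^+ 2).

Definition curv f f' f2 (x : R) : R :=
  (f x + f2 x) * slant f x ^+ 3 / slant2 f f' x ^+ 3.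

Definition curvds f f' f2 (x : R) : R :=
  (f x + f2 x) * slant f x / slant2 f f' x ^+ 2.

Section FixedFunction.
Variables (f f' f2 : R -> R).
Hypothesis fd : forall x : R, is_derive x 1 f (f' x).
Hypothesis f'd : forall x : R, is_derive x 1 f' (f2 x).
Hypothesis f2c : continuous f2.
Hypothesis f0 : forall x, 0 < f x.
Hypothesis ff0 : forall x, 0 < f x + f2 x.

Let s := slant f.
Let W := slant2 f f'.
Let z x := f x / s x.

Lemma oneDsqr_gt0 x : 0 < 1 + f x ^+ 2.
Proof. by have := sqr_ge0 (f x); lra. Qed.

Lemma oneDsqr2_gt0 x : 0 < 1 + f x ^+ 2 + f' x ^+ 2.
Proof. by have := sqr_ge0 (f x); have := sqr_ge0 (f' x); lra. Qed.

Lemma slant_gt0 x : 0 < s x. Proof. by rewrite sqrtr_gt0 oneDsqr_gt0. Qed.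

Lemma slant2_gt0 x : 0 < W x. Proof. by rewrite sqrtr_gt0 oneDsqr2_gt0. Qed.

Lemma slant_neq0 x : s x != 0. Proof. by rewrite gt_eqF// slant_gt0. Qed.

Lemma slant2_neq0 x : W x != 0. Proof. by rewrite gt_eqF// slant2_gt0. Qed.

Lemma sqr_slant x : s x ^+ 2 = 1 + f x ^+ 2.
Proof. by rewrite sqr_sqrtr// ltW// oneDsqr_gt0. Qed.

Lemma sqr_slant2 x : W x ^+ 2 = 1 + f x ^+ 2 + f' x ^+ 2.
Proof. by rewrite sqr_sqrtr// ltW// oneDsqr2_gt0. Qed.

Lemma slant_gtf x : f x < s x.
Proof.
rewrite -(ltr_pXn2r (n := 2))// ?nnegrE ?ltW ?slant_gt0//.
by rewrite sqr_slant; lra.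
Qed.

Lemma is_derive_slant (x : R) : is_derive x 1 s (f x * f' x / s x).
Proof.
have h := oneDsqr_gt0.
isderE; first by rewrite /s /slant; isder.
by cbn beta; rewrite -/(slant f x) -/(s x); field; exact: slant_neq0.
Qed.

Lemma is_derive_slant2 (x : R) : is_derive x 1 W (f' x * (f x + f2 x) / W x).
Proof.
have h := oneDsqr2_gt0.
isderE; first by rewrite /W /slant2; isder.
by cbn beta; rewrite -/(slant2 f f' x) -/(W x); field; exact: slant2_neq0.
Qed.

Let sd := is_derive_slant.
Let Wd := is_derive_slant2.
Let sn := slant_neq0.
Let Wn := slant2_neq0.
Let pp : 0 < pi *+ 2 :> R.
Proof. by rewrite mulrn_wgt0// pi_gt0. Qed.

Lemma continuous_slant : continuous s.
Proof. exact: is_derive_continuous sd. Qed.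

Lemma continuous_slant2 : continuous W.
Proof. exact: is_derive_continuous Wd. Qed.

Let sc := continuous_slant.
Let Wc := continuous_slant2.

Lemma curv_gt0 x : 0 < curv f f' f2 x.
Proof. exact: divr_gt0 (mulr_gt0 (ff0 x) (exprn_gt0 _ (slant_gt0 x))) (exprn_gt0 _ (slant2_gt0 x)). Qed.

Lemma curvds_gt0 x : 0 < curvds f f' f2 x.
Proof. exact: divr_gt0 (mulr_gt0 (ff0 x) (slant_gt0 x)) (exprn_gt0 _ (slant2_gt0 x)). Qed.

Lemma continuous_curv : continuous (curv f f' f2).
Proof.
have fc := is_derive_continuous fd; have h x : W x ^+ 3 != 0 by rewrite expf_neq0.
rewrite /curv -/s -/W.
by iscont.
Qed.

Lemma continuous_curvds : continuous (curvds f f' f2).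
Proof.
have fc := is_derive_continuous fd; have h x : W x ^+ 2 != 0 by rewrite expf_neq0.
rewrite /curvds -/s -/W.
by iscont.
Qed.

Lemma continuous_height : continuous (fun x => f x / slant f x).
Proof. by rewrite -/s; have fc := is_derive_continuous fd; iscont. Qed.

(* Gauss-Bonnet: the two integrands differ by the derivative of atan (f' / s). *)
Lemma itg_curvds : (forall x, f (x + pi *+ 2) = f x) ->
  itg 0 (pi *+ 2) (curvds f f' f2) = itg 0 (pi *+ 2) (fun x => f x / slant f x).
Proof.
move=> fT; have f'T := derive_periodic fd fT.
have fc := is_derive_continuous fd; have h x : W x ^+ 2 != 0 by rewrite expf_neq0.
pose A x := atan (f' x / s x).
have sT x : s (x + pi *+ 2) = s x by rewrite /s /slant fT.
have Ad (x : R) : is_derive x 1 A (curvds f f' f2 x - f x / s x).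
  isderE; first by rewrite /A; isder.
  cbn beta; rewrite /curvds -/s -/W !sqr_slant2.
  have -> : 1 + (f' x / s x) ^+ 2 = (1 + f x ^+ 2 + f' x ^+ 2) / s x ^+ 2.
    by rewrite -sqr_slant; field; exact: sn.
  have e : f x ^+ 2 = s x ^+ 2 - 1 by rewrite sqr_slant; ring.
  have e3 : f x ^+ 3 = f x * (s x ^+ 2 - 1) by rewrite -e; ring.
  rewrite ?e ?e3; field.
  rewrite sn/=; apply/negP => /eqP E.
  by have := oneDsqr2_gt0 x; rewrite e; have := E; lra.
have hc := continuous_height; have cc := continuous_curvds.
have := itg_derive_periodic (ltW pp) Ad.
rewrite itgD; [|exact: cc|by iscont].
have -> : itg 0 (pi *+ 2) (fun x => - (f x / s x)) = - itg 0 (pi *+ 2) (fun x => f x / s x).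
  rewrite (@eq_itg _ _ _ _ (fun x => -1 * (f x / s x))); last by move=> x; rewrite mulN1r.
  by rewrite itgZ ?mulN1r//; iscont.
move=> H; apply/eqP; rewrite -subr_eq0; apply/eqP; apply: H.
  by apply: continuous_add; [exact: cc|apply: continuous_opp; exact: hc].
by move=> x; rewrite /A f'T sT.
Qed.

Hypothesis fpi : forall x, f (x + pi) = f x.

Let f'pi := derive_periodic fd fpi.

Let m := itg 0 (pi *+ 2) (fun x => f x / slant f x) / (pi *+ 2).

Lemma mean_height_bounds : 0 < m < 1.
Proof.
have hc := continuous_height.
rewrite divr_gt0 ?itg_gt0//=; last first.
  by move=> x; rewrite divr_gt0//; exact: slant_gt0.
rewrite ltr_pdivrMr// mul1r -subr_gt0 -[X in X - _]mul1r -[X in 1 * X]subr0.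
rewrite -itg_cst ?(ltW pp)//.
have -> : forall u v : R, u - v = u + -1 * v by move=> u v; ring.
rewrite -itgZ// -itgD; [|exact: continuous_cstfun|by iscont].
apply: itg_gt0 => //; first by iscont.
by move=> x; rewrite mulN1r subr_gt0 ltr_pdivrMr ?mul1r; [exact: slant_gtf|exact: slant_gt0].
Qed.

Lemma itg_height : itg 0 (pi *+ 2) (fun x => f x / slant f x) = pi *+ 2 * m.
Proof. by rewrite /m mulrC divfK// gt_eqF. Qed.

(* The weight is eta^2 = s (s + f), for which eta^-2 = 1 - f / s. *)
Lemma itg_dual_weight :
  itg 0 (pi *+ 2) (fun x => (s x + f x) * (f x + f2 x)) <= pi *+ 2 * m / (1 - m).
Proof.
have alg (p n : R) : p != 0 -> 1 - n != 0 ->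
    p *+ 2 * n / (1 - n) = 4 * p ^+ 2 / (p *+ 2 * (1 - n)) + -1 * (p *+ 2 - 0).
  by move=> p0 n0; rewrite -mulr_natl; field; rewrite p0 n0.
have p0 := pi_gt0 R; have fc := is_derive_continuous fd.
have f'c := is_derive_continuous f'd.
have sgt := slant_gt0.
have /andP[m0 m1] := mean_height_bounds.
have spi x : s (x + pi) = s x by rewrite /s /slant fpi.
have sf x : 0 < s x + f x by rewrite addr_gt0// sgt.
pose eta x := Num.sqrt (s x * (s x + f x)).
pose eta' x := f' x * (s x + f x) ^+ 2 / (2 * s x * eta x).
have g0 x : 0 < s x * (s x + f x) by rewrite mulr_gt0// sgt.
have e0 x : 0 < eta x by rewrite sqrtr_gt0.
have en x : eta x != 0 by rewrite gt_eqF.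
have e2 x : eta x ^+ 2 = s x * (s x + f x) by rewrite sqr_sqrtr// ltW.
have ed (x : R) : is_derive x 1 eta (eta' x).
  isderE; first by rewrite /eta; isder.
  by cbn beta; rewrite -/(eta x) /eta'; field; rewrite sn en.
have ec := is_derive_continuous ed.
have n2 x : 2 * s x * eta x != 0 by rewrite !mulf_neq0.
have e'c : continuous eta' by rewrite /eta'; iscont.
have ep x : eta (x + pi) = eta x by rewrite /eta spi fpi.
have := santalo_weight ed e'c e0 ep.
have -> : itg 0 (pi *+ 2) (fun x => (eta x ^+ 2)^-1) = pi *+ 2 * (1 - m).
  have hc := continuous_height.
  rewrite (@eq_itg _ _ _ _ (fun x => 1 + -1 * (f x / slant f x))); last first.
    move=> x; rewrite e2 -/s mulN1r.
    have h : (s x - f x) * (s x + f x) = 1.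
      by rewrite -subr_sqr sqr_slant; ring.
    apply: (mulfI (mulf_neq0 (sn x) (lt0r_neq0 (sf x)))).
    rewrite divff ?mulf_neq0 ?sn ?lt0r_neq0//.
    transitivity ((s x - f x) * (s x + f x)); first by rewrite h.
    by field; exact: sn.
  rewrite itgD; [|exact: continuous_cstfun|by iscont].
  rewrite itg_cst ?ltW// itgZ// itg_height; ring.
move=> H.
(* Integration by parts: the derivative of s + f is (s + f) f' / s, so the term (s + f) f'' may be
   traded for - (s + f) f'^2 / s. *)
pose B x := (s x + f x) * f' x.
have Bd (x : R) : is_derive x 1 B ((s x + f x) * f2 x + (s x + f x) * f' x ^+ 2 / s x).
  isderE; first by rewrite /B; isder.
  by cbn beta; field; exact: sn.
have B0 : itg 0 (pi *+ 2) (fun x => (s x + f x) * f2 x + (s x + f x) * f' x ^+ 2 / s x) = 0.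
  apply: (itg_derive_periodic (ltW pp) Bd); first by iscont.
  by move=> x; rewrite mulr2n addrA /B !spi !fpi !f'pi.
have : itg 0 (pi *+ 2) (fun x => (s x + f x) * (f x + f2 x)) <=
   itg 0 (pi *+ 2) (fun x => (eta x ^+ 2 - eta' x ^+ 2) + -1 +
     ((s x + f x) * f2 x + (s x + f x) * f' x ^+ 2 / s x)).
  apply: le_itg; [by iscont|by iscont|move=> x].
  (* The two sides differ by the factor ((s + f) / (2 s))^2, at most 1 since f < s. Nothing is lost
     for a cap, where f' = 0. *)
  have k1 : eta' x ^+ 2 <= (s x + f x) * f' x ^+ 2 / s x.
    have -> : eta' x ^+ 2 = ((s x + f x) * f' x ^+ 2 / s x) * ((s x + f x) ^+ 2 / (2 * s x) ^+ 2).
      have -> : eta' x ^+ 2 = f' x ^+ 2 * (s x + f x) ^+ 4 / (4 * s x ^+ 2 * eta x ^+ 2).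
        by rewrite /eta'; field; rewrite en sn.
      by rewrite e2; field; rewrite sn lt0r_neq0.
    rewrite ler_piMr//.
      exact: divr_ge0 (mulr_ge0 (ltW (sf x)) (sqr_ge0 _)) (ltW (sgt x)).
    rewrite ler_pdivrMr ?mul1r ?exprn_gt0 ?mulr_gt0//.
    rewrite lerXn2r ?nnegrE ?mulr_ge0 ?ltW//.
    by have := slant_gtf x; rewrite -/s; lra.
  have k2 : (s x + f x) * f x + 1 = eta x ^+ 2.
    by rewrite e2; have := sqr_slant x; lra.
  by rewrite -k2; lra.
rewrite itgD; [|by iscont|by iscont].
rewrite itgD; [|by iscont|by iscont].
rewrite (itg_cst _ (ltW pp)) B0 addr0.
have -> : pi *+ 2 * m / (1 - m) = 4 * pi ^+ 2 / (pi *+ 2 * (1 - m)) + -1 * (pi *+ 2 - 0).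
  by apply: alg; rewrite gt_eqF// subr_gt0.
lra.
Qed.

(* ln (1 / kappa) = ln (a / a0) + ln (b / b0) / 2 + const, where a and b are the two
   quantities whose integrals are controlled and a0, b0 their values for the cap;
   then ln x <= x - 1. *)
Lemma entropy_ineq :
  2 * itg 0 (pi *+ 2) (fun x => - ln (curv f f' f2 x) * curvds f f' f2 x) <=
  pi *+ 2 * m * ln ((1 - m ^+ 2) / m ^+ 2).
Proof.
have lin (c' a' b' k' : R) : c' + (a' *+ 2 + b' + k' *+ 2) = 0 ->
  - (2 * k') = c' + (2 * a' + b') by lra.
have fin (c' y x : R) : x <= y -> (c' - 3) * y + (2 * y + x) <= y * c'.
  by move=> xy; have := mulrC c' y; lra.
have p0 := pi_gt0 R; have fc := is_derive_continuous fd.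
have sgt := slant_gt0; have Wgt := slant2_gt0.
have /andP[m0 m1] := mean_height_bounds.
have hc := continuous_height; have cc := continuous_curvds; have kc := continuous_curv.
have k0 := curv_gt0; have c0 := curvds_gt0.
have f2pi x : f (x + pi *+ 2) = f x by rewrite mulr2n addrA !fpi.
pose C := ln ((1 - m ^+ 2) / m ^+ 2).
(* Bound for [2 * A * curvds] obtained in [h2]. Being affine in f / s it has an integral that
   depends on [m] only, namely twice 2 pi m. *)
pose a x := m / (1 - m ^+ 2) * (2 + m + m ^+ 2 - (1 + 3 * m) * (f x / s x)).
pose b x := (1 - m) * ((s x + f x) * (f x + f2 x)).
have m21 : 0 < 1 - m ^+ 2.
  by rewrite (_ : 1 - m ^+ 2 = (1 - m) * (1 + m)); [rewrite mulr_gt0//; lra|ring].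
have lc : continuous (fun x => ln (curv f f' f2 x)) by iscont.
have fsc : continuous (fun x => f x / s x) by exact: hc.
rewrite -itgZ; last by iscont.
have : itg 0 (pi *+ 2) (fun x => 2 * (- ln (curv f f' f2 x) * curvds f f' f2 x)) <=
   itg 0 (pi *+ 2) (fun x => (C - 3) * curvds f f' f2 x + (a x + b x)).
  apply: le_itg; rewrite /a /b; [by iscont|by iscont|move=> x].
  have omm : 0 < 1 - m by rewrite subr_gt0.
  pose u := 1 + f x / s x; pose r := Num.sqrt u; pose q := Num.sqrt (1 + m).
  have z0 : 0 < f x / s x by rewrite divr_gt0// sgt.
  have u0 : 0 < u by rewrite /u; lra.
  have r0 : 0 < r by rewrite sqrtr_gt0.
  have q0 : 0 < q by rewrite sqrtr_gt0; lra.
  have r2 : r ^+ 2 = u by rewrite sqr_sqrtr// ltW.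
  have q2 : q ^+ 2 = 1 + m by rewrite sqr_sqrtr//; lra.
  pose k := curv f f' f2 x; have kgt : 0 < k by exact: k0.
  (* The constants make [A] and [B] equal to 1 when f is the constant with f / s = m, so ln x <= x -
     1 is sharp there. [A] counts twice because -2 ln kappa is C + 2 ln A + ln B. *)
  pose A := m / ((1 - m) * q * W x * k * r).
  pose B := (1 - m) * u * W x ^+ 2.
  have W0 := Wgt x.
  have A0 : 0 < A.
    exact: divr_gt0 m0 (mulr_gt0 (mulr_gt0 (mulr_gt0 (mulr_gt0 omm q0) W0) kgt) r0).
  have B0 : 0 < B by exact: mulr_gt0 (mulr_gt0 omm u0) (exprn_gt0 _ W0).
  have e : - (2 * ln k) = C + (2 * ln A + ln B).
    have m2 : 0 < m ^+ 2 by rewrite exprn_gt0.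
    have E : (1 - m ^+ 2) / m ^+ 2 * (A ^+ 2 * B * k ^+ 2) = 1.
      have -> : A ^+ 2 * B * k ^+ 2 = m ^+ 2 / ((1 - m) * q ^+ 2) * (u / r ^+ 2).
        by rewrite /A /B; field; rewrite ?gt_eqF ?subr_gt0.
      rewrite q2 r2 divff ?gt_eqF// mulr1.
      by field; rewrite ?gt_eqF ?subr_gt0//; lra.
    have := congr1 (@ln R) E; rewrite ln1.
    rewrite lnM ?posrE; [|exact: divr_gt0|]; last first.
      exact: mulr_gt0 (mulr_gt0 (exprn_gt0 _ A0) B0) (exprn_gt0 _ kgt).
    have -> : ln (A ^+ 2 * B * k ^+ 2) = ln (A ^+ 2 * B) + ln (k ^+ 2).
      apply: lnM; rewrite posrE; last exact: exprn_gt0.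
      exact: mulr_gt0 (exprn_gt0 _ A0) B0.
    have -> : ln (A ^+ 2 * B) = ln (A ^+ 2) + ln B.
      by apply: lnM; rewrite posrE//; exact: exprn_gt0.
    rewrite !lnXn//.
    exact: lin.
  have h : 2 * - ln k <= C - 3 + 2 * A + B.
    by rewrite mulrN e; have := ln_le_subr1 A0; have := ln_le_subr1 B0; lra.
  have h2 : 2 * A * curvds f f' f2 x <= m / (1 - m ^+ 2) *
      (2 + m + m ^+ 2 - (1 + 3 * m) * (f x / s x)).
    pose v := f x / s x; rewrite -/v.
    have uE : u = 1 + v by [].
    have iz : 1 / s x ^+ 2 = (1 - v) * r ^+ 2.
      rewrite r2 uE /v; have := sqr_slant x; rewrite -/s => ss.
      apply: (mulfI (expf_neq0 2 (sn x))); rewrite mul1r divff ?expf_neq0//.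
      transitivity (s x ^+ 2 - f x ^+ 2); first by rewrite ss; ring.
      by field; exact: sn.
    have z1 : 0 < 1 - v.
      by rewrite subr_gt0 /v ltr_pdivrMr ?mul1r//; exact: slant_gtf.
    have -> : 2 * A * curvds f f' f2 x = m / (1 - m ^+ 2) * ((1 - v) * (2 * (r * q))).
      have -> : 2 * A * curvds f f' f2 x = 2 * m / ((1 - m) * q * r) * (1 / s x ^+ 2).
        rewrite /A /k /curv /curvds -/s -/W; field.
        by rewrite ?gt_eqF ?subr_gt0//; have := ff0 x; lra.
      rewrite iz (_ : 1 - m ^+ 2 = (1 - m) * q ^+ 2); last by rewrite q2; ring.
      by field; rewrite ?gt_eqF ?subr_gt0.
    have mm : 0 < m / (1 - m ^+ 2) by exact: divr_gt0.
    rewrite (ler_pM2l mm).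
    (* AM-GM for [r] and [q], whose squares add up to 2 + m + v, and then v^2 >= 2 m v - m^2. Both
       are equalities at v = m. *)
    apply: (@le_trans _ _ ((1 - v) * (2 + m + v))).
      rewrite ler_pM2l//; have := sqr_ge0 (r - q).
      by rewrite sqrrB r2 q2 uE; lra.
    by have := sqr_ge0 (v - m); nra.
  have h3 : B * curvds f f' f2 x = (1 - m) * ((s x + f x) * (f x + f2 x)).
    by rewrite /B /u /curvds -/s -/W; field; rewrite sn Wn.
  have h4 : 2 * - ln k * curvds f f' f2 x <= (C - 3 + 2 * A + B) * curvds f f' f2 x.
    by rewrite ler_pM2r.
  by rewrite -h3 -/k; lra.
move=> /le_trans; apply.
have T := itg_dual_weight.
rewrite /a /b itgD; [|by iscont|by iscont].
rewrite itgZ// itg_curvds// itg_height.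
rewrite itgD; [|by iscont|by iscont].
rewrite itgZ; last by iscont.
rewrite (@eq_itg _ _ _ (fun x => 2 + m + m ^+ 2 - (1 + 3 * m) * (f x / s x))
  (fun x => 2 + m + m ^+ 2 + - (1 + 3 * m) * (f x / s x))); last first.
  by move=> x; rewrite mulNr.
rewrite itgD; [|exact: continuous_cstfun|by iscont].
rewrite (itg_cst _ (ltW pp)) itgZ// itg_height itgZ; last by iscont.
have T' : (1 - m) * itg 0 (pi *+ 2) (fun x => (s x + f x) * (f x + f2 x)) <= pi *+ 2 * m.
  by rewrite mulrC -ler_pdivlMr ?subr_gt0.
have -> : m / (1 - m ^+ 2) * ((2 + m + m ^+ 2) * (pi *+ 2 - 0) +
   - (1 + 3 * m) * (pi *+ 2 * m)) = 2 * (pi *+ 2 * m).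
  by rewrite mulr2n; field; rewrite gt_eqF.
exact: fin T'.
Qed.

End FixedFunction.
End RadialFunction.

(** * Vectors and orthonormal frames *)

Section Vectors.
Context {R : realType}.
Implicit Types (u v w a b o : 'rV[R]_3).

Lemma sum3 (F : 'I_3 -> R) :
  \sum_(i < 3) F i = F ord0 + F (inord 1) + F (inord 2).
Proof.
rewrite !big_ord_recl big_ord0 addr0 addrA; congr (_ + F _ + F _); apply/val_inj.
  by rewrite /= inordK.
by rewrite /= inordK.
Qed.

Lemma det3 (A : 'M[R]_3) : \det A =
  A ord0 ord0 * (A (inord 1) (inord 1) * A (inord 2) (inord 2) -
                 A (inord 1) (inord 2) * A (inord 2) (inord 1)) -
  A ord0 (inord 1) * (A (inord 1) ord0 * A (inord 2) (inord 2) -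
                 A (inord 1) (inord 2) * A (inord 2) ord0) +
  A ord0 (inord 2) * (A (inord 1) ord0 * A (inord 2) (inord 1) -
                 A (inord 1) (inord 1) * A (inord 2) ord0).
Proof.
have i1 : inord 1 = lift ord0 ord0 :> 'I_3 by apply/val_inj; rewrite /= inordK.
have i2 : inord 2 = lift ord0 (lift ord0 ord0) :> 'I_3 by apply/val_inj; rewrite /= inordK.
rewrite (expand_det_row _ ord0) sum3 /cofactor !(expand_det_row _ ord0).
rewrite !big_ord_recl !big_ord0 /cofactor !det_mx11 !mxE /=.
have l0 : lift ord0 (ord0 : 'I_2) = inord 1 :> 'I_3 by rewrite i1.
have l1 : lift ord0 (lift ord0 ord0 : 'I_2) = inord 2 :> 'I_3 by rewrite i2.
have l2 : lift (inord 1) (ord0 : 'I_2) = ord0 :> 'I_3.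
  by apply/val_inj; rewrite /= inordK.
have l3 : lift (inord 1) (lift ord0 ord0 : 'I_2) = inord 2 :> 'I_3.
  by apply/val_inj; rewrite /= !inordK.
have l4 : lift (inord 2) (ord0 : 'I_2) = ord0 :> 'I_3.
  by apply/val_inj; rewrite /= inordK.
have l5 : lift (inord 2) (lift ord0 ord0 : 'I_2) = inord 1 :> 'I_3.
  by apply/val_inj; rewrite /= !inordK.
have l6 (j : 'I_1) : lift (lift ord0 ord0 : 'I_2) j = ord0 :> 'I_2.
  by apply/val_inj; rewrite /= (ord1 j).
rewrite !l0 !l1 !l2 !l3 !l4 !l5 !l6 ?l0 ?l1 ?l2 ?l3 ?l4 ?l5.
rewrite !inordK//= !addn0 ?add0n ?expr0 ?expr1 ?expr2 /bump /=.
rewrite ?addn0 ?add0n ?expr0 ?expr1 ?expr2.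
ring.
Qed.

Lemma dotC u v : dot u v = dot v u.
Proof. by apply: eq_bigr => i _; rewrite mulrC. Qed.

Lemma dotDl u v w : dot (u + v) w = dot u w + dot v w.
Proof. by rewrite /dot -big_split; apply: eq_bigr => i _; rewrite mxE mulrDl. Qed.

Lemma dotZl (k : R) u w : dot (k *: u) w = k * dot u w.
Proof. by rewrite /dot big_distrr; apply: eq_bigr => i _; rewrite mxE -mulrA. Qed.

Lemma dotNl u w : dot (- u) w = - dot u w.
Proof. by rewrite -scaleN1r dotZl mulN1r. Qed.

Lemma dotBl u v w : dot (u - v) w = dot u w - dot v w.
Proof. by rewrite dotDl dotNl. Qed.

Lemma dotDr u v w : dot w (u + v) = dot w u + dot w v.
Proof. by rewrite dotC dotDl !(dotC w). Qed.

Lemma dotZr (k : R) u w : dot w (k *: u) = k * dot w u.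
Proof. by rewrite dotC dotZl dotC. Qed.

Lemma dotNr u w : dot w (- u) = - dot w u.
Proof. by rewrite dotC dotNl dotC. Qed.

Lemma dot_ge0 u : 0 <= dot u u.
Proof. by apply: sumr_ge0 => i _; rewrite -expr2 sqr_ge0. Qed.

Lemma sphereP u : sphere u <-> dot u u = 1.
Proof.
rewrite /sphere /enorm /=; split=> [h|->]; last exact: sqrtr1.
by rewrite -(sqr_sqrtr (dot_ge0 u)) h expr1n.
Qed.

Definition rows3 u v w : 'M[R]_3 := \matrix_(i < 3) nth 0 [:: u; v; w] i.

(** The matrix identity leaves the orientation open; the second clause fixes it, as the coordinate
    formula for [triple] requires. *)
Definition frame a b o := rows3 a b o *m (rows3 a b o)^T = 1%:M /\ triple a b o = 1.

Definition vec a b o (x y z : R) := x *: a + y *: b + z *: o.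

Lemma rows3_tr u v w a b o i j : (rows3 u v w *m (rows3 a b o)^T) i j =
  dot (nth 0 [:: u; v; w] i) (nth 0 [:: a; b; o] j).
Proof. by rewrite !mxE; apply: eq_bigr => k _; rewrite !mxE. Qed.

Lemma frameI a b o : dot a a = 1 -> dot b b = 1 -> dot o o = 1 ->
  dot a b = 0 -> dot a o = 0 -> dot b o = 0 -> triple a b o = 1 -> frame a b o.
Proof.
move=> aa bb oo ab ao bo t; split => //.
apply/matrixP => i j; rewrite rows3_tr !mxE.
have [ba oa ob] : [/\ dot b a = 0, dot o a = 0 & dot o b = 0] by rewrite !(dotC _ a) (dotC o).
by case: i => -[|[|[|//]]] Hi; case: j => -[|[|[|//]]] Hj /=;
  rewrite ?aa ?bb ?oo ?ab ?ao ?bo ?ba ?oa ?ob.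
Qed.

Section Frame.
Variables (a b o : 'rV[R]_3).
Hypothesis Hf : frame a b o.

Lemma frame_dots : [/\ dot a a = 1, dot b b = 1 & dot o o = 1] /\
  [/\ dot a b = 0, dot a o = 0 & dot b o = 0].
Proof.
case: Hf => H _.
have E i j : dot (nth 0 [:: a; b; o] (i : 'I_3)) (nth 0 [:: a; b; o] (j : 'I_3)) = (i == j)%:R.
  by rewrite -rows3_tr H mxE.
have := E ord0 ord0; have := E (inord 1) (inord 1); have := E (inord 2) (inord 2).
have := E ord0 (inord 1); have := E ord0 (inord 2); have := E (inord 1) (inord 2).
by rewrite -!val_eqE /= !inordK.
Qed.

(** Orthonormality yields completeness because a one-sided inverse of a square matrix is
    two-sided. *)
Lemma frame_vec u : u = vec a b o (dot u a) (dot u b) (dot u o).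
Proof.
case: Hf => H _; have {}H := mulmx1C H.
rewrite -{1}[u]mulmx1 -H mulmxA.
have -> : u *m (rows3 a b o)^T = \row_j dot u (nth 0 [:: a; b; o] (j : 'I_3)).
  by apply/rowP => j; rewrite !mxE; apply: eq_bigr => k _; rewrite !mxE.
apply/rowP => j; rewrite !mxE sum3 !mxE /= !inordK//.
Qed.

Lemma dot_vec_a x y z : dot (vec a b o x y z) a = x.
Proof.
have [[aa bb oo] [ab ao bo]] := frame_dots.
by rewrite !dotDl !dotZl aa (dotC b) ab (dotC o) ao; ring.
Qed.

Lemma dot_vec_b x y z : dot (vec a b o x y z) b = y.
Proof.
have [[aa bb oo] [ab ao bo]] := frame_dots.
by rewrite !dotDl !dotZl bb ab (dotC o) bo; ring.
Qed.

Lemma dot_vec_o x y z : dot (vec a b o x y z) o = z.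
Proof.
have [[aa bb oo] [ab ao bo]] := frame_dots.
by rewrite !dotDl !dotZl ao bo oo; ring.
Qed.

Definition dot_vecE := (dot_vec_a, dot_vec_b, dot_vec_o).

Lemma frame_dot u v : dot u v = dot u a * dot v a + dot u b * dot v b + dot u o * dot v o.
Proof.
by rewrite {1}(frame_vec u) !dotDl !dotZl !(dotC _ v).
Qed.

(** Multiplying by the transposed frame matrix, of determinant 1, turns the rows into frame
    coordinates without changing the determinant. *)
Lemma frame_triple u v w : triple u v w =
  dot u a * (dot v b * dot w o - dot v o * dot w b) -
  dot u b * (dot v a * dot w o - dot v o * dot w a) +
  dot u o * (dot v a * dot w b - dot v b * dot w a).
Proof.
case: Hf => _ H.
have : triple u v w * triple a b o = \det (rows3 u v w *m (rows3 a b o)^T).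
  by rewrite det_mulmx det_tr.
by rewrite H mulr1 => ->; rewrite det3 !rows3_tr /= !inordK.
Qed.

Lemma frame_eq u v : dot u a = dot v a -> dot u b = dot v b -> dot u o = dot v o -> u = v.
Proof. by move=> ea eb eo; rewrite (frame_vec u) ea eb eo -frame_vec. Qed.

Lemma frame_sphere u : sphere u <-> dot u a ^+ 2 + dot u b ^+ 2 + dot u o ^+ 2 = 1.
Proof. by rewrite sphereP frame_dot !expr2. Qed.

End Frame.

Definition row3 (x y z : R) : 'rV[R]_3 := \row_(i < 3) nth 0 [:: x; y; z] i.

Lemma dot_row3 x y z x' y' z' : dot (row3 x y z) (row3 x' y' z') = x * x' + y * y' + z * z'.
Proof. by rewrite /dot sum3 !mxE /= !inordK. Qed.

Lemma triple_row3 x y z x' y' z' x'' y'' z'' :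
  triple (row3 x y z) (row3 x' y' z') (row3 x'' y'' z'') =
  x * (y' * z'' - z' * y'') - y * (x' * z'' - z' * x'') + z * (x' * y'' - y' * x'').
Proof. by rewrite /triple det3 !mxE /= !inordK//= !mxE /= !inordK. Qed.

Lemma row3E u : u = row3 (u 0 ord0) (u 0 (inord 1)) (u 0 (inord 2)).
Proof.
apply/rowP => -[[|[|[|//]]] Hi]; rewrite !mxE /=; congr (u _ _); apply/val_inj => //=;
  by rewrite inordK.
Qed.

(* The frame moved to (t, p) on the sphere: the unit vectors along increasing t and
   increasing p, followed by the point itself. *)
Definition fr1 (t p : R) := row3 (cos t * cos p) (cos t * sin p) (- sin t).
Definition fr2 (p : R) := row3 (- sin p) (cos p) 0.
Definition fr3 (t p : R) := row3 (sin t * cos p) (sin t * sin p) (cos t).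

Lemma frame_fr t p : frame (fr1 t p) (fr2 p) (fr3 t p).
Proof.
have ct := cos2Dsin2 t; have cp := cos2Dsin2 p.
have st : sin t ^+ 2 = 1 - cos t ^+ 2 by rewrite -ct; ring.
have sp : sin p ^+ 2 = 1 - cos p ^+ 2 by rewrite -cp; ring.
apply: frameI; rewrite /fr1 /fr2 /fr3 ?dot_row3 ?triple_row3.
- transitivity (cos t ^+ 2 * cos p ^+ 2 + cos t ^+ 2 * sin p ^+ 2 + sin t ^+ 2); first by ring.
  by rewrite st sp; ring.
- transitivity (sin p ^+ 2 + cos p ^+ 2); first by ring.
  by rewrite sp; ring.
- transitivity (sin t ^+ 2 * cos p ^+ 2 + sin t ^+ 2 * sin p ^+ 2 + cos t ^+ 2); first by ring.
  by rewrite st sp; ring.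
- by ring.
- transitivity (cos t * sin t * (cos p ^+ 2 + sin p ^+ 2 - 1)); first by ring.
  by rewrite cp; ring.
- by ring.
- transitivity ((cos t ^+ 2 + sin t ^+ 2) * (cos p ^+ 2 + sin p ^+ 2)); first by ring.
  by rewrite ct cp; ring.
Qed.

Lemma angle_exists (x y : R) : x ^+ 2 + y ^+ 2 = 1 -> exists p, x = cos p /\ y = sin p.
Proof.
move=> xy; have x1 : -1 <= x <= 1.
  by rewrite -ler_norml -(ler_pXn2r (n := 2))// ?nnegrE// expr1n real_normK ?num_real//; have := sqr_ge0 y; lra.
have y2 : Num.sqrt (1 - x ^+ 2) = `|y| by rewrite -sqrtr_sqr; congr Num.sqrt; lra.
have [y0|y0] := leP 0 y.
  exists (acos x); rewrite acosK ?in_itv//=; split => //.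
  by rewrite sin_acos// y2 ger0_norm.
exists (- acos x); rewrite cosN acosK ?in_itv//=; split => //.
by rewrite sinN sin_acos// y2 ltr0_norm// opprK.
Qed.

Lemma polar_exists (x y : R) : exists r w : R, [/\ 0 <= r, x = r * cos w & y = r * sin w].
Proof.
have n0 : 0 <= x ^+ 2 + y ^+ 2 by rewrite addr_ge0// sqr_ge0.
have [r0|r0] := eqVneq (Num.sqrt (x ^+ 2 + y ^+ 2)) 0.
  exists 0, 0; rewrite !mul0r; move/eqP: r0; rewrite sqrtr_eq0 => n0'.
  have : x ^+ 2 + y ^+ 2 == 0 by rewrite eq_le n0 n0'.
  by rewrite paddr_eq0 ?sqr_ge0// !sqrf_eq0 => /andP[/eqP-> /eqP->].
set r := Num.sqrt _ in r0 *.
have [w [cw sw]] : exists w : R, x / r = cos w /\ y / r = sin w.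
  have rr : r ^+ 2 = x ^+ 2 + y ^+ 2 by exact: sqr_sqrtr.
  by apply: angle_exists; rewrite !expr_div_n -mulrDl -rr divff// expf_neq0.
exists r, w; split; first exact: sqrtr_ge0.
  by rewrite -cw mulrC divfK.
by rewrite -sw mulrC divfK.
Qed.

Lemma sphere_fr3 o : sphere o -> exists t p, o = fr3 t p.
Proof.
move=> /sphereP; rewrite (row3E o) dot_row3.
set x := o 0 ord0; set y := o 0 (inord 1); set z := o 0 (inord 2) => o1.
have r0 : 0 <= x ^+ 2 + y ^+ 2 by rewrite addr_ge0 ?sqr_ge0.
pose r := Num.sqrt (x ^+ 2 + y ^+ 2).
have r2 : r ^+ 2 = x ^+ 2 + y ^+ 2 by rewrite sqr_sqrtr.
have [t [zt rt]] : exists t, z = cos t /\ r = sin t.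
  by apply: angle_exists; rewrite r2; lra.
have [r00|rn] := eqVneq r 0.
  exists t, 0; rewrite /fr3 -rt r00 -zt !mul0r.
  have /eqP : x ^+ 2 + y ^+ 2 = 0 by rewrite -r2 r00 expr0n.
  by rewrite paddr_eq0 ?sqr_ge0// !sqrf_eq0 => /andP[/eqP -> /eqP ->].
have [p [xp yp]] : exists p, x / r = cos p /\ y / r = sin p.
  by apply: angle_exists; rewrite !expr_div_n -mulrDl -r2 divff// expf_neq0.
by exists t, p; rewrite /fr3 -rt -zt -xp -yp mulrC divfK// mulrC divfK.
Qed.

Lemma frame_exists o : sphere o -> exists a b, frame a b o.
Proof. by move=> /sphere_fr3[t [p ->]]; exists (fr1 t p), (fr2 p); exact: frame_fr. Qed.

Lemma spherical_coordE (p : R * R) : spherical_coord p = fr3 p.1 p.2.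
Proof. by []. Qed.

End Vectors.

(** * Polar angles and boundary curves *)

Section AngleLift.
Context {R : realType}.
Implicit Types (x y : R -> R).

Lemma cos_lt1 (l : R) : 0 < l < pi *+ 2 -> cos l < 1.
Proof.
move=> /andP[l0 l2].
have -> : l = (l / 2) *+ 2 by lra.
rewrite cos_mulr2n cos2sin2.
have : 0 < sin (l / 2) by apply: sin_gt0_pi; rewrite divr_gt0//= ltr_pdivrMr// mulr_natr.
by move=> s0; have := exprn_gt0 2 s0; lra.
Qed.

Lemma angle_lift x y x' y' : (forall t : R, is_derive t 1 x (x' t)) ->
  (forall t : R, is_derive t 1 y (y' t)) -> continuous x' -> continuous y' ->
  (forall t, 0 < x t ^+ 2 + y t ^+ 2) ->
  exists phi : R -> R,
    (forall t : R, is_derive t 1 phi ((x t * y' t - y t * x' t) / (x t ^+ 2 + y t ^+ 2))) /\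
    forall t, x t = Num.sqrt (x t ^+ 2 + y t ^+ 2) * cos (phi t) /\
              y t = Num.sqrt (x t ^+ 2 + y t ^+ 2) * sin (phi t).
Proof.
move=> xd yd x'c y'c q0.
have xc := is_derive_continuous xd; have yc := is_derive_continuous yd.
have qn t : x t ^+ 2 + y t ^+ 2 != 0 by rewrite gt_eqF.
pose r t := Num.sqrt (x t ^+ 2 + y t ^+ 2).
have r0 t : 0 < r t by rewrite sqrtr_gt0.
have rn t : r t != 0 by rewrite gt_eqF.
have r2 t : r t ^+ 2 = x t ^+ 2 + y t ^+ 2 by rewrite sqr_sqrtr// ltW.
have [P Pd] : exists P, forall t : R,
    is_derive t 1 P ((x t * y' t - y t * x' t) / (x t ^+ 2 + y t ^+ 2)).
  by apply: continuous_primitive; iscont.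
have [p0 [xp yp]] : exists p, x 0 / r 0 = cos p /\ y 0 / r 0 = sin p.
  by apply: angle_exists; rewrite !expr_div_n -mulrDl r2 divff.
pose phi t := P t + (p0 - P 0).
have phid (t : R) : is_derive t 1 phi ((x t * y' t - y t * x' t) / (x t ^+ 2 + y t ^+ 2)).
  by isderE; [rewrite /phi; isder|rewrite addr0].
exists phi; split => //.
have rd (t : R) : is_derive t 1 r ((x t * x' t + y t * y' t) / r t).
  isderE; first by rewrite /r; isder.
  by cbn beta; rewrite -/(r t) !expr1; field.
(* [A] and [B] are the cosine and sine of the angle from direction [phi] to (x, y). The choice of
   the derivative of [phi] makes them constant, and [p0] makes them 1 and 0 at time 0. *)
pose A t := (x t * cos (phi t) + y t * sin (phi t)) / r t.
pose B t := (y t * cos (phi t) - x t * sin (phi t)) / r t.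
have Ad (t : R) : is_derive t 1 A 0.
  isderE; first by rewrite /A; isder.
  cbn beta; apply: (mulIf (expf_neq0 3 (rn t))); rewrite mul0r -r2.
  transitivity (r t ^+ 2 * (x' t * cos (phi t) + y' t * sin (phi t)) +
    (x t * y' t - y t * x' t) * (y t * cos (phi t) - x t * sin (phi t)) -
    (x t * cos (phi t) + y t * sin (phi t)) * (x t * x' t + y t * y' t)).
    by field.
  by rewrite r2; ring.
have Bd (t : R) : is_derive t 1 B 0.
  isderE; first by rewrite /B; isder.
  cbn beta; apply: (mulIf (expf_neq0 3 (rn t))); rewrite mul0r -r2.
  transitivity (r t ^+ 2 * (y' t * cos (phi t) - x' t * sin (phi t)) -
    (x t * y' t - y t * x' t) * (x t * cos (phi t) + y t * sin (phi t)) -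
    (y t * cos (phi t) - x t * sin (phi t)) * (x t * x' t + y t * y' t)).
    by field.
  by rewrite r2; ring.
have phi0 : phi 0 = p0 by rewrite /phi addrCA subrr addr0.
have x0E : x 0 = r 0 * cos p0 by rewrite -xp mulrC divfK.
have y0E : y 0 = r 0 * sin p0 by rewrite -yp mulrC divfK.
have A1 t : A t = 1.
  rewrite (is_derive_0_is_cst t 0 Ad) /A phi0 x0E y0E.
  by rewrite -(cos2Dsin2 p0); field.
have B0 t : B t = 0.
  by rewrite (is_derive_0_is_cst t 0 Bd) /B phi0 x0E y0E; field.
move=> t; rewrite -/(r t).
have := A1 t; have := B0 t; rewrite /A /B => b a.
have {}a : x t * cos (phi t) + y t * sin (phi t) = r t.
  by apply: (mulIf (invr_neq0 (rn t))); rewrite a divff.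
have {}b : y t * cos (phi t) - x t * sin (phi t) = 0.
  by apply: (mulIf (invr_neq0 (rn t))); rewrite b mul0r.
have cs := cos2Dsin2 (phi t); split.
  transitivity ((x t * cos (phi t) + y t * sin (phi t)) * cos (phi t) -
                (y t * cos (phi t) - x t * sin (phi t)) * sin (phi t)).
    by rewrite -[LHS]mulr1 -cs; ring.
  by rewrite a b; ring.
transitivity ((x t * cos (phi t) + y t * sin (phi t)) * sin (phi t) +
              (y t * cos (phi t) - x t * sin (phi t)) * cos (phi t)).
  by rewrite -[LHS]mulr1 -cs; ring.
by rewrite a b; ring.
Qed.

(* A closed curve that meets each ray at most once winds around the origin once. *)
Lemma angle_lift_periodic x y x' y' : (forall t : R, is_derive t 1 x (x' t)) ->
  (forall t : R, is_derive t 1 y (y' t)) -> continuous x' -> continuous y' ->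
  (forall t, x (t + 1) = x t) -> (forall t, y (t + 1) = y t) ->
  (forall t, 0 < x t * y' t - y t * x' t) ->
  (forall s c, 0 < s < 1 -> 0 < c -> x s = c * x 0 -> y s = c * y 0 -> False) ->
  exists phi : R -> R,
    [/\ forall t : R, is_derive t 1 phi ((x t * y' t - y t * x' t) / (x t ^+ 2 + y t ^+ 2)),
      forall t, x t = Num.sqrt (x t ^+ 2 + y t ^+ 2) * cos (phi t) /\
              y t = Num.sqrt (x t ^+ 2 + y t ^+ 2) * sin (phi t) &
      forall t, phi (t + 1) = phi t + pi *+ 2].
Proof.
move=> xd yd x'c y'c x1 y1 D0 uniq.
have q0 t : 0 < x t ^+ 2 + y t ^+ 2.
  rewrite lt0r addr_ge0 ?sqr_ge0// andbT paddr_eq0 ?sqr_ge0// !sqrf_eq0.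
  by apply/negP => /andP[/eqP h /eqP k]; have := D0 t; rewrite h k !mul0r subrr ltxx.
have [phi [phid cs]] := angle_lift xd yd x'c y'c q0.
exists phi; split => // t.
have x'1 := derive_periodic xd x1; have y'1 := derive_periodic yd y1.
have phi'0 t' : 0 < (x t' * y' t' - y t' * x' t') / (x t' ^+ 2 + y t' ^+ 2).
  by rewrite divr_gt0.
have inc := derive_gt0_lt phid phi'0.
have d1 z : (x (z + 1) * y' (z + 1) - y (z + 1) * x' (z + 1)) / (x (z + 1) ^+ 2 + y (z + 1) ^+ 2) =
    (x z * y' z - y z * x' z) / (x z ^+ 2 + y z ^+ 2) by rewrite x1 y1 x'1 y'1.
have per s := primitive_periodic phid d1 s 0.
have {per}per s : phi (s + 1) = phi s + (phi 1 - phi 0).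
  by have := per s; rewrite add0r => <-; ring.
set l := phi 1 - phi 0 in per.
have l0 : 0 < l by rewrite subr_gt0 inc.
pose r t := Num.sqrt (x t ^+ 2 + y t ^+ 2).
have r0 t' : 0 < r t' by rewrite sqrtr_gt0.
have dir s p : phi s = phi 0 + p -> cos p = 1 -> sin p = 0 ->
    x s = r s / r 0 * x 0 /\ y s = r s / r 0 * y 0.
  move=> e c1 s0; have [xs ys] := cs s; have [xs0 ys0] := cs 0.
  rewrite -!/(r _) in xs ys xs0 ys0.
  rewrite xs ys xs0 ys0 e cosD sinD c1 s0.
  by split; field; rewrite gt_eqF.
rewrite per; congr (_ + _).
(* A smaller gain contradicts closedness, which forces cos l = 1; a larger one makes the curve
   return to its initial ray at some time strictly between 0 and 1, against [uniq]. *)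
have [ll|ll|//] := ltgtP l (pi *+ 2).
- have : cos l < 1 by apply: cos_lt1; rewrite l0.
  have [xs ys] := cs 1; have [xs0 ys0] := cs 0.
  have x10 : x 1 = x 0 by rewrite -[1]add0r x1.
  have y10 : y 1 = y 0 by rewrite -[1]add0r y1.
  rewrite x10 y10 in xs ys.
  rewrite -/(r 0) in xs ys xs0 ys0.
  have cc : cos (phi 1) = cos (phi 0).
    by apply: (mulfI (lt0r_neq0 (r0 0))); rewrite -xs.
  have ss : sin (phi 1) = sin (phi 0).
    by apply: (mulfI (lt0r_neq0 (r0 0))); rewrite -ys.
  by rewrite /l cosB cc ss -!expr2 cos2Dsin2 ltxx.
- exfalso.
  have [|||s] := @IVT R phi 0 1 (phi 0 + pi *+ 2) => //.
  + by apply: continuous_subspaceT; exact: is_derive_continuous phid.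
  + have p0 : 0 < pi *+ 2 :> R by rewrite mulrn_wgt0// pi_gt0.
    by rewrite ge_min le_max; apply/andP; split; apply/orP; [left|right]; move: ll; rewrite /l; lra.
  rewrite in_itv/= => /andP[s0 s1] e.
  have [||xs ys] := dir s _ e; rewrite ?cos2pi ?sin2pi//.
  apply: (uniq s (r s / r 0)) => //; last by rewrite divr_gt0.
  have p0 : 0 < pi *+ 2 :> R by rewrite mulrn_wgt0// pi_gt0.
  rewrite !lt_neqAle s0 s1 !andbT; apply/andP; split; apply/eqP => h.
    by move: e; rewrite -h; lra.
  by move: e ll; rewrite h /l; lra.
Qed.

End AngleLift.

(** * Curves in space, coordinatewise, and interior points of subsets of the sphere *)

Section VectorCalculus.
Context {R : realType}.
Implicit Types (u v w a b o : 'rV[R]_3) (g : R -> 'rV[R]_3).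

Lemma is_derive_dot g a (t : R) : derivable g t 1 ->
  is_derive t 1 (fun s => dot (g s) a) (dot (derive1 g t) a).
Proof.
move=> gd; rewrite derive1E (derive_mx gd).
have E i : is_derive t 1 (fun s => g s ord0 i) ('D_1 (fun s => g s ord0 i) t).
  by apply: derivableP; have /derivable_mxP := gd; apply.
rewrite /dot sum3 !mxE.
have -> : (fun s => \sum_(i < 3) g s 0 i * a 0 i) = (fun s => g s 0 ord0 * a 0 ord0 +
    g s 0 (inord 1) * a 0 (inord 1) + g s 0 (inord 2) * a 0 (inord 2)).
  by apply/funext => s; rewrite sum3.
have := is_derive_add (is_derive_add (is_derive_mul (E ord0) (is_derive_cstfun (a 0 ord0) t))
    (is_derive_mul (E (inord 1)) (is_derive_cstfun (a 0 (inord 1)) t)))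
    (is_derive_mul (E (inord 2)) (is_derive_cstfun (a 0 (inord 2)) t)).
by rewrite !mulr0 !add0r.
Qed.

Lemma is_derive_vec a b o (x y z : R -> R) (t x' y' z' : R) :
  is_derive t 1 x x' -> is_derive t 1 y y' -> is_derive t 1 z z' ->
  derivable (fun s => vec a b o (x s) (y s) (z s)) t 1 /\
  derive1 (fun s => vec a b o (x s) (y s) (z s)) t = vec a b o x' y' z'.
Proof.
move=> xd yd zd.
have E i j : is_derive t 1 (fun s => vec a b o (x s) (y s) (z s) i j)
    (vec a b o x' y' z' i j).
  have -> : (fun s => vec a b o (x s) (y s) (z s) i j) =
      (fun s => x s * a i j + y s * b i j + z s * o i j).
    by apply/funext => s; rewrite !mxE.
  have := is_derive_add (is_derive_add (is_derive_mul xd (is_derive_cstfun (a i j) t))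
    (is_derive_mul yd (is_derive_cstfun (b i j) t))) (is_derive_mul zd (is_derive_cstfun (o i j) t)).
  by rewrite !mulr0 !add0r !mxE.
have D : derivable (fun s => vec a b o (x s) (y s) (z s)) t 1.
  by apply/derivable_mxP => i j; have [] := E i j.
split => //; rewrite derive1E (derive_mx D); apply/matrixP => i j; rewrite [LHS]mxE.
by have [_ ->] := E i j.
Qed.

Lemma continuous_vec a b o (x y z : R -> R) :
  continuous x -> continuous y -> continuous z ->
  continuous (fun s => vec a b o (x s) (y s) (z s)).
Proof.
move=> xc yc zc t; apply: cvgD; first apply: cvgD.
- by apply: cvgZr_tmp; exact: xc.
- by apply: cvgZr_tmp; exact: yc.
- by apply: cvgZr_tmp; exact: zc.
Qed.

Lemma continuous_dot g a : continuous g -> continuous (fun s => dot (g s) a).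
Proof.
move=> gc; rewrite /dot.
have -> : (fun s => \sum_(i < 3) g s 0 i * a 0 i) = (fun s => g s 0 ord0 * a 0 ord0 +
    g s 0 (inord 1) * a 0 (inord 1) + g s 0 (inord 2) * a 0 (inord 2)).
  by apply/funext => s; rewrite sum3.
have E i : continuous (fun s => g s ord0 i).
  by move=> s; apply: (@continuous_comp _ _ _ g (fun M : 'rV[R]_3 => M ord0 i)); [exact: gc|exact: coord_continuous].
by apply: continuous_add; first apply: continuous_add; apply: continuous_mul;
  (exact: E || exact: continuous_cstfun).
Qed.

(** An interior point may be pushed a little against any direction and projected back to the sphere.
    Inserted into a linear inequality valid on [A], the pushed point shows that the inequality is
    strict at [u]. *)
Lemma sph_interior_move (A : set 'rV[R]_3) u n : sph_interior A u ->
  exists2 e, 0 < e & exists2 k, 0 < k & A (k *: (u - e *: n)).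
Proof.
move=> [/sphereP u1 Au].
pose h (e : R) := (enorm (u - e *: n))^-1 *: (u - e *: n).
have hu : h 0 = u by rewrite /h scale0r subr0 /enorm u1 sqrtr1 invr1 scale1r.
pose q (e : R) := dot (u - e *: n) (u - e *: n).
have qE e : q e = 1 - 2 * dot u n * e + dot n n * e ^+ 2.
  by rewrite /q !dotBl !dotZl !(dotC _ (_ - _)) !dotBl !dotZl u1 (dotC n u); ring.
have qc : continuous q.
  by rewrite (_ : q = fun e => 1 - 2 * dot u n * e + dot n n * e ^+ 2); [iscont|exact/funext].
have q0 : q 0 = 1 by rewrite qE !mulr0 subr0 expr0n /= mulr0 addr0.
have nq : \forall e \near (0 : R), 0 < q e.
  by have := qc 0; rewrite /continuous_at q0 => /cvgr_gt; apply; exact: ltr01.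
have hc : h e @[e --> (0 : R)] --> u.
  rewrite -hu; apply: cvgZ.
    apply: cvgV; first by rewrite scale0r subr0 /enorm u1 sqrtr1 oner_neq0.
    by apply: continuous_sqrtf; exact: qc.
  by apply: cvgB; [exact: cvg_cst|apply: cvgZr_tmp; exact: cvg_id].
have nA : \forall e \near (0 : R), sphere (h e) -> A (h e) by exact: hc Au.
have [e He] := nbhs_ex (filterI nA nq); have e0 : 0 < e%:num by [].
have [] : (sphere (h (e%:num / 2)) -> A (h (e%:num / 2))) /\ 0 < q (e%:num / 2).
  by apply: He; rewrite /ball/= sub0r normrN gtr0_norm ?divr_gt0//; lra.
move=> Ah qe; exists (e%:num / 2); first by rewrite divr_gt0.
exists (enorm (u - (e%:num / 2) *: n))^-1; first by rewrite invr_gt0 sqrtr_gt0.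
apply: Ah; apply/sphereP; rewrite /h dotZl dotZr mulrA -expr2 exprVn sqr_sqrtr ?ltW//.
by rewrite mulVf// gt_eqF.
Qed.

End VectorCalculus.

Lemma is_derive_sum3 {R : realType} (p1 p2 p3 q1 q2 q3 : R -> R) (t p1' p2' p3' q1' q2' q3' : R) :
  is_derive t 1 p1 p1' -> is_derive t 1 p2 p2' -> is_derive t 1 p3 p3' ->
  is_derive t 1 q1 q1' -> is_derive t 1 q2 q2' -> is_derive t 1 q3 q3' ->
  is_derive t 1 (fun s => p1 s * q1 s + p2 s * q2 s + p3 s * q3 s)
    (p1 t * q1' + p2 t * q2' + p3 t * q3' + (p1' * q1 t + p2' * q2 t + p3' * q3 t)).
Proof.
move=> d1 d2 d3 e1 e2 e3.
have := is_derive_add (is_derive_add (is_derive_mul d1 e1) (is_derive_mul d2 e2)) (is_derive_mul d3 e3).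
by congr is_derive; ring.
Qed.

(** * Consequences of the definition of a boundary curve *)

Section BoundaryCurve.
Context {R : realType}.
Variables (L : set 'rV[R]_3) (g : R -> 'rV[R]_3).
Hypothesis LS : L `<=` sphere.
Hypothesis Lcl : closed L.
Hypothesis gL : boundary_curve L g.

Lemma boundary_curve_mem t : L (g t).
Proof.
case: gL => _ _ rg _; have : sph_boundary L (g t) by rewrite -rg; exists t.
have e : L = closure L by apply/closure_id.
by case=> + _; rewrite -e.
Qed.

Lemma boundary_curve_dot a :
  [/\ forall t : R, is_derive t 1 (fun s => dot (g s) a) (dot (derive1 g t) a),
      forall t : R, is_derive t 1 (fun s => dot (derive1 g s) a)
        (dot (derive1 (derive1 g) t) a) &
      continuous (fun s => dot (derive1 (derive1 g) s) a)].
Proof.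
case: gL => -[[gd g'd gc] _] _ _ _; split.
- by move=> t; exact: is_derive_dot.
- by move=> t; exact: is_derive_dot.
- exact: continuous_dot.
Qed.

Lemma boundary_curve_orth t : dot (g t) (derive1 g t) = 0.
Proof.
have [a [b [c Hf]]] : exists a b c : 'rV[R]_3, frame a b c.
  by exists (fr1 0 0), (fr2 0), (fr3 0 0); exact: frame_fr.
have [ad _ _] := boundary_curve_dot a; have [bd _ _] := boundary_curve_dot b.
have [cd _ _] := boundary_curve_dot c.
have := is_derive_sum3 (ad t) (bd t) (cd t) (ad t) (bd t) (cd t).
have -> : (fun s => dot (g s) a * dot (g s) a + dot (g s) b * dot (g s) b +
    dot (g s) c * dot (g s) c) = (fun=> 1).
  apply/funext => s; rewrite -(frame_dot Hf (g s) (g s)).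
  by apply/sphereP/LS; exact: boundary_curve_mem.
rewrite -(frame_dot Hf (g t) (derive1 g t)) -(frame_dot Hf (derive1 g t) (g t)) dotC.
move=> [_ e1]; have [_ e2] := is_derive_cstfun (1 : R) t.
move: e1; rewrite e2; set d := dot _ _ => e1.
by apply/eqP; have /eqP := esym e1; rewrite -mulr2n mulrn_eq0.
Qed.

Lemma boundary_curve_orth2 t :
  dot (g t) (derive1 (derive1 g) t) = - dot (derive1 g t) (derive1 g t).
Proof.
have [a [b [c Hf]]] : exists a b c : 'rV[R]_3, frame a b c.
  by exists (fr1 0 0), (fr2 0), (fr3 0 0); exact: frame_fr.
have [ad a2 _] := boundary_curve_dot a; have [bd b2 _] := boundary_curve_dot b.
have [cd c2 _] := boundary_curve_dot c.
have := is_derive_sum3 (ad t) (bd t) (cd t) (a2 t) (b2 t) (c2 t).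
have -> : (fun s => dot (g s) a * dot (derive1 g s) a + dot (g s) b * dot (derive1 g s) b +
    dot (g s) c * dot (derive1 g s) c) = (fun=> 0).
  by apply/funext => s; rewrite -(frame_dot Hf (g s) (derive1 g s)) boundary_curve_orth.
rewrite -(frame_dot Hf (g t) (derive1 (derive1 g) t)).
rewrite -(frame_dot Hf (derive1 g t) (derive1 g t)) => -[_ e1].
have [_ e2] := is_derive_cstfun (0 : R) t.
by apply/eqP; rewrite -addr_eq0 -e1 e2.
Qed.

Lemma boundary_curve_speed t : 0 < dot (derive1 g t) (derive1 g t).
Proof.
case: gL => -[_ sp] _ _ _; have := sp t; rewrite /speed /enorm => h.
by rewrite lt0r dot_ge0 andbT; apply: contra_neq h => ->; rewrite sqrtr0.
Qed.

(** The vector [n] is g x g', and pushing [u] against it by [e] lowers the triple product by e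
    |g'|^2; the supporting inequality at the pushed point therefore leaves a positive gap at [u]. *)
Lemma boundary_curve_interior u t : sph_interior L u ->
  0 < triple (g t) (derive1 g t) u.
Proof.
move=> Lu; have gS := LS (boundary_curve_mem t).
have [a [b Hf]] := frame_exists gS; set o := g t in Hf *.
have go : dot (derive1 g t) o = 0 by rewrite dotC boundary_curve_orth.
have [[_ _ oo] [_ ao bo]] := frame_dots Hf.
pose n := vec a b o (- dot (derive1 g t) b) (dot (derive1 g t) a) 0.
have [e e0 [k k0 Lk]] := sph_interior_move n Lu.
case: gL => _ _ _ /(_ t _ Lk); rewrite -/o !(frame_triple Hf) go (dotC o a) (dotC o b) ao bo oo.
rewrite !dotZl !dotBl !dotZl !(dot_vecE Hf) => h.
have v0 := boundary_curve_speed t; rewrite (frame_dot Hf) go in v0.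
have {}h : 0 <= k * ((dot (derive1 g t) a * dot u b - dot (derive1 g t) b * dot u a) -
  e * (dot (derive1 g t) a * dot (derive1 g t) a + dot (derive1 g t) b * dot (derive1 g t) b + 0 * 0)) by lra.
rewrite pmulr_rge0// subr_ge0 in h.
by have := lt_le_trans (mulr_gt0 e0 v0) h; lra.
Qed.

End BoundaryCurve.

(** * Symmetric bodies in gnomonic polar coordinates *)

Section RadialBody.
Context {R : realType}.
Implicit Types (u v w a b o : 'rV[R]_3) (g : R -> 'rV[R]_3) (f : R -> R).

(* The points whose gnomonic image (x, y) / z has polar coordinates (r / h, w) with
   r / h <= 1 / f w. *)
Definition radial_body a b o f : set 'rV[R]_3 :=
  [set u | sphere u /\ exists w r h : R,
    [/\ 0 <= r, f w * r <= h & u = vec a b o (r * cos w) (r * sin w) h]].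

Section CurveToRadial.
Variables (K : set 'rV[R]_3) (a b o u0 : 'rV[R]_3) (g : R -> 'rV[R]_3).
Hypothesis Hf : frame a b o.
Hypothesis KS : K `<=` sphere.
Hypothesis Kcl : closed K.
Hypothesis Kcv : forall u v, K u -> K v -> v != - u -> geod_arc u v `<=` K.
Hypothesis Ku0 : sph_interior K u0.
Hypothesis Kpos : forall u, K u -> 0 < dot u o.
Hypothesis Krefl : forall u, K u -> K (vec a b o (- dot u a) (- dot u b) (dot u o)).
Hypothesis gK : boundary_curve K g.
Hypothesis gcurv : forall t, 0 < geod_curvature g t.

Let x t := dot (g t) a.
Let y t := dot (g t) b.
Let z t := dot (g t) o.
Let x' t := dot (derive1 g t) a.
Let y' t := dot (derive1 g t) b.
Let z' t := dot (derive1 g t) o.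
Let x2 t := dot (derive1 (derive1 g) t) a.
Let y2 t := dot (derive1 (derive1 g) t) b.
Let z2 t := dot (derive1 (derive1 g) t) o.
(** The determinant of g, g' and [o]; divided by x^2 + y^2 it is the angular velocity of the curve
    about [o]. *)
Let D t := x t * y' t - y t * x' t.

Let xd (t : R) : is_derive t 1 x (x' t). Proof. by have [] := boundary_curve_dot gK a. Qed.
Let yd (t : R) : is_derive t 1 y (y' t). Proof. by have [] := boundary_curve_dot gK b. Qed.
Let zd (t : R) : is_derive t 1 z (z' t). Proof. by have [] := boundary_curve_dot gK o. Qed.
Let x'd (t : R) : is_derive t 1 x' (x2 t). Proof. by have [] := boundary_curve_dot gK a. Qed.
Let y'd (t : R) : is_derive t 1 y' (y2 t). Proof. by have [] := boundary_curve_dot gK b. Qed.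
Let z'd (t : R) : is_derive t 1 z' (z2 t). Proof. by have [] := boundary_curve_dot gK o. Qed.
Let x2c : continuous x2. Proof. by have [] := boundary_curve_dot gK a. Qed.
Let y2c : continuous y2. Proof. by have [] := boundary_curve_dot gK b. Qed.
Let z2c : continuous z2. Proof. by have [] := boundary_curve_dot gK o. Qed.

Let gin t : K (g t). Proof. exact: (boundary_curve_mem Kcl gK). Qed.

Let xyz t : x t ^+ 2 + y t ^+ 2 + z t ^+ 2 = 1.
Proof. by have := KS (gin t); rewrite (frame_sphere Hf). Qed.

Let xyz' t : x t * x' t + y t * y' t + z t * z' t = 0.
Proof. by have := boundary_curve_orth KS Kcl gK t; rewrite (frame_dot Hf). Qed.

Let xyz2 t : x t * x2 t + y t * y2 t + z t * z2 t =
  - (x' t ^+ 2 + y' t ^+ 2 + z' t ^+ 2).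
Proof.
have := boundary_curve_orth2 KS Kcl gK t; rewrite [dot (g t) _](frame_dot Hf).
by rewrite [dot (derive1 g t) (derive1 g t)](frame_dot Hf) -!expr2.
Qed.

Let v2 t := x' t ^+ 2 + y' t ^+ 2 + z' t ^+ 2.

Let v2gt0 t : 0 < v2 t.
Proof. by have := boundary_curve_speed gK t; rewrite (frame_dot Hf) -!expr2. Qed.

Let N t u := (y t * z' t - z t * y' t) * dot u a +
  (z t * x' t - x t * z' t) * dot u b + D t * dot u o.

Let NE t u : triple (g t) (derive1 g t) u = N t u.
Proof.
by rewrite (frame_triple Hf) /N /D -/(x t) -/(y t) -/(z t) -/(x' t) -/(y' t) -/(z' t); ring.
Qed.

Let Nge0 t u : K u -> 0 <= N t u.
Proof. by case: gK => _ _ _ h /h; rewrite -NE. Qed.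

Let Nu0 t : 0 < N t u0.
Proof. by rewrite -NE; exact: (boundary_curve_interior KS Kcl gK t Ku0). Qed.

(** Adding the supporting inequalities at [u0] and at its reflection cancels the components along
    [a] and [b] and leaves 2 D times the height of [u0]. The first inequality is strict because [u0]
    is interior. *)
Let D0 t : 0 < D t.
Proof.
have Kr : K u0.
  case: Ku0 => s0; rewrite /within /= => h; exact: (nbhs_singleton h).
have := Nge0 t (Krefl Kr); have := Nu0 t; have := Kpos Kr.
rewrite /N !(dot_vecE Hf); set u3 := dot u0 o => u30 h1 h2.
have : 0 < D t * u3 by lra.
by rewrite pmulr_lgt0.
Qed.

Let q0 t : 0 < x t ^+ 2 + y t ^+ 2.
Proof.
rewrite lt0r addr_ge0 ?sqr_ge0// andbT paddr_eq0 ?sqr_ge0// !sqrf_eq0.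
by apply/negP => /andP[/eqP h /eqP k]; have := D0 t; rewrite /D h k !mul0r subrr ltxx.
Qed.

Let z0 t : 0 < z t.
Proof. exact: (Kpos (gin t)). Qed.

Let r t := Num.sqrt (x t ^+ 2 + y t ^+ 2).
Let r0 t : 0 < r t. Proof. by rewrite sqrtr_gt0. Qed.
Let rn t : r t != 0. Proof. by rewrite gt_eqF. Qed.
Let Dn t : D t != 0. Proof. by rewrite gt_eqF. Qed.
Let r2 t : r t ^+ 2 = x t ^+ 2 + y t ^+ 2. Proof. by rewrite sqr_sqrtr// ltW. Qed.

(** Of two boundary points over the same ray, each satisfies the supporting inequality at the other,
    which compares their heights both ways. They are thus proportional, and unit length forces c =
    1. *)
Let samedir s t c : 0 < c -> x s = c * x t -> y s = c * y t -> g s = g t.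
Proof.
move=> c0 xs ys.
have ineq s1 t1 c1 : 0 < c1 -> x s1 = c1 * x t1 -> y s1 = c1 * y t1 -> z s1 <= c1 * z t1.
  move=> c10 xs1 ys1; have := Nge0 s1 (gin t1); rewrite /N -/(x t1) -/(y t1) -/(z t1) => h.
  have : 0 <= c1 * ((y s1 * z' s1 - z s1 * y' s1) * x t1 +
    (z s1 * x' s1 - x s1 * z' s1) * y t1 + D s1 * z t1) by rewrite mulr_ge0// ltW.
  have -> : c1 * ((y s1 * z' s1 - z s1 * y' s1) * x t1 +
    (z s1 * x' s1 - x s1 * z' s1) * y t1 + D s1 * z t1) =
    (y s1 * z' s1 - z s1 * y' s1) * (c1 * x t1) +
    (z s1 * x' s1 - x s1 * z' s1) * (c1 * y t1) + D s1 * (c1 * z t1) by ring.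
  rewrite -xs1 -ys1.
  have -> : (y s1 * z' s1 - z s1 * y' s1) * x s1 + (z s1 * x' s1 - x s1 * z' s1) * y s1 +
    D s1 * (c1 * z t1) = D s1 * (c1 * z t1 - z s1) by rewrite /D; ring.
  by rewrite pmulr_rge0// subr_ge0.
have zs : z s = c * z t.
  apply/eqP; rewrite eq_le (ineq _ _ _ c0 xs ys)/=.
  have := ineq t s c^-1; rewrite invr_gt0 => /(_ c0).
  rewrite xs ys !mulKf ?gt_eqF// => /(_ erefl erefl).
  by rewrite mulrC ler_pdivlMr// mulrC.
have c1 : c = 1.
  have := xyz s; rewrite xs ys zs !exprMn -!mulrDr xyz mulr1 => /eqP.
  by rewrite sqrp_eq1 ?ltW// => /eqP.
by apply: (frame_eq Hf); rewrite -!/(x _) -!/(y _) -!/(z _) ?xs ?ys ?zs c1 mul1r.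
Qed.

(** [F] is the future f read along the curve. Dividing its time derivative by the angular velocity D
    / r^2 gives [G], the value of f'; [G'] is the time derivative of [G]. *)
Let F t := z t / r t.
Let G t := z' t / (r t * D t).
Let G' t := (z2 t * (r t * D t) - z' t * (- (z t * z' t) / r t * D t +
  r t * (x t * y2 t - y t * x2 t))) / (r t * D t) ^+ 2.

Let rd (t : R) : is_derive t 1 r (- (z t * z' t) / r t).
Proof.
have h := q0; isderE; first by rewrite /r; isder.
cbn beta; rewrite -/(r t) !expr1.
by rewrite (_ : z t * z' t = - (x t * x' t + y t * y' t)); [field|have := xyz' t; lra].
Qed.

Let Dd (t : R) : is_derive t 1 D (x t * y2 t - y t * x2 t).
Proof. by isderE; [rewrite /D; isder|cbn beta; ring]. Qed.

Let Fd (t : R) : is_derive t 1 F (z' t / r t ^+ 3).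
Proof.
isderE; first by rewrite /F; isder.
cbn beta; transitivity (z' t * (r t ^+ 2 + z t ^+ 2) / r t ^+ 3); first by field.
by rewrite r2 xyz mulr1.
Qed.

Let Gd (t : R) : is_derive t 1 G (G' t).
Proof.
have h s : r s * D s != 0 by rewrite mulf_neq0.
isderE; first by rewrite /G; isder.
by cbn beta; rewrite /G'; field; rewrite rn Dn.
Qed.

Let Tr t := x t * (y' t * z2 t - z' t * y2 t) - y t * (x' t * z2 t - z' t * x2 t) +
  z t * (x' t * y2 t - y' t * x2 t).

Let Tr0 t : 0 < Tr t.
Proof.
have sp : 0 < speed g t.
  by rewrite /speed /enorm sqrtr_gt0 (frame_dot Hf) -!expr2; exact: v2gt0.
have := gcurv t; rewrite /geod_curvature (frame_triple Hf) -/(Tr t).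
by rewrite pmulr_lgt0// invr_gt0 exprn_gt0.
Qed.

(** The left side is f + f'' at the polar angle of g t, and [Tr] is the numerator of the geodesic
    curvature. Positive curvature thus becomes f + f'' > 0. The identities E1, E2 and E4 rest on |g|
    = 1 and its first two derivatives. *)
Let curv_id t : F t + G' t * r t ^+ 2 / D t = Tr t * r t ^+ 3 / D t ^+ 3.
Proof.
have E1 : D t * v2 t + z t * (z2 t * D t - z' t * (x t * y2 t - y t * x2 t)) =
    r t ^+ 2 * (x' t * y2 t - y' t * x2 t).
  have -> : D t * v2 t + z t * (z2 t * D t - z' t * (x t * y2 t - y t * x2 t)) =
    D t * v2 t + (z t * z2 t) * D t - (z t * z' t) * (x t * y2 t - y t * x2 t) by ring.
  have -> : z t * z2 t = - v2 t - x t * x2 t - y t * y2 t by have := xyz2 t; rewrite /v2; lra.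
  have -> : z t * z' t = - (x t * x' t + y t * y' t) by have := xyz' t; lra.
  by rewrite r2 /D; ring.
have E2 : D t ^+ 2 + z' t ^+ 2 = v2 t * r t ^+ 2.
  have h : z t * z' t = - (x t * x' t + y t * y' t) by have := xyz' t; lra.
  have e1 : z' t ^+ 2 = z' t ^+ 2 * (x t ^+ 2 + y t ^+ 2) + (z t * z' t) ^+ 2.
    by rewrite -[LHS]mulr1 -(xyz t); ring.
  by rewrite e1 h r2 /D /v2; ring.
have E3 : Tr t = z2 t * D t - z' t * (x t * y2 t - y t * x2 t) +
    z t * (x' t * y2 t - y' t * x2 t) by rewrite /Tr /D; ring.
have E4 : r t ^+ 2 = 1 - z t ^+ 2 by rewrite r2; have := xyz t; lra.
apply: (mulfI (mulf_neq0 (rn t) (expf_neq0 3 (Dn t)))).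
transitivity (z t * D t * (D t ^+ 2 + z' t ^+ 2) +
  r t ^+ 2 * (z2 t * D t - z' t * (x t * y2 t - y t * x2 t))).
  by rewrite /F /G'; field; rewrite rn Dn.
transitivity (r t ^+ 4 * Tr t); last by field.
rewrite E2 E3.
set A := z2 t * D t - _ in E1 *; set E := x' t * y2 t - _ in E1 *.
transitivity (r t ^+ 2 * (z t * (D t * v2 t + z t * A) + (1 - z t ^+ 2) * A)); first by ring.
by rewrite E1 -E4; ring.
Qed.

Lemma curve_radial : K o -> exists f f' f2 : R -> R,
  [/\ forall t : R, is_derive t 1 f (f' t),
      forall t : R, is_derive t 1 f' (f2 t),
      continuous f2 &
      forall t, 0 < f t] /\
  [/\ forall t, 0 < f t + f2 t,
      forall t, f (t + pi) = f t &
      K = radial_body a b o f].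
Proof.
move=> Ko.
case: (gK) => _ [g1 ginj] _ _.
have x'c := is_derive_continuous x'd; have y'c := is_derive_continuous y'd.
have z'c := is_derive_continuous z'd.
have x1 t : x (t + 1) = x t by rewrite /x g1.
have y1 t : y (t + 1) = y t by rewrite /y g1.
have z1 t : z (t + 1) = z t by rewrite /z g1.
have [|phi [phid cs phi1]] := angle_lift_periodic xd yd x'c y'c x1 y1 D0.
  move=> s c /andP[s0 s1] c0 xs ys.
  have := samedir c0 xs ys => /ginj; rewrite !in_itv/= lexx ltr01 s1 ltW// => /(_ erefl erefl) h.
  by rewrite h ltxx in s0.
have phi'0 t : 0 < D t / (x t ^+ 2 + y t ^+ 2) by rewrite divr_gt0.
have [sg [Ks sK sd sT]] := quasiperiodic_inverse phid phi'0 ltr01 phi1.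
pose f (w : R) := F (sg w).
pose f' (w : R) := G (sg w).
pose f2 (w : R) := G' (sg w) * r (sg w) ^+ 2 / D (sg w).
have fd (w : R) : is_derive w 1 f (f' w).
  have := @is_derive_compfun _ F sg w _ _ (Fd (sg w)) (sd w).
  congr is_derive; rewrite /f' /G -/(D _) -r2; field.
  by rewrite rn Dn.
have f'd (w : R) : is_derive w 1 f' (f2 w).
  have := @is_derive_compfun _ G sg w _ _ (Gd (sg w)) (sd w).
  by congr is_derive; rewrite /f2 -/(D _) -r2; field; rewrite rn Dn.
have sgc := is_derive_continuous sd.
have zc := is_derive_continuous zd; have rc := is_derive_continuous rd.
have xc := is_derive_continuous xd; have yc := is_derive_continuous yd.
have Dc := is_derive_continuous Dd.
have G'c : continuous G'.
  have h t : (r t * D t) ^+ 2 != 0 by rewrite expf_neq0// mulf_neq0.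
  by rewrite /G'; iscont.
have f2c : continuous f2.
  have h : continuous (fun t => G' t * r t ^+ 2 / D t) by iscont.
  exact: (@continuous_compfun _ (fun t => G' t * r t ^+ 2 / D t) sg).
have f0 (w : R) : 0 < f w by rewrite divr_gt0.
have ff (w : R) : 0 < f w + f2 w.
  by rewrite /f /f2 curv_id divr_gt0 ?mulr_gt0 ?exprn_gt0.
have ginE (w : R) : [/\ x (sg w) = r (sg w) * cos w, y (sg w) = r (sg w) * sin w &
    z (sg w) = r (sg w) * f w].
  have [h1 h2] := cs (sg w); rewrite sK -/(r _) in h1 h2.
  by split => //; rewrite /f /F mulrC divfK.
(* The supporting inequality at the boundary point of angle [w], applied to a point over the same
   ray, is D (h - f w rho) >= 0. *)
have nec u (w rho h : R) : K u -> 0 <= rho -> u = vec a b o (rho * cos w) (rho * sin w) h ->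
    f w * rho <= h.
  move=> Ku rho0 uE; have := Nge0 (sg w) Ku; rewrite /N uE !(dot_vecE Hf).
  have [e1 e2 e3] := ginE w.
  have -> : (y (sg w) * z' (sg w) - z (sg w) * y' (sg w)) * (rho * cos w) +
   (z (sg w) * x' (sg w) - x (sg w) * z' (sg w)) * (rho * sin w) + D (sg w) * h =
   D (sg w) * (h - f w * rho).
    apply: (mulfI (rn (sg w))).
    transitivity (((y (sg w) * z' (sg w) - z (sg w) * y' (sg w)) * (r (sg w) * cos w) +
      (z (sg w) * x' (sg w) - x (sg w) * z' (sg w)) * (r (sg w) * sin w)) * rho +
      r (sg w) * D (sg w) * h); first by ring.
    rewrite -e1 -e2; transitivity (- (z (sg w) * D (sg w)) * rho + r (sg w) * D (sg w) * h).
      by rewrite /D; ring.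
    by rewrite e3; ring.
  by rewrite pmulr_rge0// subr_ge0.
have fT (w : R) : f (w + pi *+ 2) = f w by rewrite /f sT /F /r x1 y1 z1.
(* The reflected boundary point lies in K over the angle w + pi. Two such half turns return to [w],
   so the inequality is an equality. *)
have fle (w : R) : f (w + pi) <= f w.
  have [e1 e2 e3] := ginE w.
  have := nec _ (w + pi) (r (sg w)) (z (sg w)) (Krefl (gin (sg w))) (ltW (r0 _)).
  rewrite cosDpi' sinDpi' -/(x _) -/(y _) -/(z _) e1 e2 !mulrN => /(_ erefl).
  by rewrite e3 mulrC ler_pM2l.
have fpi (w : R) : f (w + pi) = f w.
  apply/eqP; rewrite eq_le fle /= -{1}fT mulr2n addrA; exact: fle.
exists f, f', f2; split; first by split.
split => //; apply/seteqP; split => [u Ku|u [us [w [rho [h [rho0 fh uE]]]]]].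
- split; first exact: KS.
  have [|e] := eqVneq (dot u a ^+ 2 + dot u b ^+ 2) 0.
    move=> /eqP; rewrite paddr_eq0 ?sqr_ge0// !sqrf_eq0 => /andP[/eqP ua /eqP ub].
    exists 0, 0, (dot u o); split => //; first by rewrite mulr0 ltW// Kpos.
    by rewrite {1}(frame_vec Hf u) ua ub !mul0r.
  have e0 : 0 < dot u a ^+ 2 + dot u b ^+ 2 by rewrite lt0r e addr_ge0 ?sqr_ge0.
  pose rho := Num.sqrt (dot u a ^+ 2 + dot u b ^+ 2).
  have rho0 : 0 < rho by rewrite sqrtr_gt0.
  have rhon : rho != 0 by rewrite gt_eqF.
  have [w [cw sw]] : exists w : R, dot u a / rho = cos w /\ dot u b / rho = sin w.
    by apply: angle_exists; rewrite !expr_div_n -mulrDl sqr_sqrtr ?divff// ltW.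
  have uE : u = vec a b o (rho * cos w) (rho * sin w) (dot u o).
    by rewrite -cw -sw ![rho * _]mulrC !divfK// -(frame_vec Hf).
  by exists w, rho, (dot u o); split => //; [exact: ltW|exact: nec Ku (ltW rho0) uE].
- have [e1 e2 e3] := ginE w.
  (* The point lies on the arc from the centre to the boundary point of angle [w]: it is rho / r
     times the latter plus h - f w rho times [o]. *)
  apply: (Kcv Ko (gin (sg w))).
    apply/eqP => e; have := z0 (sg w); rewrite /z e dotNl.
    by have [[_ _ ->] _] := frame_dots Hf; lra.
  split => //; exists (h - f w * rho), (rho / r (sg w)); split.
  + by rewrite subr_ge0.
  + by rewrite divr_ge0// ltW.
  + apply: (frame_eq Hf); have [[aa bb oo] [ab ao bo]] := frame_dots Hf;
      rewrite uE !(dot_vecE Hf) !dotDl !dotZl ?oo ?(dotC o a) ?(dotC o b) ?ao ?bo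
      -?/(x _) -?/(y _) -?/(z _) ?e1 ?e2 ?e3; field; exact: rn.
Qed.

End CurveToRadial.

(** The centre is in K because it is the midpoint of the arc from a point to its reflection. The
    frame is taken of the form [fr1], [fr2], [fr3] since the area is later transported along the
    rotations that these describe. *)
Lemma symmetric_radial (K : set 'rV[R]_3) o : sphere o -> sph_convex_body K ->
  sph_proper K -> C2plus K -> symmetric_about o K ->
  exists t q : R, exists f f' f2 : R -> R,
  [/\ forall t : R, is_derive t 1 f (f' t),
      forall t : R, is_derive t 1 f' (f2 t),
      continuous f2 &
      forall t, 0 < f t] /\
  [/\ forall t, 0 < f t + f2 t,
      forall t, f (t + pi) = f t &
      K = radial_body (fr1 t q) (fr2 q) (fr3 t q) f].
Proof.
move=> so [KS Kcl [u0 Ku0] Kcv] [e se Ke] [g gK gc] sym.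
have Kr0 : K u0 by case: Ku0 => s0; rewrite /within /= => h; exact: (nbhs_singleton h).
have refl u : K u -> K (point_reflection o u) by move=> Ku; rewrite -sym; exists u.
(* A point plus its reflection is 2 dot u o times [o], and [e] is positive on this sum. So dot u o
   has the same sign on all of K, and replacing [o] by [- o], which gives the same reflection, makes
   it positive. *)
have pos u : K u -> 0 < dot u o * dot e o.
  move=> Ku; have := addr_gt0 (Ke _ Ku) (Ke _ (refl _ Ku)).
  rewrite -dotDr /point_reflection addrC subrK dotZr; lra.
have [p [sp pp pos']] : exists p, [/\ sphere p, point_reflection p = point_reflection o &
    forall u, K u -> 0 < dot u p].
  have [eo|eo] := ltP 0 (dot e o).
    by exists o; split => // u /pos; rewrite pmulr_lgt0.
  exists (- o); split.
  - by apply/sphereP; rewrite dotNl dotNr opprK; apply/sphereP.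
  - by apply/funext => u; rewrite /point_reflection dotNr scalerN mulrN scaleNr opprK.
  - move=> u Ku; rewrite dotNr; have := pos _ Ku; rewrite oppr_gt0.
    have eo' : dot e o < 0.
      by rewrite lt_neqAle eo andbT; apply/eqP => h; have := pos _ Ku; rewrite h mulr0 ltxx.
    by rewrite nmulr_lgt0.
have [t [q pE]] := sphere_fr3 sp; exists t, q.
have Hf := frame_fr t q; rewrite pE in pp pos' sp; clear p pE.
have [[aa bb ppd] [ab ap bp]] := frame_dots Hf.
set a := fr1 t q in Hf aa ab ap *; set b := fr2 q in Hf bb ab bp *.
set p := fr3 t q in Hf ppd ap bp pp pos' sp *;
apply: (curve_radial Hf KS Kcl Kcv Ku0 pos' _ gK gc).
- move=> u Ku; have := refl _ Ku; rewrite -pp.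
  congr K; apply: (frame_eq Hf); rewrite !(dot_vecE Hf) /point_reflection dotBl dotZl.
  + by rewrite (dotC p) ap; ring.
  + by rewrite (dotC p) bp; ring.
  + by rewrite ppd; ring.
- have Kr := refl _ Kr0; rewrite -pp in Kr; have u0p := pos' _ Kr0.
  apply: (Kcv _ _ Kr0 Kr).
    apply/eqP; rewrite /point_reflection => h.
    have : dot ((2 * dot u0 p) *: p - u0 + u0) p = 0.
      by rewrite h addNr -(scale0r p) dotZl mul0r.
    by rewrite subrK dotZl ppd mulr1; lra.
  split => //; exists (2 * dot u0 p)^-1, (2 * dot u0 p)^-1; split.
  + by rewrite invr_ge0; lra.
  + by rewrite invr_ge0; lra.
  + rewrite -scalerDr /point_reflection addrC subrK scalerA mulVf ?scale1r//.
    by rewrite gt_eqF//; lra.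
Qed.

End RadialBody.

(** * The dual body and its boundary *)

Section Periodic.
Context {R : realType}.

Lemma periodic_int (T : Type) (h : R -> T) p : (forall x, h (x + p) = h x) ->
  forall (k : int) x, h (x + k%:~R * p) = h x.
Proof.
move=> hp; have hn (n : nat) x : h (x + n%:R * p) = h x.
  elim: n x => [|n IHn] x; first by rewrite mul0r addr0.
  by rewrite -natr1 mulrDl mul1r addrA hp IHn.
case=> n x; first exact: hn.
rewrite NegzE mulrNz mulNr -[in RHS](subrK (n.+1%:R * p) x).
by rewrite (hn n.+1).
Qed.

Lemma period_repr (c p x : R) : 0 < p -> exists2 y, c <= y < c + p &
  exists k : int, x = y + k%:~R * p.
Proof.
move=> p0; pose k := Num.floor ((x - c) / p).
exists (x - k%:~R * p); last by exists k; rewrite subrK.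
have := floor_itv ((x - c) / p); rewrite -/k => /andP[k1 k2].
rewrite ler_pdivlMr// in k1; rewrite ltr_pdivrMr// intrD mulrDl mul1r in k2.
by apply/andP; split; lra.
Qed.

End Periodic.

(** * The tangent inequality for functions with f + f'' > 0 *)

Section SupportInequality.
Context {R : realType}.
Variables (f f' f2 : R -> R).
Hypothesis fd : forall x : R, is_derive x 1 f (f' x).
Hypothesis f'd : forall x : R, is_derive x 1 f' (f2 x).
Hypothesis ff0 : forall x, 0 < f x + f2 x.
Hypothesis fT : forall x, f (x + pi *+ 2) = f x.

(* Variation of constants: the derivative of k is (f + f2) (w + s) sin (x - s). *)
Lemma support_ineq w x : f w * cos x + f' w * sin x <= f (w + x).
Proof.
wlog xpi : x / - pi <= x <= pi.
  move=> H; have pp : 0 < pi *+ 2 :> R by rewrite mulrn_wgt0// pi_gt0.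
  have [y /andP[y1 y2] [k ->]] := period_repr (- pi) x pp.
  have ypi : - pi <= y <= pi by rewrite y1 /=; move: y2; rewrite mulr2n; lra.
  have -> : cos (y + k%:~R * (pi *+ 2)) = cos y by apply: periodic_int; exact: cosD2pi.
  have -> : sin (y + k%:~R * (pi *+ 2)) = sin y by apply: periodic_int; exact: sinD2pi.
  by rewrite addrA (periodic_int fT); exact: H.
pose k s := (f' (w + s) + f w * sin s - f' w * cos s) * sin (x - s) +
            (f (w + s) - f w * cos s - f' w * sin s) * cos (x - s).
have kd (s : R) : is_derive s 1 k ((f (w + s) + f2 (w + s)) * sin (x - s)).
  have Dw : is_derive s 1 (fun s => w + s) 1 by isderE; [isder|rewrite add0r].
  have d1 : is_derive s 1 (fun s => f (w + s)) (f' (w + s)).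
    by have := @is_derive_compfun _ f (fun s => w + s) s _ _ (fd (w + s)) Dw; rewrite mulr1.
  have d2 : is_derive s 1 (fun s => f' (w + s)) (f2 (w + s)).
    by have := @is_derive_compfun _ f' (fun s => w + s) s _ _ (f'd (w + s)) Dw; rewrite mulr1.
  have s1 : is_derive s 1 (fun s => sin (x - s)) (- cos (x - s)).
    by isderE; [isder|cbn beta; ring].
  have c1 : is_derive s 1 (fun s => cos (x - s)) (sin (x - s)).
    by isderE; [isder|cbn beta; ring].
  have s2 := is_derive_sin s; have c2 := is_derive_cos s.
  have A := is_derive_add (is_derive_add d2 (is_derive_mul (is_derive_cstfun (f w) s) s2))
    (is_derive_opp (is_derive_mul (is_derive_cstfun (f' w) s) c2)).
  have B := is_derive_add (is_derive_add d1 (is_derive_opp (is_derive_mul (is_derive_cstfun (f w) s) c2)))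
    (is_derive_opp (is_derive_mul (is_derive_cstfun (f' w) s) s2)).
  have := is_derive_add (is_derive_mul A s1) (is_derive_mul B c1).
  by rewrite /k; congr is_derive; ring.
have k0 : k 0 = 0 by rewrite /k addr0 sin0 cos0; ring.
have kx : k x = f (w + x) - f w * cos x - f' w * sin x by rewrite /k subrr sin0 cos0; ring.
suff : k 0 <= k x by rewrite k0 kx; lra.
have [x0|x0] := leP 0 x.
  apply: (derive_ge0_le x0 kd) => s /andP[s0 sx].
  apply: mulr_ge0; first exact: ltW.
  by apply: sin_ge0_pi; move: xpi => /andP[_ ?]; apply/andP; split; lra.
have kNd (s : R) : is_derive s 1 (fun s => - k s) (- ((f (w + s) + f2 (w + s)) * sin (x - s))).
  exact: is_derive_opp.
have : - k x <= - k 0.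
  apply: (derive_ge0_le (ltW x0) kNd) => s /andP[s0 sx].
  rewrite -mulrN -sinN; apply: mulr_ge0; first exact: ltW.
  by apply: sin_ge0_pi; move: xpi => /andP[? _]; apply/andP; split; lra.
by rewrite lerN2.
Qed.

End SupportInequality.

Section DualBody.
Context {R : realType}.
Implicit Types (u v : 'rV[R]_3) (g : R -> 'rV[R]_3).
Variables (a b o : 'rV[R]_3).
Hypothesis Hf : frame a b o.
Variables (f f' f2 : R -> R).
Hypothesis fd : forall x : R, is_derive x 1 f (f' x).
Hypothesis f'd : forall x : R, is_derive x 1 f' (f2 x).
Hypothesis f2c : continuous f2.
Hypothesis f0 : forall x, 0 < f x.
Hypothesis ff0 : forall x, 0 < f x + f2 x.
Hypothesis fT : forall x, f (x + pi *+ 2) = f x.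

Let K := radial_body a b o f.
Let W := slant2 f f'.
Let s := slant f.
Let f'T := derive_periodic fd fT.
Let f2T := derive_periodic f'd f'T.
Let pp : 0 < pi *+ 2 :> R.
Proof. by rewrite mulrn_wgt0// pi_gt0. Qed.
Let Wgt x : 0 < W x. Proof. exact: slant2_gt0. Qed.
Let Wn x : W x != 0. Proof. exact: slant2_neq0. Qed.
Let sgt x : 0 < s x. Proof. exact: slant_gt0. Qed.

(* Up to the factor slant f w, the pairing of v with the boundary point of K at angle w,
   and its derivative in w. *)
Definition pairing v (w : R) := dot v a * cos w + dot v b * sin w + dot v o * f w.
Definition pairing' v (w : R) := - dot v a * sin w + dot v b * cos w + dot v o * f' w.

(* The unit normal at the boundary point of K at angle w, which runs through the
   boundary of the dual body. *)
Definition normal (w : R) := vec a b o ((- f w * cos w + f' w * sin w) / W w)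
  ((- f w * sin w - f' w * cos w) / W w) (W w)^-1.

Let pdots := dot_vecE Hf.

Lemma pairing_periodic v w : pairing v (w + pi *+ 2) = pairing v w.
Proof. by rewrite /pairing fT cosD2pi sinD2pi. Qed.

Lemma is_derive_pairing v (w : R) : is_derive w 1 (pairing v) (pairing' v w).
Proof. by isderE; [rewrite /pairing; isder|cbn beta; rewrite /pairing'; ring]. Qed.

(** A point of K is a nonnegative multiple of a boundary point plus a nonnegative multiple of [o],
    so testing on the boundary is enough once dot v o >= 0. The latter follows by adding the
    pairings at [w] and w + pi. *)
Lemma sph_dualE : sph_dual K = [set v | sphere v /\ forall w, 0 <= pairing v w].
Proof.
apply/seteqP; split => v [vs h]; split => //.
- move=> w.
  pose u := vec a b o ((s w)^-1 * cos w) ((s w)^-1 * sin w) (f w / s w).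
  have sn : s w != 0 by rewrite gt_eqF.
  have Ku : K u.
    split; last by exists w, (s w)^-1, (f w / s w); rewrite invr_ge0 ltW.
    apply/(frame_sphere Hf); rewrite /u !pdots.
    transitivity ((cos w ^+ 2 + sin w ^+ 2 + f w ^+ 2) / s w ^+ 2); first by field.
    by rewrite cos2Dsin2 sqr_slant divff// -sqr_slant expf_neq0.
  have := h _ Ku; rewrite (frame_dot Hf) /u !pdots.
  have -> : dot v a * ((s w)^-1 * cos w) + dot v b * ((s w)^-1 * sin w) + dot v o * (f w / s w) =
    pairing v w / s w by rewrite /pairing; field.
  by rewrite pmulr_lge0// invr_gt0.
- move=> u [us [w [r [k [r0 fk ->]]]]].
  rewrite (frame_dot Hf) !pdots.
  have v3 : 0 <= dot v o.
    have := addr_ge0 (h w) (h (w + pi)); rewrite /pairing cosDpi' sinDpi'.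
    have -> : dot v a * cos w + dot v b * sin w + dot v o * f w +
      (dot v a * - cos w + dot v b * - sin w + dot v o * f (w + pi)) =
      dot v o * (f w + f (w + pi)) by ring.
    by rewrite pmulr_lge0// addr_gt0.
  have -> : dot v a * (r * cos w) + dot v b * (r * sin w) + dot v o * k =
    r * pairing v w + dot v o * (k - f w * r) by rewrite /pairing; ring.
  by rewrite addr_ge0// mulr_ge0// subr_ge0.
Qed.

Lemma continuous_dotl u : continuous (fun v => dot v u : R).
Proof.
move=> v; have -> : (fun v => dot v u : R) = (fun v => v 0 ord0 * u 0 ord0 +
    v 0 (inord 1) * u 0 (inord 1) + v 0 (inord 2) * u 0 (inord 2)).
  by apply/funext => x; rewrite /dot sum3.
have E i : (fun x : 'rV[R]_3 => x ord0 i) @ v --> v ord0 i by exact: coord_continuous.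
by apply: (cvgD (cvgD (cvgM (E _) (cvg_cst _)) (cvgM (E _) (cvg_cst _)))
  (cvgM (E _) (cvg_cst _))).
Qed.

Lemma closed_sph_dual : closed (sph_dual K).
Proof.
rewrite sph_dualE.
have -> : [set v | sphere v /\ forall w, 0 <= pairing v w] =
    [set v | enorm v ^+ 2 = 1] `&` \bigcap_(w in [set: R])
      ((fun v => dot v (vec a b o (cos w) (sin w) (f w))) @^-1` [set x : R | 0 <= x]).
  apply/seteqP; split => v /=.
    move=> [vs h]; split; first by rewrite vs expr1n.
    by move=> w _ /=; rewrite (frame_dot Hf) !pdots; exact: h.
  move=> [vs h]; split.
    by have /eqP := vs; rewrite sqrp_eq1 ?sqrtr_ge0// => /eqP.
  by move=> w; have := h w I; rewrite /= (frame_dot Hf) !pdots.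
apply: closedI.
  have -> : [set v : 'rV[R]_3 | enorm v ^+ 2 = 1] =
     (fun v => dot v a * dot v a + dot v b * dot v b + dot v o * dot v o : R) @^-1` [set 1].
    by apply/seteqP; split => v /=; rewrite /enorm sqr_sqrtr ?dot_ge0// -(frame_dot Hf v v).
  apply: closed_comp; last first.
    by apply: accessible_closed_set1; apply: hausdorff_accessible; exact: Rhausdorff.
  move=> v _; have E c := @continuous_dotl c v.
  exact: (cvgD (cvgD (cvgM (E _) (E _)) (cvgM (E _) (E _))) (cvgM (E _) (E _))).
apply: closed_bigI => w _; apply: closed_comp; last exact: closed_ge.
by move=> v _; exact: continuous_dotl.
Qed.

Lemma sph_dual_interior v : sphere v -> (forall w, 0 < pairing v w) ->
  sph_interior (sph_dual K) v.
Proof.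
move=> vs h; split => //; rewrite sph_dualE.
have pc := is_derive_continuous (is_derive_pairing v).
have fc := is_derive_continuous fd.
have [w1 _ min] := EVT_min (ltW pp) (continuous_subspaceT pc).
have [w2 _ max] := EVT_max (ltW pp) (continuous_subspaceT fc).
set B := f w2 in max; have B0 : 0 < B by exact: f0.
(* Changing each frame coordinate of [v] by less than [e] changes the pairing by at most e (1 + 1 +
   B), which is the minimum of [pairing v]. *)
pose e := pairing v w1 / (2 + B).
have e0 : 0 < e by rewrite divr_gt0//; lra.
have na c : \forall u \near v, `|dot v c - dot u c| < e.
  by have := @continuous_dotl c v => /cvgr_dist_lt; apply.
suff : \forall u \near v, sphere u -> sphere u /\ forall w, 0 <= pairing u w by [].
near=> u => us; split => // w.
wlog w02 : w / 0 <= w <= pi *+ 2.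
  move=> H; have [y /andP[y1 y2] [k ->]] := period_repr 0 w pp.
  rewrite (periodic_int (pairing_periodic u)); apply: H.
  by rewrite y1 ltW//; move: y2; rewrite add0r.
have h1 : pairing v w1 <= pairing v w by apply: min; rewrite in_itv.
have h2 : f w <= B by apply: max; rewrite in_itv.
have ha : `|dot v a - dot u a| < e by near: u; exact: na.
have hb : `|dot v b - dot u b| < e by near: u; exact: na.
have ho : `|dot v o - dot u o| < e by near: u; exact: na.
have d : pairing v w - pairing u w <= e + e + e * B.
  have -> : pairing v w - pairing u w = (dot v a - dot u a) * cos w +
    (dot v b - dot u b) * sin w + (dot v o - dot u o) * f w by rewrite /pairing; ring.
  apply: lerD; first apply: lerD.
  - apply: (le_trans (ler_norm _)); rewrite normrM -[e]mulr1.
    by apply: ler_pM => //; [exact: ltW|exact: cos_max].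
  - apply: (le_trans (ler_norm _)); rewrite normrM -[e]mulr1.
    by apply: ler_pM => //; [exact: ltW|exact: sin_max].
  - apply: (le_trans (ler_norm _)); rewrite normrM.
    by apply: ler_pM => //; [exact: ltW|rewrite ger0_norm// ltW].
have : e + e + e * B = pairing v w1 by rewrite /e; field; rewrite gt_eqF//; lra.
lra.
Unshelve. all: by end_near. Qed.

Lemma pairing_normal w : pairing (normal w) w = 0.
Proof.
rewrite /pairing /normal !pdots.
transitivity (f w * (1 - (cos w ^+ 2 + sin w ^+ 2)) / W w); first by field.
by rewrite cos2Dsin2 subrr mulr0 mul0r.
Qed.

Lemma sphere_normal w : sphere (normal w).
Proof.
apply/(frame_sphere Hf); rewrite /normal !pdots.
transitivity (((f w ^+ 2 + f' w ^+ 2) * (cos w ^+ 2 + sin w ^+ 2) + 1) / W w ^+ 2).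
  by field.
by rewrite cos2Dsin2 sqr_slant2 mulr1 addrC addrA divff// gt_eqF// oneDsqr2_gt0.
Qed.

Lemma normal_dual w : sph_dual K (normal w).
Proof.
rewrite sph_dualE; split; first exact: sphere_normal.
move=> x; have := support_ineq fd f'd ff0 fT w (x - w).
rewrite (addrC w) subrK cosB sinB => h.
have -> : pairing (normal w) x = (f x - (f w * (cos x * cos w + sin x * sin w) +
   f' w * (sin x * cos w - cos x * sin w))) / W w.
  by rewrite /pairing /normal !pdots; field.
by rewrite divr_ge0 ?subr_ge0// ltW.
Qed.

(** At a boundary point some pairing vanishes, and so does its derivative, the pairing being minimal
    there. These two linear equations fix [v] up to a factor, which unit length and dot v o >= 0
    determine. Conversely, pushing [normal w] against the boundary point of angle [w] leaves the
    dual body. *)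
Lemma sph_dual_boundary v : sph_boundary (sph_dual K) v <-> exists w, v = normal w.
Proof.
split.
- move=> []; rewrite -(closure_id _).1; last exact: closed_sph_dual.
  rewrite {1}sph_dualE => -[vs h] nint.
  have [w pw] : exists w, pairing v w = 0.
    apply: contrapT => /forallNP nw; apply: nint; apply: sph_dual_interior => // w.
    by rewrite lt_neqAle h andbT eq_sym; apply/eqP; exact: nw.
  have dw : pairing' v w = 0.
    have win : w \in `]w - 1, w + 1[ by rewrite in_itv/=; apply/andP; split; lra.
    have [_ e1] : is_derive w 1 (pairing v) 0.
      apply: (@derive1_at_min R (pairing v) (w - 1) (w + 1) w _ _ win); first by lra.
        by move=> x _; have [] := is_derive_pairing v x.
      by move=> x _; rewrite pw.
    by have [_ e2] := is_derive_pairing v w; rewrite -e2 e1.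
  exists w.
  have cs := cos2Dsin2 w.
  have e1 : dot v a = dot v o * (- f w * cos w + f' w * sin w).
    rewrite -[LHS]mulr1 -cs.
    transitivity (pairing v w * cos w - pairing' v w * sin w + dot v o * (- f w * cos w + f' w * sin w)).
      by rewrite /pairing /pairing'; ring.
    by rewrite pw dw !mul0r subrr add0r.
  have e2 : dot v b = dot v o * (- f w * sin w - f' w * cos w).
    rewrite -[LHS]mulr1 -cs.
    transitivity (pairing v w * sin w + pairing' v w * cos w + dot v o * (- f w * sin w - f' w * cos w)).
      by rewrite /pairing /pairing'; ring.
    by rewrite pw dw !mul0r addr0 add0r.
  have v3 : 0 <= dot v o.
    have := h (w + pi); rewrite /pairing cosDpi' sinDpi'.
    have := pw; rewrite /pairing => pw'.
    have -> : dot v a * - cos w + dot v b * - sin w + dot v o * f (w + pi) =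
      - (dot v a * cos w + dot v b * sin w + dot v o * f w) + dot v o * (f w + f (w + pi)) by ring.
    by rewrite pw' oppr0 add0r pmulr_lge0// addr_gt0.
  have v3W : dot v o = (W w)^-1.
    have : (dot v o * W w) ^+ 2 = 1.
      have /(frame_sphere Hf) := vs; rewrite e1 e2 => e3.
      rewrite exprMn sqr_slant2 -[RHS]e3.
      transitivity (dot v o ^+ 2 * (1 + (f w ^+ 2 + f' w ^+ 2) * (cos w ^+ 2 + sin w ^+ 2))).
        by rewrite cs; ring.
      by ring.
    have vW : 0 <= dot v o * W w by exact: mulr_ge0 v3 (ltW (Wgt w)).
    move/eqP; rewrite sqrp_eq1// => /eqP e.
    by apply: (mulIf (Wn w)); rewrite e mulVf.
  by apply: (frame_eq Hf); rewrite /normal !pdots ?e1 ?e2 v3W// mulrC.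
- move=> [w ->]; split; first exact/subset_closure/normal_dual.
  move=> nint.
  have [e e0 [k k0]] := sph_interior_move (vec a b o (cos w) (sin w) (f w)) nint.
  rewrite sph_dualE => -[_ /(_ w)].
  have -> : pairing (k *: (normal w - e *: vec a b o (cos w) (sin w) (f w))) w =
    k * (pairing (normal w) w - e * (cos w ^+ 2 + sin w ^+ 2 + f w ^+ 2)).
    by rewrite /pairing !dotZl !dotBl !dotZl !pdots; ring.
  rewrite pairing_normal cos2Dsin2 sub0r mulrN oppr_ge0 leNgt mulr_gt0// mulr_gt0//.
  exact: oneDsqr_gt0.
Qed.

Let fn x : f x != 0. Proof. by rewrite gt_eqF. Qed.
Let Wd := is_derive_slant2 fd f'd.
Let cs1 w := cos2Dsin2 (w : R).

Let n1 (w : R) := (- f w * cos w + f' w * sin w) / W w.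
Let n2 (w : R) := (- f w * sin w - f' w * cos w) / W w.
Let n3 (w : R) := (W w)^-1.

(* normal' = (f + f2) t *)
Let t1 (w : R) := sin w / W w - (- f w * cos w + f' w * sin w) * f' w / W w ^+ 3.
Let t2 (w : R) := - cos w / W w - (- f w * sin w - f' w * cos w) * f' w / W w ^+ 3.
Let t3 (w : R) := - (f' w / W w ^+ 3).

Let n1d (w : R) : is_derive w 1 n1 ((f w + f2 w) * t1 w).
Proof. by isderE; [rewrite /n1; isder|cbn beta; rewrite /t1 -/W; field]. Qed.
Let n2d (w : R) : is_derive w 1 n2 ((f w + f2 w) * t2 w).
Proof. by isderE; [rewrite /n2; isder|cbn beta; rewrite /t2 -/W; field]. Qed.
Let n3d (w : R) : is_derive w 1 n3 ((f w + f2 w) * t3 w).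
Proof. by isderE; [rewrite /n3; isder|cbn beta; rewrite /t3 -/W; field]. Qed.

Let dotn w : [/\ dot (normal w) a = n1 w, dot (normal w) b = n2 w & dot (normal w) o = n3 w].
Proof. by rewrite /normal !pdots. Qed.

Let tsq w : t1 w ^+ 2 + t2 w ^+ 2 + t3 w ^+ 2 = s w ^+ 2 / W w ^+ 4.
Proof.
have e : s w ^+ 2 = W w ^+ 2 - f' w ^+ 2 by rewrite sqr_slant sqr_slant2; ring.
transitivity ((cos w ^+ 2 + sin w ^+ 2) / W w ^+ 2 -
   2 * f' w ^+ 2 * (cos w ^+ 2 + sin w ^+ 2) / W w ^+ 4 +
   f' w ^+ 2 * (1 + (f w ^+ 2 + f' w ^+ 2) * (cos w ^+ 2 + sin w ^+ 2)) / W w ^+ 6).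
  by rewrite /t1 /t2 /t3; field.
rewrite cs1 mulr1.
have -> : 1 + (f w ^+ 2 + f' w ^+ 2) * 1 = W w ^+ 2 by rewrite sqr_slant2; ring.
by rewrite e; field.
Qed.

(** Biduality: the cross product of the normal with its tangent t is the boundary direction (cos w,
    sin w, f w) of K, divided by W^2. *)
Let cross1 w : n2 w * t3 w - n3 w * t2 w = cos w / W w ^+ 2.
Proof. by rewrite /n2 /n3 /t2 /t3; field. Qed.
Let cross2 w : n3 w * t1 w - n1 w * t3 w = sin w / W w ^+ 2.
Proof. by rewrite /n1 /n3 /t1 /t3; field. Qed.
Let cross3 w : n1 w * t2 w - n2 w * t1 w = f w / W w ^+ 2.
Proof.
transitivity (f w * (cos w ^+ 2 + sin w ^+ 2) / W w ^+ 2).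
  by rewrite /n1 /n2 /t1 /t2; field.
by rewrite cs1 mulr1.
Qed.

Let pairt w : t1 w * cos w + t2 w * sin w + t3 w * f w = 0.
Proof.
transitivity (f' w * f w * (cos w ^+ 2 + sin w ^+ 2 - 1) / W w ^+ 3).
  by rewrite /t1 /t2 /t3; field.
by rewrite cs1 subrr mulr0 mul0r.
Qed.

Let pairt' w : - t1 w * sin w + t2 w * cos w + t3 w * f' w = - (W w)^-1.
Proof.
transitivity (- (cos w ^+ 2 + sin w ^+ 2) / W w + f' w ^+ 2 * (cos w ^+ 2 + sin w ^+ 2 - 1) / W w ^+ 3).
  by rewrite /t1 /t2 /t3; field.
by rewrite cs1 subrr mulr0 mul0r addr0 mulNr mul1r.
Qed.

(* The azimuth of the normal. *)
Let theta (w : R) := w + pi + atan (f' w / f w).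

Let rho w := Num.sqrt (f w ^+ 2 + f' w ^+ 2) / W w.

Let q0 w : 0 < f w ^+ 2 + f' w ^+ 2.
Proof. by have := exprn_gt0 2 (f0 w); have := sqr_ge0 (f' w); lra. Qed.

Let rho_gt0 w : 0 < rho w.
Proof. by apply: divr_gt0; [rewrite sqrtr_gt0; exact: q0|exact: Wgt]. Qed.

Let theta_cs w : n1 w = rho w * cos (theta w) /\ n2 w = rho w * sin (theta w).
Proof.
have qs : 0 < Num.sqrt (f w ^+ 2 + f' w ^+ 2) by rewrite sqrtr_gt0.
have ca : cos (atan (f' w / f w)) = f w / Num.sqrt (f w ^+ 2 + f' w ^+ 2).
  rewrite cos_atan.
  have -> : 1 + (f' w / f w) ^+ 2 = (f w ^+ 2 + f' w ^+ 2) / f w ^+ 2 by field.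
  rewrite sqrtrM ?ltW// sqrtrV ?sqr_ge0// sqrtr_sqr gtr0_norm//.
  by rewrite invf_div.
have sa : sin (atan (f' w / f w)) = f' w / Num.sqrt (f w ^+ 2 + f' w ^+ 2).
  have c0 : cos (atan (f' w / f w)) != 0 by rewrite ca gt_eqF// divr_gt0.
  have := atanK (f' w / f w); rewrite /tan => e.
  rewrite -[sin _](divfK c0) e ca; field; rewrite fn gt_eqF//.
rewrite /theta addrAC cosDpi' sinDpi' cosD sinD ca sa /rho /n1 /n2.
by split; field; rewrite Wn gt_eqF.
Qed.

Let thetad (w : R) : is_derive w 1 theta (f w * (f w + f2 w) / (f w ^+ 2 + f' w ^+ 2)).
Proof.
isderE; first by rewrite /theta; isder.
cbn beta.
have qn : f w ^+ 2 + f' w ^+ 2 != 0 by rewrite gt_eqF.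
have -> : 1 + (f' w / f w) ^+ 2 = (f w ^+ 2 + f' w ^+ 2) / f w ^+ 2 by field.
by field; rewrite fn qn.
Qed.

Let theta'0 w : 0 < f w * (f w + f2 w) / (f w ^+ 2 + f' w ^+ 2).
Proof. by rewrite divr_gt0// mulr_gt0. Qed.

Let thetaT w : theta (w + pi *+ 2) = theta w + pi *+ 2.
Proof. by rewrite /theta fT f'T; ring. Qed.

(** Equal normals have azimuths [theta] that agree modulo 2 pi, and [theta] increases by exactly 2
    pi over a period. *)
Lemma normal_inj w w' : `|w - w'| < pi *+ 2 -> normal w = normal w' -> w = w'.
Proof.
move=> ww e.
have [ea eb _] := dotn w; have [ea' eb' _] := dotn w'.
have E1 : n1 w = n1 w' by rewrite -ea e ea'.
have E2 : n2 w = n2 w' by rewrite -eb e eb'.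
have [c1 s1] := theta_cs w; have [c2 s2] := theta_cs w'.
have rE x : rho x ^+ 2 = n1 x ^+ 2 + n2 x ^+ 2.
  have [c3 s3] := theta_cs x; rewrite c3 s3 !exprMn -mulrDr.
  by rewrite cos2Dsin2 mulr1.
have rr : rho w = rho w'.
  have /eqP : rho w ^+ 2 = rho w' ^+ 2 by rewrite !rE E1 E2.
  by rewrite eqrXn2 ?(ltW (rho_gt0 _))// => /eqP.
have cc : cos (theta w) = cos (theta w').
  by apply: (mulfI (lt0r_neq0 (rho_gt0 w))); rewrite -c1 rr -c2.
have ss : sin (theta w) = sin (theta w').
  by apply: (mulfI (lt0r_neq0 (rho_gt0 w))); rewrite -s1 rr -s2.
have inc := derive_gt0_lt thetad theta'0.
have key x y : x < y -> y - x < pi *+ 2 -> cos (theta x) = cos (theta y) ->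
    sin (theta x) = sin (theta y) -> False.
  move=> xy yx c s'; have : cos (theta y - theta x) < 1.
    apply: cos_lt1; rewrite subr_gt0 inc//=.
    have : theta y < theta (x + pi *+ 2) by apply: inc; lra.
    by rewrite thetaT; lra.
  by rewrite cosB c s' -!expr2 cos2Dsin2 ltxx.
have [h|h|//] := ltgtP w w'; exfalso.
  by apply: (key w w') => //; move: ww; rewrite ltr_norml => /andP[]; lra.
by apply: (key w' w) => //; move: ww; rewrite ltr_norml => /andP[]; lra.
Qed.

(** As in [samedir]: the constraint that is tight at one point holds at the other, in both
    directions, and unit length then gives c = 1. *)
Lemma boundary_samedir v u c : sph_boundary (sph_dual K) v ->
  sph_boundary (sph_dual K) u -> 0 < c -> dot u a = c * dot v a ->
  dot u b = c * dot v b -> u = v.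
Proof.
have ineq v' u' c' : sph_boundary (sph_dual K) v' -> sph_boundary (sph_dual K) u' ->
    dot u' a = c' * dot v' a -> dot u' b = c' * dot v' b -> c' * dot v' o <= dot u' o.
  move=> /sph_dual_boundary[w ->] /sph_dual_boundary[w' ->] ua ub.
  have := normal_dual w'; rewrite sph_dualE => -[_ /(_ w)].
  have := pairing_normal w; rewrite /pairing ua ub => h h'.
  have : 0 <= (dot (normal w') o - c' * dot (normal w) o) * f w.
    have e : c' * (dot (normal w) a * cos w + dot (normal w) b * sin w + dot (normal w) o * f w) = 0.
      by rewrite h mulr0.
    by lra.
  by rewrite pmulr_lge0// subr_ge0.
move=> bv bu c0 ua ub.
have uo : dot u o = c * dot v o.
  apply/eqP; rewrite eq_le (ineq _ _ _ bv bu ua ub) andbT.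
  have := ineq u v c^-1 bu bv; rewrite ua ub !mulKf ?gt_eqF// => /(_ erefl erefl).
  by rewrite mulrC ler_pdivrMr// mulrC.
have sv : sphere v by have /sph_dual_boundary[w ->] := bv; exact: sphere_normal.
have su : sphere u by have /sph_dual_boundary[w ->] := bu; exact: sphere_normal.
have c1 : c = 1.
  have := (frame_sphere Hf u).1 su; rewrite ua ub uo !exprMn -!mulrDr.
  rewrite ((frame_sphere Hf v).1 sv) mulr1 => /eqP.
  by rewrite sqrp_eq1 ?ltW// => /eqP.
by apply: (frame_eq Hf); rewrite ?ua ?ub ?uo c1 mul1r.
Qed.

Lemma sphere_sph_dual : sph_dual K `<=` sphere.
Proof. by move=> v []. Qed.

Lemma sph_dual_center : sph_interior (sph_dual K) o.
Proof.
have [[_ _ oo] [_ ao bo]] := frame_dots Hf.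
apply: sph_dual_interior; first exact/sphereP.
by move=> w; rewrite /pairing oo (dotC o a) (dotC o b) ao bo !mul0r !add0r mul1r.
Qed.

(** [chi] is the polar angle of [g] about [o], followed by the inverse of the azimuth [theta] of the
    normals. Monotonicity and the gain of one full period make curvature and boundary integrals
    independent of the curve. *)
Lemma boundary_curve_normal g : boundary_curve (sph_dual K) g ->
  exists chi c : R -> R,
    [/\ forall t : R, is_derive t 1 chi (c t), continuous c, forall t, 0 < c t,
      forall t, chi (t + 1) = chi t + pi *+ 2 & forall t, g t = normal (chi t)].
Proof.
move=> gK; have [xd x2d _] := boundary_curve_dot gK a.
have [yd y2d _] := boundary_curve_dot gK b.
set x := (fun t => dot (g t) a) in xd; set y := (fun t => dot (g t) b) in yd.
set x' := (fun t => dot (derive1 g t) a) in x2d xd.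
set y' := (fun t => dot (derive1 g t) b) in y2d yd.
have xc := is_derive_continuous xd; have yc := is_derive_continuous yd.
have x'c := is_derive_continuous x2d; have y'c := is_derive_continuous y2d.
case: (gK) => _ [g1 ginj] rg _.
have gb t : sph_boundary (sph_dual K) (g t) by rewrite -rg; exists t.
have D0 t : 0 < x t * y' t - y t * x' t.
  have := boundary_curve_interior sphere_sph_dual closed_sph_dual gK t sph_dual_center.
  have [[_ _ oo] [_ ao bo]] := frame_dots Hf.
  by rewrite (frame_triple Hf) oo (dotC o a) (dotC o b) ao bo -/(x t) -/(y t) -/(x' t) -/(y' t); lra.
have [| | |Th [Thd Thcs ThT]] := angle_lift_periodic xd yd x'c y'c _ _ D0.
- by move=> t; rewrite /x g1.
- by move=> t; rewrite /y g1.
- move=> t c /andP[t0 t1'] c0 xt yt.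
  have := boundary_samedir (gb 0) (gb t) c0 xt yt => /ginj.
  rewrite !in_itv/= lexx ltr01 t1' ltW// => /(_ erefl erefl) h.
  by rewrite h ltxx in t0.
have [ta [Kt tK tad taT]] := quasiperiodic_inverse thetad theta'0 pp thetaT.
have r0 t : 0 < x t ^+ 2 + y t ^+ 2.
  rewrite lt0r addr_ge0 ?sqr_ge0// andbT paddr_eq0 ?sqr_ge0// !sqrf_eq0.
  by apply/negP => /andP[/eqP h /eqP k]; have := D0 t; rewrite h k !mul0r subrr ltxx.
pose chi (t : R) := ta (Th t).
pose c (t : R) := (f (chi t) * (f (chi t) + f2 (chi t)) / (f (chi t) ^+ 2 + f' (chi t) ^+ 2))^-1 *
  ((x t * y' t - y t * x' t) / (x t ^+ 2 + y t ^+ 2)).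
have chid (t : R) : is_derive t 1 chi (c t).
  exact: (@is_derive_compfun _ ta Th t _ _ (tad (Th t)) (Thd t)).
have chic := is_derive_continuous chid.
have fc := is_derive_continuous fd; have f'c := is_derive_continuous f'd.
exists chi, c; split => //.
- have h1 : continuous (fun w => (f w * (f w + f2 w) / (f w ^+ 2 + f' w ^+ 2))^-1).
    have h2 w : f w * (f w + f2 w) / (f w ^+ 2 + f' w ^+ 2) != 0 by rewrite gt_eqF.
    have h3 w : f w ^+ 2 + f' w ^+ 2 != 0 by rewrite gt_eqF.
    by iscont.
  have h4 t : x t ^+ 2 + y t ^+ 2 != 0 by rewrite gt_eqF.
  apply: continuous_mul.
    exact: (@continuous_compfun _ (fun w => (f w * (f w + f2 w) / (f w ^+ 2 + f' w ^+ 2))^-1) chi).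
  by iscont.
- by move=> t; rewrite mulr_gt0 ?invr_gt0// divr_gt0.
- by move=> t; rewrite /chi ThT taT.
- move=> t; apply: (boundary_samedir (c := Num.sqrt (x t ^+ 2 + y t ^+ 2) / rho (chi t))).
  + by apply/sph_dual_boundary; exists (chi t).
  + exact: gb.
  + by apply: divr_gt0; [rewrite sqrtr_gt0|exact: rho_gt0].
  + have [-> _ _] := dotn (chi t); have [-> _] := theta_cs (chi t).
    rewrite -/(x t) {1}(Thcs t).1 /chi tK; field; rewrite gt_eqF//; exact: rho_gt0.
  + have [_ -> _] := dotn (chi t); have [_ ->] := theta_cs (chi t).
    rewrite -/(y t) {1}(Thcs t).2 /chi tK; field; rewrite gt_eqF//; exact: rho_gt0.
Qed.

Section Reparametrization.
Variables (g : R -> 'rV[R]_3) (chi c : R -> R).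
Hypothesis gK : boundary_curve (sph_dual K) g.
Hypothesis chid : forall t : R, is_derive t 1 chi (c t).
Hypothesis c0 : forall t, 0 < c t.
Hypothesis gE : forall t, g t = normal (chi t).

Let k t := (f (chi t) + f2 (chi t)) * c t.

Let g'E t : [/\ dot (derive1 g t) a = k t * t1 (chi t), dot (derive1 g t) b = k t * t2 (chi t) &
  dot (derive1 g t) o = k t * t3 (chi t)].
Proof.
have D u (n t' : R -> R) : (forall w, dot (normal w) u = n w) ->
    (forall w : R, is_derive w 1 n ((f w + f2 w) * t' w)) ->
    dot (derive1 g t) u = k t * t' (chi t).
  move=> nE nd; have [/(_ t)[_ <-] _ _] := boundary_curve_dot gK u.
  have -> : (fun s => dot (g s) u) = (fun s => n (chi s)).
    by apply/funext => r; rewrite gE nE.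
  have [_ ->] := @is_derive_compfun _ n chi t _ _ (nd (chi t)) (chid t).
  by rewrite /k; ring.
split; [apply: (D a n1)|apply: (D b n2)|apply: (D o n3)] => // w; by have [] := dotn w.
Qed.

Lemma reparam_speed t : speed g t = curvds f f' f2 (chi t) * c t.
Proof.
have k0 : 0 < k t by rewrite mulr_gt0.
have [e1 e2 e3] := g'E t.
rewrite /speed /enorm (frame_dot Hf) e1 e2 e3.
have -> : k t * t1 (chi t) * (k t * t1 (chi t)) + k t * t2 (chi t) * (k t * t2 (chi t)) +
    k t * t3 (chi t) * (k t * t3 (chi t)) =
    k t ^+ 2 * (t1 (chi t) ^+ 2 + t2 (chi t) ^+ 2 + t3 (chi t) ^+ 2) by ring.
rewrite tsq.
have -> : k t ^+ 2 * (s (chi t) ^+ 2 / W (chi t) ^+ 4) =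
    (k t * (s (chi t) / W (chi t) ^+ 2)) ^+ 2 by field.
rewrite sqrtr_sqr ger0_norm; last first.
  by apply: mulr_ge0; [exact: ltW|apply: divr_ge0; [exact: ltW|apply: exprn_ge0; exact: ltW]].
by rewrite /k /curvds -/s -/W; field.
Qed.

(** Since [chi] is only known to be C^1, g' = k t is not differentiated factor by factor. By the
    [cross] identities g x g' is parallel to the boundary direction of K at [chi t], so only the
    product of g'' with that direction is required; differentiating the vanishing product of g' with
    it supplies this. *)
Lemma reparam_curvature t : geod_curvature g t = (curv f f' f2 (chi t))^-1.
Proof.
have k0 r : 0 < k r by rewrite mulr_gt0.
have [_ a2 _] := boundary_curve_dot gK a; have [_ b2 _] := boundary_curve_dot gK b.
have [_ o2 _] := boundary_curve_dot gK o.
pose x2 := dot (derive1 (derive1 g) t) a; pose y2 := dot (derive1 (derive1 g) t) b.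
pose z2 := dot (derive1 (derive1 g) t) o.
have E : x2 * cos (chi t) + y2 * sin (chi t) + z2 * f (chi t) = k t * c t / W (chi t).
  have dc : is_derive t 1 (fun s => cos (chi s)) (- sin (chi t) * c t).
    by isder.
  have ds : is_derive t 1 (fun s => sin (chi s)) (cos (chi t) * c t).
    by isder.
  have df := @is_derive_compfun _ f chi t _ _ (fd (chi t)) (chid t).
  have := is_derive_sum3 (a2 t) (b2 t) (o2 t) dc ds df.
  have -> : (fun s0 => dot (derive1 g s0) a * cos (chi s0) + dot (derive1 g s0) b * sin (chi s0) +
      dot (derive1 g s0) o * f (chi s0)) = (fun=> 0).
    apply/funext => r; have [-> -> ->] := g'E r.
    by transitivity (k r * (t1 (chi r) * cos (chi r) + t2 (chi r) * sin (chi r) +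
      t3 (chi r) * f (chi r))); [ring|rewrite pairt mulr0].
  move=> [_ e1]; have [_ e2] := is_derive_cstfun (0 : R) t; rewrite e2 in e1.
  have [g1 g2 g3] := g'E t; rewrite g1 g2 g3 -/x2 -/y2 -/z2 in e1.
  have e3 : k t * c t * (- t1 (chi t) * sin (chi t) + t2 (chi t) * cos (chi t) +
      t3 (chi t) * f' (chi t)) + (x2 * cos (chi t) + y2 * sin (chi t) + z2 * f (chi t)) = 0.
    by rewrite [RHS]e1; ring.
  by move: e3; rewrite pairt'; lra.
have [g1 g2 g3] := g'E t; have [m1 m2 m3] := dotn (chi t).
rewrite /geod_curvature reparam_speed (frame_triple Hf) gE m1 m2 m3 g1 g2 g3.
rewrite -/x2 -/y2 -/z2.
have -> : n1 (chi t) * (k t * t2 (chi t) * z2 - k t * t3 (chi t) * y2) -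
  n2 (chi t) * (k t * t1 (chi t) * z2 - k t * t3 (chi t) * x2) +
  n3 (chi t) * (k t * t1 (chi t) * y2 - k t * t2 (chi t) * x2) =
  k t * ((n2 (chi t) * t3 (chi t) - n3 (chi t) * t2 (chi t)) * x2 +
         (n3 (chi t) * t1 (chi t) - n1 (chi t) * t3 (chi t)) * y2 +
         (n1 (chi t) * t2 (chi t) - n2 (chi t) * t1 (chi t)) * z2) by ring.
rewrite cross1 cross2 cross3.
transitivity (k t / W (chi t) ^+ 2 * (x2 * cos (chi t) + y2 * sin (chi t) + z2 * f (chi t)) /
  (curvds f f' f2 (chi t) * c t) ^+ 3); first by congr (_ / _); field.
rewrite E /k /curv /curvds -/s -/W; field.
by rewrite !gt_eqF.
Qed.

End Reparametrization.

(** In the angle [w] the derivative of the normal is (f + f'') t, where f'' is merely continuous but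
    t is C^1. Taking a primitive [Sg] of f + f'' as parameter removes the rough factor and makes the
    curve C^2; the scaling by [l] makes the period 1. *)
Lemma dual_curve_exists : exists g, boundary_curve (sph_dual K) g.
Proof.
have fc := is_derive_continuous fd; have f'c := is_derive_continuous f'd.
have Wc := is_derive_continuous Wd.
have ffc : continuous (fun w => f w + f2 w) by iscont.
have [Sg Sd] := continuous_primitive ffc.
have ffT w : f (w + pi *+ 2) + f2 (w + pi *+ 2) = f w + f2 w by rewrite fT f2T.
pose l := Sg (pi *+ 2) - Sg 0.
have ST w : Sg (w + pi *+ 2) = Sg w + l.
  by have := primitive_periodic Sd ffT w 0; rewrite add0r -/l => <-; ring.
have l0 : 0 < l by rewrite subr_gt0; apply: (derive_gt0_lt Sd ff0).
have [si [KS SK sd siT]] := quasiperiodic_inverse Sd ff0 pp ST.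
pose sg (t : R) := si (l * t).
pose g t := normal (sg t).
have sgd (t : R) : is_derive t 1 sg (l / (f (sg t) + f2 (sg t))).
  have D : is_derive t 1 (fun r => l * r) l by isderE; [isder|cbn beta; ring].
  have := @is_derive_compfun _ si (fun r => l * r) t _ _ (sd (l * t)) D.
  by rewrite mulrC.
have sgc := is_derive_continuous sgd.
have fn' w : f w + f2 w != 0 by rewrite gt_eqF.
have sgT t : sg (t + 1) = sg t + pi *+ 2 by rewrite /sg mulrDr mulr1 siT.
have sginc x y : x < y -> sg x < sg y.
  by apply: (derive_gt0_lt sgd) => r; rewrite divr_gt0.
pose wd (w : R) := f' w * (f w + f2 w) / W w.
pose t1' (w : R) := cos w / W w - sin w * wd w / W w ^+ 2 -
  ((f w + f2 w) * sin w * f' w + (- f w * cos w + f' w * sin w) * f2 w) / W w ^+ 3 +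
  3 * (- f w * cos w + f' w * sin w) * f' w * wd w / W w ^+ 4.
pose t2' (w : R) := sin w / W w + cos w * wd w / W w ^+ 2 -
  (- (f w + f2 w) * cos w * f' w + (- f w * sin w - f' w * cos w) * f2 w) / W w ^+ 3 +
  3 * (- f w * sin w - f' w * cos w) * f' w * wd w / W w ^+ 4.
pose t3' (w : R) := - (f2 w / W w ^+ 3) + 3 * f' w * wd w / W w ^+ 4.
have W3 w : W w ^+ 3 != 0 by rewrite expf_neq0.
have W2 w : W w ^+ 2 != 0 by rewrite expf_neq0.
have W4 w : W w ^+ 4 != 0 by rewrite expf_neq0.
have t1d (w : R) : is_derive w 1 t1 (t1' w).
  by isderE; [rewrite /t1; isder|cbn beta; rewrite /t1' /wd -/W; field].
have t2d (w : R) : is_derive w 1 t2 (t2' w).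
  by isderE; [rewrite /t2; isder|cbn beta; rewrite /t2' /wd -/W; field].
have t3d (w : R) : is_derive w 1 t3 (t3' w).
  by isderE; [rewrite /t3; isder|cbn beta; rewrite /t3' /wd -/W; field].
have wdc : continuous wd by rewrite /wd; iscont.
have t1'c : continuous t1' by rewrite /t1'; iscont.
have t2'c : continuous t2' by rewrite /t2'; iscont.
have t3'c : continuous t3' by rewrite /t3'; iscont.
have sub (n t t' : R -> R) : (forall w : R, is_derive w 1 n ((f w + f2 w) * t w)) ->
    (forall w : R, is_derive w 1 t (t' w)) -> continuous t' ->
    [/\ forall r : R, is_derive r 1 (fun x => n (sg x)) (l * t (sg r)),
      forall r : R, is_derive r 1 (fun x => l * t (sg x)) (l * (t' (sg r) * (l / (f (sg r) + f2 (sg r))))) &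
      continuous (fun r => l * (t' (sg r) * (l / (f (sg r) + f2 (sg r)))))].
  move=> nd td t'c; split => [r|r|].
  - have := @is_derive_compfun _ n sg r _ _ (nd (sg r)) (sgd r).
    by congr is_derive; field.
  - have := @is_derive_compfun _ t sg r _ _ (td (sg r)) (sgd r) => D.
    by have := is_derive_mul (is_derive_cstfun l r) D; congr is_derive; cbn beta; ring.
  - have c1 : continuous (fun w => l * (t' w * (l / (f w + f2 w)))) by iscont.
    exact: (@continuous_compfun _ (fun w => l * (t' w * (l / (f w + f2 w)))) sg).
have [a1 a2 a3] := sub _ _ _ n1d t1d t1'c.
have [b1 b2 b3] := sub _ _ _ n2d t2d t2'c.
have [e1 e2 e3] := sub _ _ _ n3d t3d t3'c.
have gE : g = fun t => vec a b o (n1 (sg t)) (n2 (sg t)) (n3 (sg t)) by [].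
have g'E : derive1 g = fun t => vec a b o (l * t1 (sg t)) (l * t2 (sg t)) (l * t3 (sg t)).
  by apply/funext => t; have [_ <-] := is_derive_vec a b o (a1 t) (b1 t) (e1 t).
have g2E : derive1 (derive1 g) = fun t => vec a b o
    (l * (t1' (sg t) * (l / (f (sg t) + f2 (sg t)))))
    (l * (t2' (sg t) * (l / (f (sg t) + f2 (sg t)))))
    (l * (t3' (sg t) * (l / (f (sg t) + f2 (sg t))))).
  by apply/funext => t; rewrite g'E; have [_ <-] := is_derive_vec a b o (a2 t) (b2 t) (e2 t).
exists g; split.
- split; first split.
  + by move=> t; have [] := is_derive_vec a b o (a1 t) (b1 t) (e1 t).
  + by move=> t; rewrite g'E; have [] := is_derive_vec a b o (a2 t) (b2 t) (e2 t).
  + by rewrite g2E; exact: continuous_vec.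
  + move=> t; rewrite /speed /enorm g'E (frame_dot Hf) !pdots gt_eqF// sqrtr_gt0.
    have -> : l * t1 (sg t) * (l * t1 (sg t)) + l * t2 (sg t) * (l * t2 (sg t)) +
      l * t3 (sg t) * (l * t3 (sg t)) =
      l ^+ 2 * (t1 (sg t) ^+ 2 + t2 (sg t) ^+ 2 + t3 (sg t) ^+ 2) by ring.
    rewrite tsq; apply: mulr_gt0; first exact: exprn_gt0.
    by apply: divr_gt0; apply: exprn_gt0.
- split.
    move=> t; rewrite /g sgT /normal.
    by rewrite /W /slant2 !fT !f'T cosD2pi sinD2pi.
  move=> x y; rewrite !in_itv/= => /andP[x0 x1] /andP[y0 y1] e.
  have sle r : 0 <= r -> sg 0 <= sg r.
    by rewrite le_eqVlt => /predU1P[<-//|/sginc/ltW].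
  have slt r : r < 1 -> sg r < sg 0 + pi *+ 2 by move=> /sginc; rewrite -[1]add0r sgT.
  have sxy : sg x = sg y.
    apply: normal_inj e; rewrite ltr_norml.
    have := sle _ x0; have := sle _ y0; have := slt _ x1; have := slt _ y1.
    by move=> ? ? ? ?; apply/andP; split; lra.
  have : Sg (sg x) = Sg (sg y) by rewrite sxy.
  by rewrite /sg !SK => /(mulfI (lt0r_neq0 l0)).
- apply/seteqP; split => [v [t _ <-]|v /sph_dual_boundary[w ->]].
    by apply/sph_dual_boundary; exists (sg t).
  exists (Sg w / l) => //; rewrite /g /sg mulrCA divff ?mulr1 ?KS//.
  by rewrite gt_eqF.
- move=> t u; rewrite sph_dualE => -[us /(_ (sg t)) h].
  rewrite (frame_triple Hf) g'E gE !pdots.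
  have -> : n1 (sg t) * (l * t2 (sg t) * dot u o - l * t3 (sg t) * dot u b) -
    n2 (sg t) * (l * t1 (sg t) * dot u o - l * t3 (sg t) * dot u a) +
    n3 (sg t) * (l * t1 (sg t) * dot u b - l * t2 (sg t) * dot u a) =
    l * ((n2 (sg t) * t3 (sg t) - n3 (sg t) * t2 (sg t)) * dot u a +
         (n3 (sg t) * t1 (sg t) - n1 (sg t) * t3 (sg t)) * dot u b +
         (n1 (sg t) * t2 (sg t) - n2 (sg t) * t1 (sg t)) * dot u o) by ring.
  rewrite cross1 cross2 cross3.
  have -> : l * (cos (sg t) / W (sg t) ^+ 2 * dot u a + sin (sg t) / W (sg t) ^+ 2 * dot u b +
    f (sg t) / W (sg t) ^+ 2 * dot u o) = l / W (sg t) ^+ 2 * pairing u (sg t).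
    by rewrite /pairing; field.
  apply: mulr_ge0 h; apply: divr_ge0; first exact: ltW.
  by apply: exprn_ge0; exact: ltW.
Qed.

Lemma normal_eq_periodic (T : Type) (h : R -> T) w w' :
  (forall x, h (x + pi *+ 2) = h x) -> normal w = normal w' -> h w = h w'.
Proof.
move=> hT.
have nT x : normal (x + pi *+ 2) = normal x.
  by rewrite /normal /W /slant2 !fT !f'T cosD2pi sinD2pi.
have [y /andP[y1 y2] [k ->]] := period_repr 0 w pp.
have [y' /andP[y1' y2'] [k' ->]] := period_repr 0 w' pp.
rewrite !(periodic_int nT) !(periodic_int hT) => e; congr h.
apply: normal_inj e; rewrite ltr_norml.
by apply/andP; split; lra.
Qed.

Let curvT x : curv f f' f2 (x + pi *+ 2) = curv f f' f2 x.
Proof. by rewrite /curv /slant /slant2 fT f'T f2T. Qed.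

Let curvdsT x : curvds f f' f2 (x + pi *+ 2) = curvds f f' f2 x.
Proof. by rewrite /curvds /slant /slant2 fT f'T f2T. Qed.

(** All admissible curves give the same value, and [dual_curve_exists] excludes the default 0 of
    [xget]; the next lemma argues likewise for integrals. *)
Lemma geod_H1_dual w : geod_H1 (sph_dual K) (normal w) = (curv f f' f2 w)^-1.
Proof.
have val k : (exists g t, [/\ boundary_curve (sph_dual K) g, g t = normal w & k = geod_curvature g t]) ->
    k = (curv f f' f2 w)^-1.
  move=> [g [t [gK gt ->]]].
  have [chi [c [cd _ c0 _ gE]]] := boundary_curve_normal gK.
  rewrite (reparam_curvature gK cd c0 gE); congr (_^-1).
  by apply: (normal_eq_periodic curvT); rewrite -gE.
rewrite /geod_H1; case: xgetP => [k _ /val //|no].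
have [g gK] := dual_curve_exists; exfalso.
have : sph_boundary (sph_dual K) (normal w) by apply/sph_dual_boundary; exists w.
case: (gK) => _ _ <- _ [t _ gt].
by apply: (no (geod_curvature g t)); exists g, t.
Qed.

Lemma boundary_integral_dual (F : 'rV[R]_3 -> R) (h : R -> R) :
  continuous h -> (forall x, h (x + pi *+ 2) = h x) -> (forall w, F (normal w) = h w) ->
  boundary_integral (sph_dual K) F = itg 0 (pi *+ 2) (fun w => h w * curvds f f' f2 w).
Proof.
move=> hc hT FE; have cc := continuous_curvds fd f'd f2c.
have hcc : continuous (fun w => h w * curvds f f' f2 w) by iscont.
have [H Hd] := continuous_primitive hcc.
have hcT x : h (x + pi *+ 2) * curvds f f' f2 (x + pi *+ 2) = h x * curvds f f' f2 x.
  by rewrite hT curvdsT.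
have val I : (exists2 g, boundary_curve (sph_dual K) g &
    I = Rintegral lebesgue_measure `[0, 1] (fun t => F (g t) * speed g t)) ->
    I = itg 0 (pi *+ 2) (fun w => h w * curvds f f' f2 w).
  move=> [g gK ->]; have [chi [c [cd cont c0 chiT gE]]] := boundary_curve_normal gK.
  have -> : (fun t => F (g t) * speed g t) = (fun t => h (chi t) * curvds f f' f2 (chi t) * c t).
    by apply/funext => t; rewrite (reparam_speed gK cd c0 gE) gE FE mulrA.
  have Hcd (t : R) : is_derive t 1 (fun r => H (chi r)) (h (chi t) * curvds f f' f2 (chi t) * c t).
    exact: (@is_derive_compfun _ H chi t _ _ (Hd (chi t)) (cd t)).
  have chic := is_derive_continuous cd.
  have ic : continuous (fun t => h (chi t) * curvds f f' f2 (chi t) * c t).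
    apply: continuous_mul => //.
    exact: (@continuous_compfun _ (fun w => h w * curvds f f' f2 w) chi).
  rewrite -/(itg 0 1 _) (itg_FTC ler01 ic Hcd) (itg_FTC (ltW pp) hcc Hd).
  by rewrite -[1]add0r chiT (primitive_periodic Hd hcT (chi 0) 0) add0r.
rewrite /boundary_integral; case: xgetP => [I _ /val //|no]; exfalso.
have [g gK] := dual_curve_exists.
by apply: (no (Rintegral lebesgue_measure `[0, 1] (fun t => F (g t) * speed g t))); exists g.
Qed.

Lemma perimeter_dual : perimeter (sph_dual K) = itg 0 (pi *+ 2) (curvds f f' f2).
Proof.
rewrite /perimeter (@boundary_integral_dual _ (fun=> 1))//; last exact: continuous_cstfun.
by apply: eq_itg => w; rewrite mul1r.
Qed.

Lemma Omega_dual q : Omega q (sph_dual K) = itg 0 (pi *+ 2)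
  (fun w => expR (q / (2 + q) * - ln (curv f f' f2 w)) * curvds f f' f2 w).
Proof.
have k0 := curv_gt0 f' ff0; have kc := continuous_curv fd f'd f2c.
rewrite /Omega (@boundary_integral_dual _ (fun w => expR (q / (2 + q) * - ln (curv f f' f2 w))))//.
- by iscont.
- by move=> x; rewrite curvT.
- move=> w; rewrite geod_H1_dual /powR gt_eqF ?invr_gt0//.
  by rewrite lnV ?posrE.
Qed.

(** From exp (-x) >= 1 - x follows (1 - x) exp x <= 1, while (1 - x) (1 + x + 2 x^2) = 1 + x^2 (1 -
    2 x) >= 1 for x <= 1/2. *)
Lemma expR_le_quadratic (x : R) : `|x| <= 1 / 2 -> expR x <= 1 + x + 2 * x ^+ 2.
Proof.
rewrite ler_norml => /andP[x1 x2].
have h : 0 < 1 - x by lra.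
have : 1 - x <= expR (- x) by exact: expR_ge1Dx.
rewrite expRN => e; have e0 := expR_gt0 x.
have {}e : (1 - x) * expR x <= 1 by rewrite -ler_pdivlMr// mul1r.
rewrite -(ler_pM2l h); apply: (le_trans e).
have : 0 <= x ^+ 2 * (1 - 2 * x) by rewrite mulr_ge0 ?sqr_ge0//; lra.
lra.
Qed.

(* Writing p = q / (2 + q), so that 1 + 2 / q = 1 / p, Jensen and the quadratic upper
   bound for exp confine the logarithm of the quotient to [p m, p m + 2 p^2 B^2], with m
   the mean of - ln kappa. *)
Lemma entropy_radial : entropy K =
  itg 0 (pi *+ 2) (fun w => ln (curv f f' f2 w) * curvds f f' f2 w) /
  itg 0 (pi *+ 2) (curvds f f' f2).
Proof.
have k0 := curv_gt0 f' ff0; have kc := continuous_curv fd f'd f2c.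
have d0 := curvds_gt0 f' ff0; have dc := continuous_curvds fd f'd f2c.
have M0 : 0 < itg 0 (pi *+ 2) (curvds f f' f2) by exact: itg_gt0.
set M := itg 0 (pi *+ 2) (curvds f f' f2) in M0 *.
have lc : continuous (fun w => ln (curv f f' f2 w)) by iscont.
have nlc : continuous (fun w => - ln (curv f f' f2 w)) by iscont.
pose m := itg 0 (pi *+ 2) (fun w => - ln (curv f f' f2 w) * curvds f f' f2 w) / M.
have mE : itg 0 (pi *+ 2) (fun w => - ln (curv f f' f2 w) * curvds f f' f2 w) = m * M.
  by rewrite /m divfK// gt_eqF.
suff H : (Omega q (sph_dual K) / perimeter (sph_dual K)) `^ (1 + 2 / q)
    @[q --> (0 : R)^'+] --> expR m.
  rewrite /entropy /entropy_power (cvg_lim _ H)// expRK /m -mulNr; congr (_ / _).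
  rewrite (@eq_itg _ _ _ _ (fun w => -1 * (ln (curv f f' f2 w) * curvds f f' f2 w))).
    by rewrite itgZ; [rewrite mulN1r opprK|iscont].
  by move=> w; rewrite mulN1r mulNr.
have [B [B0 Bb]] : exists B, 0 < B /\ forall w, 0 <= w <= pi *+ 2 -> `|ln (curv f f' f2 w)| <= B.
  have nc : continuous (fun w => `|ln (curv f f' f2 w)|).
    by move=> w; apply: cvg_norm; exact: lc.
  have [w1 _ max] := EVT_max (ltW pp) (continuous_subspaceT nc).
  exists (`|ln (curv f f' f2 w1)| + 1); split; first by rewrite ltr_wpDl.
  by move=> w ww; apply: (@le_trans _ _ `|ln (curv f f' f2 w1)|); [apply: max; rewrite in_itv|rewrite lerDl].
have bnd q : 0 < q -> q * B <= 1 / 2 ->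
    expR m <= (Omega q (sph_dual K) / perimeter (sph_dual K)) `^ (1 + 2 / q) <= expR (m + 2 * B ^+ 2 * q).
  move=> qp qB; pose p := q / (2 + q).
  have q2 : 0 < 2 + q by lra.
  have p0 : 0 < p by rewrite divr_gt0.
  have pq : p <= q by rewrite ler_pdivrMr// -[leLHS]mulr1 ler_pM2l//; lra.
  have pE : 1 + 2 / q = p^-1 by rewrite /p invf_div; field; rewrite gt_eqF.
  rewrite Omega_dual perimeter_dual -/M -/p pE.
  have ec : continuous (fun w => expR (p * - ln (curv f f' f2 w))) by iscont.
  (* The tangent line of [expR] at p m, integrated; its linear term drops out because [m] is the
     mean. *)
  have lo : expR (p * m) * M <= itg 0 (pi *+ 2) (fun w => expR (p * - ln (curv f f' f2 w)) * curvds f f' f2 w).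
    have -> : expR (p * m) * M = itg 0 (pi *+ 2) (fun w => (expR (p * m) * (1 - p * m)) * curvds f f' f2 w +
        (expR (p * m) * p) * (- ln (curv f f' f2 w) * curvds f f' f2 w)).
      rewrite itgD; [|by iscont|by iscont]; rewrite itgZ// itgZ; last by iscont.
      by rewrite mE -/M; ring.
    apply: le_itg; [by iscont|by iscont|move=> w].
    have := expR_ge1Dx (p * - ln (curv f f' f2 w) - p * m).
    rewrite expRB ler_pdivlMr ?expR_gt0// => h.
    have := ler_wpM2r (ltW (d0 w)) h; lra.
  have hi : itg 0 (pi *+ 2) (fun w => expR (p * - ln (curv f f' f2 w)) * curvds f f' f2 w) <=
     (1 + p * m + 2 * p ^+ 2 * B ^+ 2) * M.
    have -> : (1 + p * m + 2 * p ^+ 2 * B ^+ 2) * M = itg 0 (pi *+ 2) (fun w =>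
        (1 + 2 * p ^+ 2 * B ^+ 2) * curvds f f' f2 w + p * (- ln (curv f f' f2 w) * curvds f f' f2 w)).
      rewrite itgD; [|by iscont|by iscont]; rewrite itgZ// itgZ; last by iscont.
      by rewrite mE -/M; ring.
    apply: le_itg_cc; [by iscont|by iscont|move=> w ww].
    have lB := Bb _ ww.
    have pl : `|p * - ln (curv f f' f2 w)| <= p * B.
      by rewrite normrM normrN gtr0_norm// ler_pM2l.
    have h1 := expR_le_quadratic (le_trans pl (le_trans (ler_wpM2r (ltW B0) pq) qB)).
    have h2 : (p * - ln (curv f f' f2 w)) ^+ 2 <= p ^+ 2 * B ^+ 2.
      by rewrite -exprMn -[leLHS]real_normK ?num_real// lerXn2r ?nnegrE// mulr_ge0// ltW.
    have h3 : expR (p * - ln (curv f f' f2 w)) <= 1 + p * - ln (curv f f' f2 w) + 2 * (p ^+ 2 * B ^+ 2) by lra.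
    have := ler_wpM2r (ltW (d0 w)) h3; lra.
  set O := itg 0 _ _ in lo hi *.
  have A1 : expR (p * m) <= O / M by rewrite ler_pdivlMr.
  have A2 : O / M <= 1 + p * m + 2 * p ^+ 2 * B ^+ 2 by rewrite ler_pdivrMr.
  have A0 : 0 < O / M by apply: lt_le_trans A1; exact: expR_gt0.
  rewrite /powR gt_eqF// !ler_expR.
  have l1 : p * m <= ln (O / M) by rewrite -[leLHS]expRK ler_ln ?posrE ?expR_gt0.
  have l2 : ln (O / M) <= p * m + 2 * p ^+ 2 * B ^+ 2 by have := ln_le_subr1 A0; lra.
  rewrite ![p^-1 * _]mulrC ler_pdivlMr// ler_pdivrMr// mulrC l1 /=.
  apply: (le_trans l2).
  have -> : p * m + 2 * p ^+ 2 * B ^+ 2 = (m + 2 * B ^+ 2 * p) * p by ring.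
  by rewrite ler_pM2r// lerD2l ler_pM2l// mulr_gt0// exprn_gt0.
have uc : expR (m + 2 * B ^+ 2 * q) @[q --> (0 : R)^'+] --> expR m.
  have cc : continuous (fun q : R => expR (m + 2 * B ^+ 2 * q)) by iscont.
  apply: cvg_at_right_filter; have := cc 0.
  by rewrite /continuous_at mulr0 addr0.
apply: (squeeze_cvgr _ (cvg_cst (expR m)) uc).
near=> q; apply: bnd; first by near: q; exact: nbhs_right_gt.
rewrite -ler_pdivlMr//; near: q; apply: nbhs_right_le.
by rewrite !divr_gt0.
Unshelve. all: by end_near. Qed.

End DualBody.

(** * Rotation invariance of the area *)

Section Tame.
Context {R : realType}.
Implicit Types (H : R -> R * R -> R) (u v : 'rV[R]_3).

(** The first argument is the rotation parameter. The bound is uniform in it, hence an integrable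
    majorant on a rectangle of finite measure. *)
Definition tame H := (forall e, measurable_fun [set: R * R] (H e)) /\
  exists C, forall e p, `|H e p| <= C.

Lemma tame_cst (k : R) : tame (fun _ _ => k).
Proof. by split=> [e|]; [exact: measurable_cst|exists `|k|]. Qed.

Lemma tameD H1 H2 : tame H1 -> tame H2 -> tame (fun e p => H1 e p + H2 e p).
Proof.
move=> [m1 [C1 b1]] [m2 [C2 b2]]; split=> [e|]; first exact: measurable_funD.
by exists (C1 + C2) => e p; apply: (le_trans (ler_normD _ _)); exact: lerD.
Qed.

Lemma tameM H1 H2 : tame H1 -> tame H2 -> tame (fun e p => H1 e p * H2 e p).
Proof.
move=> [m1 [C1 b1]] [m2 [C2 b2]]; split=> [e|]; first exact: measurable_funM.
by exists (C1 * C2) => e p; rewrite normrM; exact: ler_pM.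
Qed.

Lemma tame_comp (h : R -> R) H : continuous h -> tame H -> tame (fun e p => h (H e p)).
Proof.
move=> hc [mH [C bC]]; split=> [e|].
  by apply: (@measurableT_comp _ _ _ _ _ _ h) => //; exact: continuous_measurable_fun.
have C0 : - `|C| <= `|C| by rewrite lerNl; apply: le_trans (normr_ge0 _); rewrite oppr_le0.
have nc : continuous (fun w => `|h w|) by move=> w; apply: cvg_norm; exact: hc.
have [w1 _ max] := EVT_max C0 (continuous_subspaceT nc).
exists `|h w1| => e p; apply: max; rewrite in_itv /= -ler_norml.
by apply: (le_trans (bC e p)); exact: ler_norm.
Qed.

Lemma tame_fst (h : R -> R) : continuous h -> (exists C, forall x, `|h x| <= C) ->
  tame (fun _ p => h p.1).
Proof.
move=> hc [C hC]; split=> [e|]; last by exists C => e p.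
by apply: (@measurableT_comp _ _ _ _ _ _ h) => //; exact: continuous_measurable_fun.
Qed.

Lemma tame_snd (h : R -> R) : continuous h -> (exists C, forall x, `|h x| <= C) ->
  tame (fun _ p => h p.2).
Proof.
move=> hc [C hC]; split=> [e|]; last by exists C => e p.
by apply: (@measurableT_comp _ _ _ _ _ _ h) => //; exact: continuous_measurable_fun.
Qed.

Lemma tame_param (h : R -> R) : (exists C, forall x, `|h x| <= C) -> tame (fun e _ => h e).
Proof. by move=> [C hC]; split=> [e|]; [exact: measurable_cst|exists C]. Qed.

Lemma normr_sin_le1 (x : R) : `|sin x| <= 1.
Proof. by rewrite ler_norml sin_geN1 sin_le1. Qed.

Lemma normr_cos_le1 (x : R) : `|cos x| <= 1.
Proof. by rewrite ler_norml cos_geN1 cos_le1. Qed.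

End Tame.

(** * Smooth functions on space and the mollified half-spaces *)

Section Smooth.
Context {R : realType}.
Implicit Types (H : R -> R * R -> R) (n x y : 'rV[R]_3).

(** Vector-valued notions are tested against all linear functionals, so that only real-valued
    calculus is involved. *)
Definition vec_tame (u : R -> R * R -> 'rV[R]_3) := forall v, tame (fun e p => dot v (u e p)).
Definition vec_derive (u : R -> 'rV[R]_3) (t : R) x :=
  forall v, is_derive t 1 (fun r => dot v (u r)) (dot v x).
Definition vec_continuous (u : R -> 'rV[R]_3) := forall v, continuous (fun r => dot v (u r)).

(* C^1 functions of u in R^3, presented by the chain rule along curves; boundedness of the
   last two fields provides the domination for differentiating under the integral. *)
Record smooth (F : 'rV[R]_3 -> R) (dF : 'rV[R]_3 -> 'rV[R]_3 -> R) : Prop := Smooth {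
  smooth_linear : forall u k l x y, dF u (k *: x + l *: y) = k * dF u x + l * dF u y;
  smooth_derive : forall u t x, vec_derive u t x ->
    is_derive t 1 (fun r => F (u r)) (dF (u t) x);
  smooth_continuous : forall u, vec_continuous u -> continuous (fun r : R => F (u r));
  smooth_dcontinuous : forall u u', vec_continuous u -> vec_continuous u' ->
    continuous (fun r : R => dF (u r) (u' r));
  smooth_tame : forall u, vec_tame u -> tame (fun e p => F (u e p));
  smooth_dtame : forall u u', vec_tame u -> vec_tame u' -> tame (fun e p => dF (u e p) (u' e p)) }.

Lemma smooth_affine (b : R) n : smooth (fun u => b - dot n u) (fun _ x => - dot n x).
Proof.
split.
- by move=> u k l x y; rewrite dotDr !dotZr; ring.
- move=> u t x ud; have d := ud n.
  rewrite -[- dot n x]add0r; exact: (@is_derive_add _ (fun=> b) (fun r => - dot n (u r)) _ _ _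
    (is_derive_cstfun b t) (is_derive_opp d)).
- by move=> u uc; have c := uc n; iscont.
- by move=> u u' uc uc'; have c := uc' n; iscont.
- move=> u ut; apply: tameD; first exact: tame_cst.
  by apply: (@tame_comp _ -%R); [move=> x; exact: opp_continuous|exact: ut].
- move=> u u' ut ut'.
  by apply: (@tame_comp _ -%R); [move=> x; exact: opp_continuous|exact: ut'].
Qed.

Lemma smoothD F dF G dG : smooth F dF -> smooth G dG ->
  smooth (fun u => F u + G u) (fun u x => dF u x + dG u x).
Proof.
move=> sF sG; split.
- by move=> u k l x y; rewrite !(smooth_linear sF, smooth_linear sG); ring.
- move=> u t x ud; have d1 := smooth_derive sF ud; have d2 := smooth_derive sG ud.
  exact: is_derive_add.
- by move=> u uc; have c1 := smooth_continuous sF uc; have c2 := smooth_continuous sG uc; iscont.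
- move=> u u' uc uc'; have c1 := smooth_dcontinuous sF uc uc'.
  by have c2 := smooth_dcontinuous sG uc uc'; iscont.
- by move=> u ut; apply: tameD; [exact: (smooth_tame sF)|exact: (smooth_tame sG)].
- by move=> u u' ut ut'; apply: tameD; [exact: (smooth_dtame sF)|exact: (smooth_dtame sG)].
Qed.

Lemma smooth_comp (h h' : R -> R) F dF : (forall r : R, is_derive r 1 h (h' r)) ->
  continuous h' -> smooth F dF -> smooth (fun u => h (F u)) (fun u x => h' (F u) * dF u x).
Proof.
move=> hd h'c sF; have hc := is_derive_continuous hd; split.
- by move=> u k l x y; rewrite (smooth_linear sF); ring.
- move=> u t x ud; have d1 := smooth_derive sF ud.
  exact: (@is_derive_compfun _ h (fun r => F (u r)) t _ _ (hd (F (u t))) d1).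
- move=> u uc; have c1 := smooth_continuous sF uc.
  exact: (@continuous_compfun _ h (fun r => F (u r))).
- move=> u u' uc uc'; have c1 := smooth_continuous sF uc.
  apply: continuous_mul; last exact: (smooth_dcontinuous sF uc uc').
  exact: (@continuous_compfun _ h' (fun r => F (u r))).
- by move=> u ut; apply: tame_comp => //; exact: (smooth_tame sF).
- move=> u u' ut ut'; apply: tameM; last exact: (smooth_dtame sF).
  by apply: tame_comp => //; exact: (smooth_tame sF).
Qed.

Lemma continuous_pos_part : continuous (fun x : R => Num.max 0 x).
Proof.
have -> : (fun x : R => Num.max 0 x) = (fun x : R => (x + `|x|) / 2).
  by apply/funext => x; rewrite maxEle; case: ifPn => h; [rewrite ger0_norm//|
    rewrite ltr0_norm ?ltNge//]; lra.
move=> x; apply: cvgM; last exact: cvg_cst.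
by apply: cvgD; [exact: cvg_id|apply: cvg_norm; exact: cvg_id].
Qed.

(** The delicate point is 0. It is avoided by taking a primitive [H] of the continuous function max
    0 and identifying it, by integration on either side of 0, as half the square up to a
    constant. *)
Lemma is_derive_sqr_pos_part (x : R) :
  is_derive x 1 (fun x : R => Num.max 0 x ^+ 2) (2 * Num.max 0 x).
Proof.
have c := continuous_pos_part; have [H Hd] := continuous_primitive c.
have idc : continuous (fun x : R => x) by move=> r; exact: cvg_id.
have qd (r : R) : is_derive r 1 (fun r => r ^+ 2 / 2) r by isderE; [isder|cbn beta; rewrite expr1; field].
have zd (r : R) : is_derive r 1 (fun=> 0 : R) 0 by isder.
have HE r : H r = H 0 + Num.max 0 r ^+ 2 / 2.
  have [r0|r0] := leP 0 r.
    have : itg 0 r (fun x : R => Num.max 0 x) = itg 0 r (fun x : R => x).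
      by apply/le_anti/andP; split; apply: le_itg_cc => // y /andP[y0 _]; rewrite maxEle y0.
    rewrite (itg_FTC r0 c Hd) (itg_FTC r0 idc qd); lra.
  have : itg r 0 (fun x : R => Num.max 0 x) = itg r 0 (fun=> 0).
    apply/le_anti/andP; split; apply: le_itg_cc => //; try exact: continuous_cstfun.
      by move=> y /andP[_ y0]; rewrite max_l.
    by move=> y /andP[_ y0]; rewrite max_l.
  rewrite (itg_FTC (ltW r0) c Hd) (itg_FTC (ltW r0) (@continuous_cstfun R 0) zd).
  by lra.
have -> : (fun x : R => Num.max 0 x ^+ 2) = (fun x : R => 2 * H x - 2 * H 0).
  by apply/funext => r; rewrite HE; lra.
by have d := Hd x; isderE; [isder|ring].
Qed.

(* Equals 1 where all the inequalities b i <= dot (n i) u hold, and tends to 0 elsewhere. *)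
Definition mollifier (b : nat -> R) (n : nat -> 'rV[R]_3) (j : nat) u : R :=
  expR (- j%:R * \sum_(i < j) Num.max 0 (b i - dot (n i) u) ^+ 2).

Lemma smooth_mollifier b (n : nat -> 'rV[R]_3) j : exists dF, smooth (mollifier b n j) dF.
Proof.
have [dS sS] : exists dS, smooth (fun u => \sum_(i < j) Num.max 0 (b i - dot (n i) u) ^+ 2) dS.
  elim: j => [|j [dS sS]].
    exists (fun _ x => - dot 0 x).
    have -> : (fun u => \sum_(i < 0) Num.max 0 (b i - dot (n i) u) ^+ 2) = (fun u => 0 - dot 0 u).
      by apply/funext => u; rewrite big_ord0 /dot big1 ?subr0// => i _; rewrite mxE mul0r.
    exact: smooth_affine.
  have s1 := smooth_comp is_derive_sqr_pos_part
    (continuous_mul (@continuous_cstfun R 2) continuous_pos_part) (smooth_affine (b j) (n j)).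
  eexists; have -> : (fun u => \sum_(i < j.+1) Num.max 0 (b i - dot (n i) u) ^+ 2) =
     (fun u => \sum_(i < j) Num.max 0 (b i - dot (n i) u) ^+ 2 + Num.max 0 (b j - dot (n j) u) ^+ 2).
    by apply/funext => u; rewrite big_ord_recr.
  exact: smoothD sS s1.
have ed (k r : R) : is_derive r 1 (fun r => expR (k * r)) (k * expR (k * r)).
  by isderE; [isder|cbn beta; ring].
have ec (k : R) : continuous (fun r => k * expR (k * r)) by iscont.
by eexists; exact: (smooth_comp (ed (- j%:R)) (ec _) sS).
Qed.

Lemma mollifier_bounds b (n : nat -> 'rV[R]_3) j u : 0 <= mollifier b n j u <= 1.
Proof.
rewrite expR_ge0 /= -expR0 ler_expR mulNr oppr_le0 mulr_ge0// sumr_ge0// => i _.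
exact: sqr_ge0.
Qed.

Lemma mollifier_cvg b (n : nat -> 'rV[R]_3) u :
  mollifier b n j u @[j --> \oo] --> ((`[< forall i, b i <= dot (n i) u >])%:R : R).
Proof.
case: asboolP => [h|/existsNP[i /negP]].
  apply: cvg_near_cst; apply: nearW => j.
  rewrite /mollifier big1 ?mulr0 ?expR0// => i _.
  by rewrite max_l ?expr0n// subr_le0.
rewrite -ltNge => ni; set d := b i - dot (n i) u.
have d0 : 0 < d by rewrite subr_gt0.
(* A violated inequality with index [i] contributes d^2 to the sum once j > i, so the value is at
   most exp (- j d^2) <= 1 / (j d^2). *)
apply: (@squeeze_cvgr _ _ _ _ (fun=> 0) (fun j : nat => (d ^+ 2)^-1 * j%:R^-1)); last 2 first.
- exact: cvg_cst.
- rewrite -[X in _ --> X](mulr0 (d ^+ 2)^-1); apply: cvgMr.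
  by apply/gtr0_cvgV0; [near=> j; rewrite ltr0n; near: j; exact: nbhs_infty_gt|exact: cvgr_idn].
near=> j; rewrite expR_ge0 /=.
have ij : (i < j)%N by near: j; exact: nbhs_infty_gt.
have j0 : 0 < j%:R :> R by rewrite ltr0n (leq_ltn_trans _ ij).
have dj : 0 < j%:R * d ^+ 2 by rewrite mulr_gt0// exprn_gt0.
have le : j%:R * d ^+ 2 <= j%:R * \sum_(i < j) Num.max 0 (b i - dot (n i) u) ^+ 2.
  rewrite ler_pM2l// (bigD1 (Ordinal ij))//= -/d max_r ?(ltW d0)// lerDl sumr_ge0// => k _.
  exact: sqr_ge0.
rewrite -invfM [_ ^+ 2 * _]mulrC /mollifier mulNr expRN lef_pV2 ?posrE ?expR_gt0//.
by apply: (le_trans le); apply: le_trans (expR_ge1Dx _); rewrite lerDr.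
Unshelve. all: by end_near. Qed.

End Smooth.

(** * Fubini on the coordinate rectangle *)

Section Rect.
Context {R : realType}.
Implicit Types (H : R * R -> R).

Local Notation leb2 := (@lebesgue_measure R \x @lebesgue_measure R)%E.

Definition rect : set (R * R) := `[0, pi] `*` `[0, pi *+ 2].

Lemma measurable_rect : measurable rect.
Proof. by apply: measurableX; exact: measurable_itv. Qed.

Lemma itv_lty (a b : R) : (lebesgue_measure `[a, b] < +oo :> \bar R)%E.
Proof. by rewrite lebesgue_measure_itv /=; case: ifP => _; rewrite ?ltry. Qed.

Lemma rect_lty : (leb2 rect < +oo)%E.
Proof.
rewrite /rect product_measure1E//; try exact: measurable_itv.
have h (a b : R) : (lebesgue_measure `[a, b] \is a fin_num).
  by rewrite ge0_fin_numE ?itv_lty.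
by apply: lte_mul_pinfty; [exact: measure_ge0|exact: h|exact: itv_lty].
Qed.

Lemma bounded_measurable_integrable d (T : measurableType d) (mu : {measure set T -> \bar R})
  (D : set T) (H : T -> R) : measurable D -> (mu D < +oo)%E -> measurable_fun D H ->
  (exists C, forall p, D p -> `|H p| <= C) -> mu.-integrable D (EFin \o H).
Proof.
move=> mD fD mH [C bC]; apply: measurable_bounded_integrable => //.
exists C; split; first exact: num_real.
by move=> x Cx p Dp; apply: (le_trans (bC p Dp)); exact: ltW.
Qed.

Section Fubini.
Variable H : R * R -> R.
Hypothesis mH : measurable_fun [set: R * R] H.
Hypothesis bH : exists C, forall p, `|H p| <= C.

Lemma rect_integrable : leb2.-integrable rect (EFin \o H).
Proof.
apply: bounded_measurable_integrable; [exact: measurable_rect|exact: rect_lty| |].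
  exact: measurable_funTS.
by have [C bC] := bH; exists C.
Qed.

Let slice1 x : measurable_fun [set: R] (fun y => H (x, y)).
Proof. exact: (@measurableT_comp _ _ _ _ _ _ H _ (pair x)). Qed.

Let slice2 y : measurable_fun [set: R] (fun x => H (x, y)).
Proof. exact: (@measurableT_comp _ _ _ _ _ _ H _ (fun x => (x, y))). Qed.

Let itv_integrable (h : R -> R) a b : measurable_fun [set: R] h ->
  (exists C, forall x, `|h x| <= C) ->
  (@lebesgue_measure R).-integrable `[a, b] (EFin \o h).
Proof.
move=> mh [C bC]; apply: bounded_measurable_integrable; [exact: measurable_itv|exact: itv_lty| |].
  exact: measurable_funTS.
by exists C.
Qed.

Let int1 x a b : (@lebesgue_measure R).-integrable `[a, b] (EFin \o (fun y => H (x, y))).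
Proof. by apply: itv_integrable => //; have [C bC] := bH; exists C => y. Qed.

Let int2 y a b : (@lebesgue_measure R).-integrable `[a, b] (EFin \o (fun x => H (x, y))).
Proof. by apply: itv_integrable => //; have [C bC] := bH; exists C => x. Qed.

Let patch_in (x y : R) : y \in `[0, pi *+ 2] -> ((EFin \o H) \_ rect) (x, y) =
  ((EFin \o (fun x => H (x, y))) \_ `[0, pi]) x.
Proof.
move=> yD; rewrite !patchE; congr (if _ then _ else _).
by apply/idP/idP; rewrite !inE /rect /= ; [case|split].
Qed.

Let patch_in' (x y : R) : x \in `[0, pi] -> ((EFin \o H) \_ rect) (x, y) =
  ((EFin \o (fun y => H (x, y))) \_ `[0, pi *+ 2]) y.
Proof.
move=> xD; rewrite !patchE; congr (if _ then _ else _).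
by apply/idP/idP; rewrite !inE /rect /= ; [case|split].
Qed.

Lemma rect_fubini21 :
  Rintegral leb2 rect H = itg 0 (pi *+ 2) (fun y => itg 0 pi (fun x => H (x, y))).
Proof.
have i : leb2.-integrable setT ((EFin \o H) \_ rect).
  exact: (@integrable_mkcond _ _ _ leb2 rect (EFin \o H) measurable_rect).1 rect_integrable.
have E := integral21_prod_meas1 i.
rewrite /itg /Rintegral integral_mkcond -[X in fine X]E; congr fine.
rewrite [RHS]integral_mkcond; apply: eq_integral => y _.
rewrite /fubini_G patchE; case: ifPn => yD; last first.
  rewrite integral0_eq// => x _; rewrite patchE; case: ifPn => //.
  by rewrite inE /rect /= => -[_ yD']; move: yD; rewrite notin_setE.
rewrite fineK; last first.
  by apply: integrable_fin_num; [exact: measurable_itv|exact: int2].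
by rewrite [RHS]integral_mkcond; apply: eq_integral => x _; apply: patch_in; rewrite inE in yD.
Qed.

Lemma rect_fubini12 :
  Rintegral leb2 rect H = itg 0 pi (fun x => itg 0 (pi *+ 2) (fun y => H (x, y))).
Proof.
have i : leb2.-integrable setT ((EFin \o H) \_ rect).
  exact: (@integrable_mkcond _ _ _ leb2 rect (EFin \o H) measurable_rect).1 rect_integrable.
have E := integral12_prod_meas1 i.
rewrite /itg /Rintegral integral_mkcond -[X in fine X]E; congr fine.
rewrite [RHS]integral_mkcond; apply: eq_integral => x _.
rewrite /fubini_F patchE; case: ifPn => xD; last first.
  rewrite integral0_eq// => y _; rewrite patchE; case: ifPn => //.
  by rewrite inE /rect /= => -[xD' _]; move: xD; rewrite notin_setE.
rewrite fineK; last first.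
  by apply: integrable_fin_num; [exact: measurable_itv|exact: int1].
by rewrite [RHS]integral_mkcond; apply: eq_integral => y _; apply: patch_in'; rewrite inE in xD.
Qed.

End Fubini.
End Rect.
Notation leb2 R := (@lebesgue_measure R \x @lebesgue_measure R)%E.

(** * Rotated spherical coordinates *)

Section Rotation.
Context {R : realType}.
Implicit Types (v a b o : 'rV[R]_3).

Lemma dot_vec v a b o x y z : dot v (vec a b o x y z) = x * dot v a + y * dot v b + z * dot v o.
Proof. by rewrite /vec !dotDr !dotZr. Qed.

(** The point with spherical coordinates [p] relative to the frame at (t, q). The next three
    definitions are its partial derivatives in [t], [p.1] and [p.2]. *)
Definition rot_sph q t (p : R * R) := vec (fr1 t q) (fr2 q) (fr3 t q)
  (sin p.1 * cos p.2) (sin p.1 * sin p.2) (cos p.1).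
Definition rot_sph_t q t (p : R * R) := vec (fr1 t q) (fr2 q) (fr3 t q)
  (cos p.1) 0 (- (sin p.1 * cos p.2)).
Definition rot_sph_1 q t (p : R * R) := vec (fr1 t q) (fr2 q) (fr3 t q)
  (cos p.1 * cos p.2) (cos p.1 * sin p.2) (- sin p.1).
Definition rot_sph_2 q t (p : R * R) := vec (fr1 t q) (fr2 q) (fr3 t q)
  (- (sin p.1 * sin p.2)) (sin p.1 * cos p.2) 0.

Lemma dot_fr v q : exists x y z : R, [/\
  forall t, dot v (fr1 t q) = x * cos t + y * sin t,
  dot v (fr2 q) = z &
  forall t, dot v (fr3 t q) = x * sin t - y * cos t].
Proof.
rewrite (row3E v); set v1 := v 0 _; set v2 := v 0 _; set v3 := v 0 _.
exists (v1 * cos q + v2 * sin q), (- v3), (- v1 * sin q + v2 * cos q).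
by rewrite /fr1 /fr2 /fr3; split=> [t||t]; rewrite dot_row3; ring.
Qed.

Lemma rot_sph_derive q t p : vec_derive (fun r => rot_sph q r p) t (rot_sph_t q t p).
Proof.
move=> v; have [x [y [z [e1 e2 e3]]]] := dot_fr v q.
have -> : (fun r => dot v (rot_sph q r p)) = (fun r => sin p.1 * cos p.2 * (x * cos r + y * sin r) +
   sin p.1 * sin p.2 * z + cos p.1 * (x * sin r - y * cos r)).
  by apply/funext => r; rewrite dot_vec e1 e2 e3.
by rewrite dot_vec e1 e2 e3; isderE; [isder|cbn beta; ring].
Qed.

Lemma rot_sph_derive1 q t x y : vec_derive (fun r => rot_sph q t (r, y)) x (rot_sph_1 q t (x, y)).
Proof.
move=> v; set A := dot v (fr1 t q); set B := dot v (fr2 q); set C := dot v (fr3 t q).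
have -> : (fun r => dot v (rot_sph q t (r, y))) = (fun r => sin r * cos y * A +
   sin r * sin y * B + cos r * C).
  by apply/funext => r; rewrite dot_vec.
by rewrite dot_vec -/A -/B -/C /=; isderE; [isder|cbn beta; ring].
Qed.

Lemma rot_sph_derive2 q t x y : vec_derive (fun r => rot_sph q t (x, r)) y (rot_sph_2 q t (x, y)).
Proof.
move=> v; set A := dot v (fr1 t q); set B := dot v (fr2 q); set C := dot v (fr3 t q).
have -> : (fun r => dot v (rot_sph q t (x, r))) = (fun r => sin x * cos r * A +
   sin x * sin r * B + cos x * C).
  by apply/funext => r; rewrite dot_vec.
by rewrite dot_vec -/A -/B -/C /=; isderE; [isder|cbn beta; ring].
Qed.

Lemma rot_sph_continuous1 q t y : vec_continuous (fun r => rot_sph q t (r, y)).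
Proof. by move=> v; apply: (is_derive_continuous (fun x => rot_sph_derive1 q t x y v)). Qed.

Lemma rot_sph_continuous2 q t x : vec_continuous (fun r => rot_sph q t (x, r)).
Proof. by move=> v; apply: (is_derive_continuous (fun y => rot_sph_derive2 q t x y v)). Qed.

Lemma rot_sph_1_continuous q t y : vec_continuous (fun r => rot_sph_1 q t (r, y)).
Proof.
move=> v; set A := dot v (fr1 t q); set B := dot v (fr2 q); set C := dot v (fr3 t q).
have -> : (fun r => dot v (rot_sph_1 q t (r, y))) = (fun r => cos r * cos y * A +
   cos r * sin y * B + - sin r * C).
  by apply/funext => r; rewrite dot_vec.
by iscont.
Qed.

Lemma rot_sph_2_continuous q t x : vec_continuous (fun r => rot_sph_2 q t (x, r)).
Proof.
move=> v; set A := dot v (fr1 t q); set B := dot v (fr2 q); set C := dot v (fr3 t q).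
have -> : (fun r => dot v (rot_sph_2 q t (x, r))) = (fun r => - (sin x * sin r) * A +
   sin x * cos r * B + 0 * C).
  by apply/funext => r; rewrite dot_vec.
by iscont.
Qed.

Lemma tame_sin1 : tame (fun (_ : R) p => sin p.1).
Proof. by apply: tame_fst; [exact: continuous_sin|exists 1; exact: normr_sin_le1]. Qed.

Lemma tame_cos1 : tame (fun (_ : R) p => cos p.1).
Proof. by apply: tame_fst; [exact: continuous_cos|exists 1; exact: normr_cos_le1]. Qed.

Lemma tame_sin2 : tame (fun (_ : R) p => sin p.2).
Proof. by apply: tame_snd; [exact: continuous_sin|exists 1; exact: normr_sin_le1]. Qed.

Lemma tame_cos2 : tame (fun (_ : R) p => cos p.2).
Proof. by apply: tame_snd; [exact: continuous_cos|exists 1; exact: normr_cos_le1]. Qed.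

Lemma tameN (H : R -> R * R -> R) : tame H -> tame (fun e p => - H e p).
Proof. by apply: tame_comp => x; exact: opp_continuous. Qed.

Lemma tame_vec q (X Y Z : R -> R * R -> R) : tame X -> tame Y -> tame Z ->
  vec_tame (fun t p => vec (fr1 t q) (fr2 q) (fr3 t q) (X t p) (Y t p) (Z t p)).
Proof.
move=> tX tY tZ v; have [x [y [z [e1 e2 e3]]]] := dot_fr v q.
have -> : (fun t p => dot v (vec (fr1 t q) (fr2 q) (fr3 t q) (X t p) (Y t p) (Z t p))) =
  (fun t p => X t p * (x * cos t + y * sin t) + Y t p * z + Z t p * (x * sin t + - (y * cos t))).
  by apply/funext => t; apply/funext => p; rewrite dot_vec e1 e2 e3.
have tc : tame (fun (t : R) (_ : R * R) => cos t) by apply: tame_param; exists 1; exact: normr_cos_le1.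
have ts : tame (fun (t : R) (_ : R * R) => sin t) by apply: tame_param; exists 1; exact: normr_sin_le1.
by repeat first [exact: tame_cst | apply: tameD | apply: tameN | apply: tameM].
Qed.

Lemma rot_sph_tame q : vec_tame (rot_sph q).
Proof.
apply: tame_vec; last exact: tame_cos1.
  by apply: tameM; [exact: tame_sin1|exact: tame_cos2].
by apply: tameM; [exact: tame_sin1|exact: tame_sin2].
Qed.

Lemma rot_sph_t_tame q : vec_tame (rot_sph_t q).
Proof.
apply: tame_vec; [exact: tame_cos1|exact: tame_cst|].
by apply: tameN; apply: tameM; [exact: tame_sin1|exact: tame_cos2].
Qed.

Lemma rot_sph_1_tame q : vec_tame (rot_sph_1 q).
Proof.
apply: tame_vec; last by apply: tameN; exact: tame_sin1.
  by apply: tameM; [exact: tame_cos1|exact: tame_cos2].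
by apply: tameM; [exact: tame_cos1|exact: tame_sin2].
Qed.

Lemma rot_sph_2_tame q : vec_tame (rot_sph_2 q).
Proof.
apply: tame_vec; last exact: tame_cst.
  by apply: tameN; apply: tameM; [exact: tame_sin1|exact: tame_sin2].
by apply: tameM; [exact: tame_sin1|exact: tame_cos2].
Qed.

(* Infinitesimal rotations are divergence free. *)
Lemma rot_sph_split q t p : sin p.1 *: rot_sph_t q t p =
  (sin p.1 * cos p.2) *: rot_sph_1 q t p + (- (cos p.1 * sin p.2)) *: rot_sph_2 q t p.
Proof.
have Hf := frame_fr t q; have c1 := cos2Dsin2 p.1; have c2 := cos2Dsin2 p.2.
apply: (frame_eq Hf); rewrite dotDl !dotZl !(dot_vecE Hf).
- transitivity (sin p.1 * cos p.1 * (cos p.2 ^+ 2 + sin p.2 ^+ 2)); last by ring.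
  by rewrite c2; ring.
- by ring.
- by ring.
Qed.

Variables (F : 'rV[R]_3 -> R) (dF : 'rV[R]_3 -> 'rV[R]_3 -> R).
Hypothesis sF : smooth F dF.

Let I q t := Rintegral (leb2 R) rect (fun p => F (rot_sph q t p) * sin p.1).

Let der q t p := dF (rot_sph q t p) (rot_sph_t q t p) * sin p.1.

Let der_tame q : tame (der q).
Proof.
apply: tameM; last exact: tame_sin1.
by apply: (smooth_dtame sF); [exact: rot_sph_tame|exact: rot_sph_t_tame].
Qed.

Let int_tame q : tame (fun t p => F (rot_sph q t p) * sin p.1).
Proof.
apply: tameM; last exact: tame_sin1.
by apply: (smooth_tame sF); exact: rot_sph_tame.
Qed.

Let tame_integrable H (t : R) : tame H -> (leb2 R).-integrable rect (EFin \o H t).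
Proof.
move=> [mH [C bC]]; apply: rect_integrable; first exact: mH.
by exists C.
Qed.

(** By [rot_sph_split] the integrand is P1 - P2, where P1 is the [p.1]-derivative of F sin p.1 cos
    p.2 and P2 the [p.2]-derivative of F cos p.1 sin p.2; the product-rule terms F cos p.1 cos p.2
    cancel. Both integrals vanish as sin is 0 at 0, pi and 2 pi. *)
Let der_itg0 q t : Rintegral (leb2 R) rect (der q t) = 0.
Proof.
pose P1 s p := dF (rot_sph q s p) (rot_sph_1 q s p) * (sin p.1 * cos p.2) +
  F (rot_sph q s p) * (cos p.1 * cos p.2).
pose P2 s p := dF (rot_sph q s p) (rot_sph_2 q s p) * (cos p.1 * sin p.2) +
  F (rot_sph q s p) * (cos p.1 * cos p.2).
have tF : tame (fun s p => F (rot_sph q s p)) by apply: (smooth_tame sF); exact: rot_sph_tame.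
have t1 : tame P1.
  apply: tameD; apply: tameM => //.
  - by apply: (smooth_dtame sF); [exact: rot_sph_tame|exact: rot_sph_1_tame].
  - by apply: tameM; [exact: tame_sin1|exact: tame_cos2].
  - by apply: tameM; [exact: tame_cos1|exact: tame_cos2].
have t2 : tame P2.
  apply: tameD; apply: tameM => //.
  - by apply: (smooth_dtame sF); [exact: rot_sph_tame|exact: rot_sph_2_tame].
  - by apply: tameM; [exact: tame_cos1|exact: tame_sin2].
  - by apply: tameM; [exact: tame_cos1|exact: tame_cos2].
have -> : der q t = (fun p => P1 t p - P2 t p).
  apply/funext => p; rewrite /der mulrC.
  have := congr1 (dF (rot_sph q t p)) (rot_sph_split q t p).
  rewrite (smooth_linear sF) -[X in dF _ X = _]addr0 -(scale0r (rot_sph_t q t p)).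
  by rewrite (smooth_linear sF) mul0r addr0 => ->; rewrite /P1 /P2; ring.
rewrite RintegralB; [|exact: measurable_rect|exact: tame_integrable|exact: tame_integrable].
have zero (h H : R -> R) (a b : R) : a <= b -> continuous h -> (forall x : R, is_derive x 1 H (h x)) ->
    H a = H b -> itg a b h = 0.
  by move=> ab hc Hd HE; rewrite (itg_FTC ab hc Hd) HE subrr.
rewrite (rect_fubini21 (t1.1 t)); last by have [C bC] := t1.2; exists C.
rewrite (rect_fubini12 (t2.1 t)); last by have [C bC] := t2.2; exists C.
rewrite (@eq_itg _ _ _ _ (fun=> 0)); last first.
  move=> y; apply: (zero _ (fun x => F (rot_sph q t (x, y)) * (sin x * cos y))).
  - exact: pi_ge0.
  - have c1 := smooth_continuous sF (@rot_sph_continuous1 q t y).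
    have c2 := smooth_dcontinuous sF (@rot_sph_continuous1 q t y) (@rot_sph_1_continuous q t y).
    by rewrite /P1 /=; iscont.
  - move=> x; have d1 := smooth_derive sF (rot_sph_derive1 q t x y).
    have d2 : is_derive x 1 (fun x => sin x * cos y) (cos x * cos y) by isderE; [isder|cbn beta; ring].
    have := is_derive_mul d1 d2; rewrite /P1 /=.
    by rewrite [X in is_derive _ _ _ X]addrC.
  - by rewrite sin0 sinpi !mul0r !mulr0.
rewrite (@eq_itg _ _ _ (fun x => itg _ _ _) (fun=> 0)); last first.
  move=> x; apply: (zero _ (fun y => F (rot_sph q t (x, y)) * (cos x * sin y))).
  - by rewrite mulrn_wge0// pi_ge0.
  - have c1 := smooth_continuous sF (@rot_sph_continuous2 q t x).
    have c2 := smooth_dcontinuous sF (@rot_sph_continuous2 q t x) (@rot_sph_2_continuous q t x).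
    by rewrite /P2 /=; iscont.
  - move=> y; have d1 := smooth_derive sF (rot_sph_derive2 q t x y).
    have d2 : is_derive y 1 (fun y => cos x * sin y) (cos x * cos y) by isderE; [isder|cbn beta; ring].
    have := is_derive_mul d1 d2; rewrite /P2 /=.
    by rewrite [X in is_derive _ _ _ X]addrC.
  - by rewrite sin0 sin2pi !mulr0.
have z (b : R) : 0 <= b -> itg 0 b (fun=> 0) = 0 by move=> b0; rewrite itg_cst// mul0r.
by rewrite (z pi (pi_ge0 R)) (z (pi *+ 2)) ?subrr// mulrn_wge0// pi_ge0.
Qed.

Let I_derive q (t : R) : is_derive t 1 (I q) 0.
Proof.
have [mt [C bC]] := der_tame q.
have dd (x : R) p : is_derive x 1 (fun t => F (rot_sph q t p) * sin p.1) (der q x p).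
  have d1 := smooth_derive sF (rot_sph_derive q x p).
  have := is_derive_mul d1 (is_derive_cstfun (sin p.1) x).
  by rewrite mulr0 add0r.
pose f t p := F (rot_sph q t p) * sin p.1.
have pE x p : partial1of2 f x p = der q x p by rewrite partial1of2E; have [_ ->] := dd x p.
have C0 : 0 <= C by apply: le_trans (normr_ge0 _) (bC 0 (0, 0)).
have ti : `]t - 1, t + 1[%classic t by rewrite /= in_itv /=; apply/andP; split; lra.
have h1 (x : R) : `]t - 1, t + 1[%classic x -> (leb2 R).-integrable rect (EFin \o f x).
  by move=> _; apply: (tame_integrable x (int_tame q)).
have h2 (x : R) p : `]t - 1, t + 1[%classic x -> rect p -> derivable (f ^~ p) x 1.
  by move=> _ _; have [] := dd x p.
have h3 : (leb2 R).-integrable rect (EFin \o (fun=> C)).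
  exact: (@tame_integrable (fun _ _ => C) 0 (tame_cst C)).
have h4 (x : R) p : `]t - 1, t + 1[%classic x -> rect p -> `|partial1of2 f x p| <= C.
  by move=> _ _; rewrite pE.
have D := @derivable_under_integral R _ _ (leb2 R) f rect measurable_rect t (t - 1) (t + 1) ti h1 h2 (fun=> C) (fun=> C0) h3 h4.
have E := @differentiation_under_integral R _ _ (leb2 R) f rect measurable_rect t (t - 1) (t + 1) ti h1 h2 (fun=> C) (fun=> C0) h3 h4.
apply: DeriveDef; first exact: D.
rewrite -derive1E [LHS]E -(der_itg0 q t); apply: eq_Rintegral => p _.
exact: pE.
Qed.

Lemma rot_sph00 q x y : rot_sph q 0 (x, y) = fr3 x (y + q).
Proof.
apply: (frame_eq (frame_fr 0 q)); rewrite !(dot_vecE (frame_fr 0 q)) /fr1 /fr2 /fr3 dot_row3;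
  rewrite ?sin0 ?cos0 ?sinD ?cosD /=; have c := cos2Dsin2 q.
- transitivity (sin x * cos y * (cos q ^+ 2 + sin q ^+ 2)); last by ring.
  by rewrite c mulr1.
- transitivity (sin x * sin y * (cos q ^+ 2 + sin q ^+ 2)); last by ring.
  by rewrite c mulr1.
- by ring.
Qed.

(** The integral does not depend on [t], and at t = 0 the rotation is a shift of the azimuth by [q],
    absorbed by periodicity. *)
Lemma smooth_rotation q t :
  Rintegral (leb2 R) rect (fun p => F (rot_sph q t p) * sin p.1) =
  Rintegral (leb2 R) rect (fun p => F (spherical_coord p) * sin p.1).
Proof.
rewrite -/(I q t) (@is_derive_0_is_cst R (I q) t 0 (I_derive q)).
have E : (fun p => F (spherical_coord p) * sin p.1) = (fun p => F (rot_sph 0 0 p) * sin p.1).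
  by apply/funext => -[x y]; rewrite spherical_coordE rot_sph00 addr0.
rewrite E /I.
have [m1 b1] := int_tame q; have [m2 b2] := int_tame 0.
rewrite (rect_fubini12 (m1 0)); last by have [C bC] := b1; exists C.
rewrite (rect_fubini12 (m2 0)); last by have [C bC] := b2; exists C.
apply: eq_itg => x.
have c1 := smooth_continuous sF (@rot_sph_continuous2 0 0 x).
have hc : continuous (fun y => F (rot_sph 0 0 (x, y)) * sin x) by iscont.
rewrite -(itg_shift q _ hc).
- by apply: eq_itg => y /=; rewrite !rot_sph00 addr0.
- by rewrite mulrn_wge0// pi_ge0.
- by move=> y; rewrite !rot_sph00 !addr0 /fr3 cosD2pi sinD2pi.
Qed.

End Rotation.

(** * The area of radial bodies and caps *)

Section Area.
Context {R : realType}.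
Implicit Types (b : nat -> R) (n : nat -> 'rV[R]_3).

(** Dominated convergence with bound 1. Measurability of the limiting indicator, too, comes from its
    being a pointwise limit. *)
Lemma mollifier_integral b n (w : R -> R * R -> 'rV[R]_3) e (u := w e) : vec_tame w ->
  Rintegral (leb2 R) rect (fun p => mollifier b n j (u p) * sin p.1) @[j --> \oo] -->
  Rintegral (leb2 R) (rect `&` [set p | forall i, b i <= dot (n i) (u p)]) (fun p => sin p.1).
Proof.
move=> tw; rewrite Rintegral_mkcondr; set E := [set p | _].
have mm j : measurable_fun [set: R * R] (fun p => mollifier b n j (u p) * sin p.1).
  have [dF sF] := smooth_mollifier b n j.
  apply: measurable_funM; [exact: (smooth_tame sF tw).1 e|exact: tame_sin1.1 0].
have cv p : mollifier b n j (u p) * sin p.1 @[j --> \oo] --> ((fun p : R * R => sin p.1) \_ E) p.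
  have -> : ((fun p : R * R => sin p.1) \_ E) p = (`[< E p >])%:R * sin p.1.
    rewrite patchE; case: asboolP => h; first by rewrite mem_set// mul1r.
    by rewrite memNset// mul0r.
  by apply: cvgMl; exact: mollifier_cvg.
have bd j p : `|mollifier b n j (u p) * sin p.1| <= 1.
  have /andP[m0 m1] := mollifier_bounds b n j (u p).
  rewrite normrM (ger0_norm m0) -[leRHS]mulr1.
  by apply: ler_pM => //; exact: normr_sin_le1.
have mS : measurable_fun rect ((fun p : R * R => sin p.1) \_ E).
  apply/measurable_EFinP.
  apply: (@emeasurable_fun_cvg _ _ _ _ (fun j p => (mollifier b n j (u p) * sin p.1)%:E)).
    by move=> j; apply/measurable_EFinP; apply: measurable_funTS; exact: mm.
  by move=> p _; apply: cvg_EFin; [exact: nearW|exact: cv].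
have iS : (leb2 R).-integrable rect (EFin \o ((fun p : R * R => sin p.1) \_ E)).
  apply: bounded_measurable_integrable => //; [exact: measurable_rect|exact: rect_lty|].
  exists 1 => p _; rewrite patchE; case: ifP => _; first exact: normr_sin_le1.
  by rewrite normr0.
have fS : (\int[leb2 R]_(x in rect) (((fun p : R * R => sin p.1) \_ E) x)%:E \is a fin_num)%E.
  by apply: integrable_fin_num; [exact: measurable_rect|exact: iS].
apply: fine_cvg; rewrite (fineK fS).
apply: (@dominated_cvg _ _ _ (leb2 R) rect measurable_rect
    (fun j p => (mollifier b n j (u p) * sin p.1)%:E) _ (fun=> 1%:E)).
- by move=> j; apply/measurable_EFinP; apply: measurable_funTS; exact: mm.
- by move=> p _; apply: cvg_EFin; [exact: nearW|exact: cv].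
- by [].
- apply: (@bounded_measurable_integrable _ _ _ (leb2 R) rect (fun=> 1)) => //.
  + exact: measurable_rect.
  + exact: rect_lty.
  + by exists 1 => p _; rewrite normr1.
- by move=> j p _; rewrite lee_fin; exact: bd.
Qed.

Lemma rot_sph_sphere q t p : sphere (rot_sph (R := R) q t p).
Proof.
apply/(frame_sphere (frame_fr t q)); rewrite !(dot_vecE (frame_fr t q)).
have c1 := cos2Dsin2 p.1; have c2 := cos2Dsin2 p.2.
transitivity (sin p.1 ^+ 2 * (cos p.2 ^+ 2 + sin p.2 ^+ 2) + cos p.1 ^+ 2); first by ring.
by rewrite c2 mulr1 addrC.
Qed.

Lemma area_rotation b n q t :
  area [set u | sphere u /\ forall i, b i <= dot (n i) u] =
  Rintegral (leb2 R) (rect `&` [set p | forall i, b i <= dot (n i) (rot_sph q t p)])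
    (fun p => sin p.1).
Proof.
have E : spherical_coord = rot_sph 0 0 :> (R * R -> 'rV[R]_3).
  by apply/funext => -[x y]; rewrite spherical_coordE rot_sph00 addr0.
have c1 := @mollifier_integral b n _ t (rot_sph_tame q).
have c2 := @mollifier_integral b n _ 0 (rot_sph_tame 0).
have h : (fun j => Rintegral (leb2 R) rect (fun p => mollifier b n j (rot_sph q t p) * sin p.1)) =
    (fun j => Rintegral (leb2 R) rect (fun p => mollifier b n j (rot_sph 0 0 p) * sin p.1)).
  apply/funext => j; have [dF sF] := smooth_mollifier b n j.
  exact: (etrans (smooth_rotation sF q t) (esym (smooth_rotation sF 0 0))).
rewrite h in c1.
transitivity (Rintegral (leb2 R) (rect `&` [set p | forall i, b i <= dot (n i) (rot_sph 0 0 p)])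
    (fun p => sin p.1)); last exact: (cvg_unique _ c2 c1).
rewrite /area E.
have -> : rot_sph 0 0 @^-1` [set u : 'rV[R]_3 | sphere u /\ forall i, b i <= dot (n i) u] =
    [set p | forall i, b i <= dot (n i) (rot_sph 0 0 p)].
  apply/seteqP; split=> [p [_ bp] //|p bp]; split; first exact: rot_sph_sphere.
  exact: bp.
by [].
Qed.

(** At azimuth [y] the slice is [0, acos (g y)] because cos decreases on [0, pi], and sin integrates
    to 1 - g y over it. *)
Lemma polar_area (g : R -> R) : continuous g -> (forall y, -1 <= g y <= 1) ->
  Rintegral (leb2 R) (rect `&` [set p | g p.2 <= cos p.1]) (fun p => sin p.1) =
  itg 0 (pi *+ 2) (fun y => 1 - g y).
Proof.
move=> gc gb; rewrite Rintegral_mkcondr; set H := _ \_ _.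
have HE p : H p = if g p.2 <= cos p.1 then sin p.1 else 0.
  rewrite /H patchE.
  by have -> : (p \in [set p : R * R | g p.2 <= cos p.1]) = (g p.2 <= cos p.1)
    by apply/idP/idP; rewrite inE.
have mH : measurable_fun [set: R * R] H.
  rewrite (funext HE); apply: measurable_fun_ifT.
  - apply: measurable_fun_ler.
      by apply: (@measurableT_comp _ _ _ _ _ _ g) => //; exact: continuous_measurable_fun.
    exact: tame_cos1.1 0.
  - exact: tame_sin1.1 0.
  - exact: measurable_cst.
rewrite (rect_fubini21 mH); last first.
  by exists 1 => p; rewrite HE; case: ifP => _; rewrite ?normr0//; exact: normr_sin_le1.
apply: eq_itg => y; have /andP[g1 g2] := gb y.
have gy : g y \in `[(-1), 1] by rewrite in_itv /= g1.
have d0 : 0 <= acos (g y) by apply: acos_ge0; rewrite g1.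
have dpi : acos (g y) <= pi by apply: acos_lepi; rewrite g1.
have -> : itg 0 pi (fun x => H (x, y)) = itg 0 (acos (g y)) sin.
  have -> : itg 0 (acos (g y)) sin = Rintegral lebesgue_measure (`[0, pi] `&` `[0, acos (g y)]) sin.
    rewrite /itg; congr Rintegral; apply/seteqP; split=> x /=; rewrite !in_itv /=; last by case.
    by move=> /andP[x0 xd]; rewrite x0 xd (le_trans xd dpi).
  rewrite Rintegral_mkcondr; apply: eq_Rintegral => x; rewrite inE /= in_itv /= => /andP[x0 xpi].
  rewrite HE /= patchE.
  have -> : (x \in [set` `[0, acos (g y)]]) = (g y <= cos x) => //.
  have xI : (x : R) \in `[0, pi] by rewrite in_itv /= x0.
  have dI : acos (g y) \in `[0, pi] by rewrite in_itv /= d0.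
  have -> : (g y <= cos x) = ((x : R) <= acos (g y)).
    by rewrite leNgt [RHS]leNgt -(ltr_cos dI xI) acosK.
  by apply/idP/idP; rewrite inE /= in_itv /= x0.
have sd (x : R) : is_derive x 1 (fun x => - cos x) (sin x) by isderE; [isder|rewrite mulr1 opprK].
have sc : continuous (fun x : R => sin x) by exact: continuous_sin.
by rewrite (itg_FTC d0 sc sd) acosK// cos0; ring.
Qed.

Lemma starlike_area b n q t (g : R -> R) : continuous g -> (forall y, -1 <= g y <= 1) ->
  (forall x y, 0 <= x <= pi ->
    (forall i, b i <= dot (n i) (rot_sph q t (x, y))) <-> g y <= cos x) ->
  area [set u | sphere u /\ forall i, b i <= dot (n i) u] =
  itg 0 (pi *+ 2) (fun y => 1 - g y).
Proof.
move=> gc gb H; rewrite (@area_rotation b n q t) -polar_area//; congr Rintegral.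
apply/seteqP; split=> -[x y] [rp /= h]; (split; first by []);
  by apply/(H x y) => //; case: rp => /=; rewrite in_itv.
Qed.

Lemma area_cap (c : 'rV[R]_3) (beta : R) : sphere c -> -1 <= beta <= 1 ->
  area [set u | sphere u /\ beta <= dot c u] = pi *+ 2 * (1 - beta).
Proof.
move=> /sphere_fr3[t [q ->]] bb.
have -> : [set u | sphere u /\ beta <= dot (fr3 t q) u] =
  [set u | sphere u /\ forall i : nat, beta <= dot (fr3 t q) u].
  by apply/seteqP; split=> u /= [su h]; split=> // ; exact: (h 0%N).
rewrite (@starlike_area _ _ q t (fun=> beta)) //.
- by rewrite itg_cst ?subr0 1?mulrC// mulrn_wge0// pi_ge0.
- exact: continuous_cstfun.
- move=> x y _; rewrite dotC (dot_vec_o (frame_fr t q)) /=.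
  by split=> [/(_ 0%N)|].
Qed.

End Area.

(** With c = cos x and d = sin x, both conditions say that [x] is at most the angle with cotangent
    [f], whose cosine is f / s. *)
Lemma cap_condition (R : realType) (f s c d : R) : 0 < f -> 0 < s -> s ^+ 2 = 1 + f ^+ 2 ->
  c ^+ 2 + d ^+ 2 = 1 -> 0 <= d -> f * d <= c <-> f / s <= c.
Proof.
move=> f0 s0 sE cd d0; rewrite ler_pdivrMr//; split=> h.
- rewrite leNgt; apply/negP => lt.
  have c0 : 0 <= c by apply: le_trans h; rewrite mulr_ge0// ltW.
  have cs0 : 0 <= c * s by rewrite mulr_ge0// ltW.
  have fd0 : 0 <= f * d by rewrite mulr_ge0// ltW.
  have h1 : (c * s) ^+ 2 < f ^+ 2 by rewrite ltr_pXn2r// nnegrE ltW.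
  have h2 : (f * d) ^+ 2 <= c ^+ 2 by rewrite ler_pXn2r.
  have dE : d ^+ 2 = 1 - c ^+ 2 by lra.
  by move: h1 h2; rewrite !exprMn sE dE; lra.
- have c0 : 0 < c by rewrite -(pmulr_lgt0 _ s0); exact: lt_le_trans h.
  have cs0 : 0 <= c * s by rewrite mulr_ge0// ltW.
  have fd0 : 0 <= f * d by rewrite mulr_ge0// ltW.
  have h1 : f ^+ 2 <= (c * s) ^+ 2 by rewrite ler_pXn2r// nnegrE ltW.
  have dE : d ^+ 2 = 1 - c ^+ 2 by lra.
  rewrite -(ler_pXn2r (n := 2))// ?nnegrE ?(ltW c0)//.
  by move: h1; rewrite !exprMn sE dE; lra.
Qed.

(** * Radial bodies as countable intersections of half-spaces *)

Section RadialArea.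
Context {R : realType}.
Variables (t q : R) (f f' f2 : R -> R).
Hypothesis fd : forall x : R, is_derive x 1 f (f' x).
Hypothesis f'd : forall x : R, is_derive x 1 f' (f2 x).
Hypothesis f0 : forall x, 0 < f x.
Hypothesis ff0 : forall x, 0 < f x + f2 x.
Hypothesis fT : forall x, f (x + pi *+ 2) = f x.

Let Hf := frame_fr t q.
Let K := radial_body (fr1 t q) (fr2 q) (fr3 t q) f.

(** [normal w] without its normalizing factor. *)
Let conormal w := vec (fr1 t q) (fr2 q) (fr3 t q)
  (- (f w * cos w - f' w * sin w)) (- (f w * sin w + f' w * cos w)) 1.

Let dot_conormal w r y h : dot (conormal w) (vec (fr1 t q) (fr2 q) (fr3 t q) (r * cos y) (r * sin y) h) =
  h - r * (f w * cos (y - w) + f' w * sin (y - w)).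
Proof. by rewrite dot_vec /conormal !(dot_vecE Hf) cosB sinB; ring. Qed.

Let radialP w u : K u -> 0 <= dot (conormal w) u.
Proof.
move=> [_ [y [r [h [r0 le ->]]]]]; rewrite dot_conormal.
have e : w + (y - w) = y by ring.
have := support_ineq fd f'd ff0 fT w (y - w); rewrite e => s.
by have := ler_wpM2l r0 s; lra.
Qed.

Let conormal_cond r y h : 0 <= dot (conormal y) (vec (fr1 t q) (fr2 q) (fr3 t q) (r * cos y) (r * sin y) h) ->
  f y * r <= h.
Proof. by rewrite dot_conormal subrr cos0 sin0; lra. Qed.

Let fc := is_derive_continuous fd.
Let f'c := is_derive_continuous f'd.

(** An enumeration of the rationals, with 0 at indices that code none: [area_rotation] handles
    sequences of half-spaces, and the angles [w] form a continuum. *)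
Let node (i : nat) : R := if unpickle i is Some r then ratr r else 0.

Let node_dense (h : R -> R) : continuous h -> (forall i, 0 <= h (node i)) -> forall w, 0 <= h w.
Proof.
move=> hc hp w; rewrite leNgt; apply/negP => hw.
have nh : 0 < - h w by rewrite oppr_gt0.
have /cvgrPdist_lt/(_ _ nh)[e /= e0 eh] := hc w.
have ew : w - e / 2 < w + e / 2 by lra.
have [r] := rat_in_itvoo ew; rewrite in_itv /= => /andP[r1 r2].
have := hp (pickle r); rewrite /node pickleK => hr.
have : `|h w - h (ratr r)| < - h w by apply: eh; rewrite /ball /= ltr_norml; lra.
by rewrite ltr_norml => /andP[]; lra.
Qed.

(** The half-space at angle [y] alone decides the points of azimuth [y], and continuity in the angle
    carries the inequalities from the rationals to all angles. *)
Let radial_halfspaces : K = [set u | sphere u /\ forall i, 0 <= dot (conormal (node i)) u].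
Proof.
apply/seteqP; split=> u.
  by move=> Ku; split; [case: Ku|move=> i; exact: radialP].
move=> [su hu]; split=> //.
have [r [y [r0 ax ay]]] := polar_exists (dot u (fr1 t q)) (dot u (fr2 q)).
have uE := frame_vec Hf u; rewrite ax ay in uE.
exists y, r, (dot u (fr3 t q)); split=> //.
apply: conormal_cond; rewrite -uE.
apply: (@node_dense (fun w => dot (conormal w) u)) => //.
have -> : (fun w => dot (conormal w) u) = (fun w => (- (f w * cos w - f' w * sin w)) * dot u (fr1 t q) +
   (- (f w * sin w + f' w * cos w)) * dot u (fr2 q) + 1 * dot u (fr3 t q)).
  by apply/funext => w; rewrite dotC dot_vec.
by iscont.
Qed.

Lemma area_radial : area K = itg 0 (pi *+ 2) (fun w => 1 - f w / slant f w).
Proof.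
have s0 := slant_gt0 f; have sc := continuous_slant fd.
have z0 y : 0 < f y / slant f y by exact: divr_gt0.
have z1 y : f y / slant f y < 1 by rewrite ltr_pdivrMr// mul1r; exact: slant_gtf.
rewrite radial_halfspaces (@starlike_area _ _ _ q t (fun y => f y / slant f y)) //.
- have sn y : slant f y != 0 by exact: slant_neq0.
  by iscont.
- by move=> y; rewrite (ltW (z1 y)) andbT; apply: le_trans (ltW (z0 y)); lra.
move=> x y xpi.
have sx : 0 <= sin x by exact: sin_ge0_pi.
have rE : rot_sph q t (x, y) = vec (fr1 t q) (fr2 q) (fr3 t q) (sin x * cos y) (sin x * sin y) (cos x).
  by [].
have Kx : (forall i, 0 <= dot (conormal (node i)) (rot_sph q t (x, y))) <-> f y * sin x <= cos x.
  split=> h.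
    have : K (rot_sph q t (x, y)) by rewrite radial_halfspaces; split; [exact: rot_sph_sphere|].
    by move/(radialP y); rewrite rE => /conormal_cond.
  move=> i; apply: radialP; split; first exact: rot_sph_sphere.
  by exists y, (sin x), (cos x).
apply: (iff_trans Kx).
have c2 := cos2Dsin2 x; have S2 := sqr_slant f y.
set s := slant f y in s0 z0 S2 *; have sy : 0 < s := slant_gt0 f y.
have fy := f0 y.
exact: cap_condition.
Qed.

End RadialArea.

(** * Geodesic balls *)

Section Caps.
Context {R : realType}.
Implicit Types (c u v : 'rV[R]_3).

Lemma dot_sphere_bounds u v : sphere u -> sphere v -> dot u v \in `[(-1), 1].
Proof.
move=> su /sphere_fr3[t [q ->]]; have := (frame_sphere (frame_fr t q) u).1 su.
set x := dot u (fr3 t q) => h; rewrite in_itv /= -ler_norml.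
rewrite -(ler_pXn2r (n := 2))// ?nnegrE// expr1n real_normK ?num_real//.
by have := sqr_ge0 (dot u (fr1 t q)); have := sqr_ge0 (dot u (fr2 q)); lra.
Qed.

Lemma oneBsqr_gt0 (m : R) : 0 < m < 1 -> 0 < 1 - m ^+ 2.
Proof.
move=> /andP[m0 m1]; have -> : 1 - m ^+ 2 = (1 - m) * (1 + m) by ring.
by rewrite mulr_gt0//; lra.
Qed.

(** Radii beyond pi all give the whole sphere; the truncation keeps the radius in the interval on
    which cos is decreasing. *)
Lemma geod_ball_halfspace c (alpha : R) : sphere c -> 0 <= alpha ->
  geod_ball c alpha = [set u | sphere u /\ cos (Num.min alpha pi) <= dot c u].
Proof.
move=> sc a0; apply/seteqP; split=> u [su h]; split=> //.
  have db := dot_sphere_bounds sc su; have := db; rewrite in_itv /= => db'.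
  have aI : acos (dot c u) \in `[0, pi] by rewrite in_itv /= acos_ge0// acos_lepi.
  have mI : Num.min alpha pi \in `[0, pi].
    by rewrite in_itv /= le_min a0 pi_ge0 /= ge_min lexx orbT.
  rewrite -[leRHS]acosK// leNgt (ltr_cos mI aI) -leNgt le_min.
  by rewrite h acos_lepi.
rewrite /geod_dist; have db := dot_sphere_bounds sc su; have := db; rewrite in_itv /= => db'.
have aI : acos (dot c u) \in `[0, pi] by rewrite in_itv /= acos_ge0// acos_lepi.
have mI : Num.min alpha pi \in `[0, pi].
  by rewrite in_itv /= le_min a0 pi_ge0 /= ge_min lexx orbT.
move: h; rewrite -[X in _ <= X -> _]acosK// leNgt (ltr_cos mI aI) -leNgt le_min.
by case/andP.
Qed.

Lemma area_geod_ball c (alpha : R) : sphere c -> 0 <= alpha ->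
  area (geod_ball c alpha) = pi *+ 2 * (1 - cos (Num.min alpha pi)).
Proof.
by move=> sc a0; rewrite geod_ball_halfspace// area_cap// cos_geN1 cos_le1.
Qed.

Lemma area_geod_ball_neg c (alpha : R) : sphere c -> alpha < 0 -> area (geod_ball c alpha) = 0.
Proof.
move=> sc a0; have -> : geod_ball c alpha = set0; last first.
  by rewrite /area preimage_set0 setI0 Rintegral_set0.
apply/seteqP; split=> // u [su]; have := dot_sphere_bounds sc su; rewrite in_itv /= => db.
by rewrite /geod_dist => h; have := le_trans (acos_ge0 db) h; rewrite leNgt a0.
Qed.

(* The slope cot alpha of a cap in terms of its height m = cos alpha. *)
Lemma halfspace_radial (t q m : R) : 0 < m < 1 ->
  [set u | sphere u /\ m <= dot (fr3 t q) u] =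
  radial_body (fr1 t q) (fr2 q) (fr3 t q) (fun=> m / Num.sqrt (1 - m ^+ 2)).
Proof.
move=> mb; have /andP[m0 m1] := mb; have Hf := frame_fr t q.
have d0 : 0 < 1 - m ^+ 2 by exact: oneBsqr_gt0.
set s := Num.sqrt (1 - m ^+ 2); have s0 : 0 < s by rewrite sqrtr_gt0.
have S2 : s ^+ 2 = 1 - m ^+ 2 by rewrite sqr_sqrtr// ltW.
have k0 : 0 < m / s by exact: divr_gt0.
have si0 : 0 < s^-1 by rewrite invr_gt0.
have kE : s^-1 ^+ 2 = 1 + (m / s) ^+ 2.
  rewrite expr_div_n exprVn S2; field.
  by rewrite gt_eqF.
have hE : (m / s) / s^-1 = m by rewrite invrK divfK// gt_eqF.
have cond r y h : 0 <= r -> sphere (vec (fr1 t q) (fr2 q) (fr3 t q) (r * cos y) (r * sin y) h) ->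
    (m / s * r <= h <-> m <= h).
  move=> r0 /(frame_sphere Hf); rewrite !(dot_vecE Hf) => e.
  rewrite -{2}hE; apply: cap_condition => //.
  rewrite -e; have c := cos2Dsin2 y.
  transitivity (h ^+ 2 + r ^+ 2 * (cos y ^+ 2 + sin y ^+ 2)); last by ring.
  by rewrite c mulr1.
apply/seteqP; split=> u [su].
  move=> mu; split=> //.
  have [r [y [r0 ax ay]]] := polar_exists (dot u (fr1 t q)) (dot u (fr2 q)).
  have uE := frame_vec Hf u; rewrite ax ay in uE.
  exists y, r, (dot u (fr3 t q)); split=> //.
  by apply/(cond _ y) => //; [rewrite -uE|rewrite dotC].
move=> [y [r [h [r0 le uE]]]]; split=> //.
by rewrite dotC uE (dot_vec_o Hf); apply/(cond r y) => //; rewrite -uE.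
Qed.

(** For a cap f is constant, equal to the cotangent [k] of the radius, and this is also the
    curvature; the mean of ln kappa is therefore ln k. *)
Lemma entropy_halfspace c m : sphere c -> 0 < m < 1 ->
  entropy [set u | sphere u /\ m <= dot c u] = - (1 / 2) * ln ((1 - m ^+ 2) / m ^+ 2).
Proof.
move=> /sphere_fr3[t [q ->]] mb; have := mb => /andP[m0 m1].
rewrite halfspace_radial//.
have d0 : 0 < 1 - m ^+ 2 by exact: oneBsqr_gt0.
set s := Num.sqrt (1 - m ^+ 2); have s0 : 0 < s by rewrite sqrtr_gt0.
have S2 : s ^+ 2 = 1 - m ^+ 2 by rewrite sqr_sqrtr// ltW.
set k := m / s; have k0 : 0 < k by exact: divr_gt0.
have cd (z x : R) : is_derive x 1 (fun=> z) 0 by exact: is_derive_cstfun.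
have cc (z : R) : continuous (fun _ : R => z) by exact: continuous_cstfun.
have kk0 (x : R) : 0 < k + 0 by rewrite addr0.
rewrite (entropy_radial (frame_fr t q) (cd k) (cd 0) (cc 0) (fun=> k0) kk0)//.
have E x : curv (fun=> k) (fun=> 0) (fun=> 0) x = k.
  rewrite /curv /slant /slant2 expr0n /= !addr0 mulfK// expf_neq0// gt_eqF// sqrtr_gt0.
  by rewrite ltr_pwDl// sqr_ge0.
rewrite (@eq_itg _ _ _ _ (fun x => ln k * curvds (fun=> k) (fun=> 0) (fun=> 0) x)); last first.
  by move=> x; rewrite E.
have cv := @continuous_curvds _ _ _ _ (cd k) (cd 0) (cc 0).
rewrite itgZ// mulfK; last first.
  rewrite gt_eqF//; apply: itg_gt0 => //; first by rewrite mulrn_wgt0// pi_gt0.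
  exact: curvds_gt0.
have -> : (1 - m ^+ 2) / m ^+ 2 = (k ^+ 2)^-1 by rewrite -S2 /k expr_div_n invf_div.
rewrite lnV ?posrE ?exprn_gt0// lnXn// -mulr_natl; by field.
Qed.

(* Both sides are functions of the mean height m = 1 - A / (2 pi). *)
Lemma entropy_area_ratio (A m : R) : A = pi *+ 2 * (1 - m) -> 0 < m ->
  (4 * pi * A - A ^+ 2) / (2 * pi - A) ^+ 2 = (1 - m ^+ 2) / m ^+ 2.
Proof.
move=> -> m0; have := pi_gt0 R; move: (pi : R) => p p0.
rewrite mulr2n; field; rewrite gt_eqF//=.
have -> : 2 * p - (p + p) * (1 - m) = 2 * p * m by ring.
by rewrite !mulf_neq0// gt_eqF.
Qed.

Lemma entropy_ratio_ge0 (m : R) : 0 < m -> 1 <= 2 * m ^+ 2 ->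
  0 <= - (1 / 2) * ln ((1 - m ^+ 2) / m ^+ 2).
Proof.
move=> m0 m2; have : ln ((1 - m ^+ 2) / m ^+ 2) <= 0; last by lra.
by apply: ln_le0; rewrite ler_pdivrMr ?exprn_gt0//; lra.
Qed.

Lemma sqr_cos_pi4 : 0 < cos (pi / 4) :> R /\ 2 * cos (pi / 4) ^+ 2 = 1 :> R.
Proof.
have p0 : 0 < pi :> R by exact: pi_gt0.
split; first by apply: cos_gt0_pihalf; apply/andP; split; lra.
have h : cos ((pi / 4) *+ 2) = 0 :> R by rewrite -(cos_pihalf R); congr cos; rewrite mulr2n; field.
by move: h; rewrite cos_mulr2n mulr2n; lra.
Qed.

End Caps.

(** With [m] the mean of f / slant f, the area of K is 2 pi (1 - m) and the cap of equal area has
    height [m]. The entropy formula is thus a function of [m], and either criterion amounts to 2 m^2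
    >= 1. *)
Theorem corollary1p5 (R : realType) (K : set 'rV[R]_3) (o : 'rV[R]_3)
    (ho : sphere o) (hK : sph_convex_body K) (hproper : sph_proper K)
    (hC2 : C2plus K) (hsym : symmetric_about o K) :
  [/\ (* C_K = geod_ball c alpha *)
      forall (c : 'rV[R]_3) (alpha : R), sphere c ->
        area (geod_ball c alpha) = area K ->
        entropy (geod_ball c alpha) <= entropy K /\
        entropy (geod_ball c alpha) =
          - (1 / 2) * ln ((4 * pi * area K - area K ^+ 2)
                          / (2 * pi - area K) ^+ 2),
      forall c : 'rV[R]_3, sphere c ->
        area (geod_ball c (pi / 4)) = (2 - Num.sqrt 2) * pi /\
        (area K <= area (geod_ball c (pi / 4)) -> 0 <= entropy K)
    & geod_diam K <= pi / 2 -> 0 <= entropy K].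
Proof.
have KS : K `<=` sphere by case: hK.
have [t [q [f [f' [f2 [[fd f'd f2c f0] [ff0 fpi KE]]]]]]] := symmetric_radial ho hK hproper hC2 hsym.
have fT x : f (x + pi *+ 2) = f x by rewrite mulr2n addrA !fpi.
have p0 : 0 < pi :> R by exact: pi_gt0.
have p2 : 0 < pi *+ 2 :> R by rewrite mulrn_wgt0.
have zc : continuous (fun w => f w / slant f w) := continuous_height fd.
have mb := mean_height_bounds fd f0; have ent := entropy_ineq fd f'd f2c f0 ff0 fpi.
have ME := itg_height f.
set m := itg 0 (pi *+ 2) (fun w => f w / slant f w) / (pi *+ 2) in mb ent ME.
have AE : area K = pi *+ 2 * (1 - m).
  rewrite KE (area_radial t q fd f'd f0 ff0 fT).
  rewrite (@eq_itg _ _ _ _ (fun w => 1 + -1 * (f w / slant f w))); last first.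
    by move=> w; rewrite mulN1r.
  have zc1 : continuous (fun w => -1 * (f w / slant f w)).
    by apply: continuous_mul => //; exact: continuous_cstfun.
  rewrite itgD//; last exact: continuous_cstfun.
  by rewrite itgZ// itg_cst ?(ltW p2)// ME; ring.
have m0 : 0 < m by case/andP: mb.
have ER := entropy_area_ratio AE m0.
have lower : - (1 / 2) * ln ((1 - m ^+ 2) / m ^+ 2) <= entropy K.
  have lc : continuous (fun x => ln (curv f f' f2 x) * curvds f f' f2 x).
    have k0 := curv_gt0 f' ff0; have kc := continuous_curv fd f'd f2c.
    have dc := continuous_curvds fd f'd f2c; have lk : continuous (fun w => ln (curv f f' f2 w)) by iscont.
    by iscont.
  rewrite KE (entropy_radial (frame_fr t q) fd f'd f2c f0 ff0 fT) (itg_curvds fd f'd f2c fT) ME.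
  rewrite (ler_pdivlMr _ _ (mulr_gt0 p2 m0)); move: ent.
  rewrite (@eq_itg _ _ _ (fun x => - _ * _) (fun x => -1 * (ln (curv f f' f2 x) * curvds f f' f2 x))).
    by rewrite itgZ//; lra.
  by move=> x; rewrite mulN1r mulNr.
have nonneg : 1 <= 2 * m ^+ 2 -> 0 <= entropy K.
  by move=> m2; apply: le_trans lower; exact: entropy_ratio_ge0.
split.
(* A negative radius gives the empty ball, of area 0, whereas m < 1 makes the area of K positive. *)
- move=> c alpha sc; have [a0|a0] := ltP alpha 0.
    rewrite (area_geod_ball_neg sc a0) AE => h.
    have : 0 < pi *+ 2 * (1 - m) by rewrite mulr_gt0//; case/andP: mb; lra.
    by rewrite -h ltxx.
  rewrite (area_geod_ball sc a0) AE => /(mulfI (lt0r_neq0 p2)) h.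
  have {}h : cos (Num.min alpha pi) = m by lra.
  rewrite (geod_ball_halfspace sc a0) h entropy_halfspace// -AE ER.
  by split.
- have [c0 c2] := @sqr_cos_pi4 R.
  move=> c sc; have a0 : 0 <= pi / 4 :> R by lra.
  have -> : area (geod_ball c (pi / 4)) = pi *+ 2 * (1 - cos (pi / 4)).
    by rewrite area_geod_ball// min_l//; lra.
  split.
    have -> : Num.sqrt 2 = 2 * cos (pi / 4) :> R.
      have E : (2 * cos (pi / 4)) ^+ 2 = 2 :> R by rewrite exprMn; lra.
      by rewrite -[X in Num.sqrt X]E sqrtr_sqr ger0_norm// mulr_ge0// ltW.
    by rewrite mulr2n; ring.
  rewrite AE ler_pM2l// => h; apply: nonneg.
  have cm : cos (pi / 4) <= m by lra.
  have := ler_pM (ltW c0) (ltW c0) cm cm; rewrite -!expr2; lra.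
- move=> diam; apply: nonneg.
  (* [P w] and [P (w + pi)] are opposite boundary points with dot product (f^2 - 1) / (1 + f^2),
     which must be nonnegative when their distance is at most pi / 2. *)
  have f1 w : 1 <= f w.
    pose P x := vec (fr1 t q) (fr2 q) (fr3 t q) ((slant f w)^-1 * cos x) ((slant f w)^-1 * sin x)
       (f w / slant f w).
    have s0 : 0 < slant f w by exact: slant_gt0.
    have S2 := sqr_slant f w.
    have PK x : f x = f w -> K (P x).
      move=> fx; rewrite KE; split.
        apply/(frame_sphere (frame_fr t q)); rewrite !(dot_vecE (frame_fr t q)).
        have c := cos2Dsin2 x.
        transitivity ((slant f w)^-1 ^+ 2 * (cos x ^+ 2 + sin x ^+ 2 + f w ^+ 2)); first by ring.
        by rewrite c -S2 exprVn mulVf// expf_neq0// gt_eqF.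
      exists x, (slant f w)^-1, (f w / slant f w); split=> //; first by rewrite invr_ge0 ltW.
      by rewrite fx.
    have K1 := PK w erefl; have K2 := PK (w + pi) (fpi w).
    have le : geod_dist (P w) (P (w + pi)) <= pi / 2.
      apply: le_trans diam; apply: sup_upper_bound; last by exists (P w, P (w + pi)).
      split; first by exists (geod_dist (P w) (P w)), (P w, P w).
      exists pi => _ [[u v] [/KS su /KS sv] <-] /=.
      by apply: acos_lepi; have := dot_sphere_bounds su sv; rewrite in_itv.
    have db := dot_sphere_bounds (KS _ K1) (KS _ K2).
    have dE : dot (P w) (P (w + pi)) = (f w ^+ 2 - 1) / slant f w ^+ 2.
      rewrite (frame_dot (frame_fr t q)) !(dot_vecE (frame_fr t q)) cosDpi sinDpi.
      have c := cos2Dsin2 w.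
      transitivity ((slant f w)^-1 ^+ 2 * (f w ^+ 2 - (cos w ^+ 2 + sin w ^+ 2))); first by ring.
      by rewrite c exprVn mulrC.
    have d0 : 0 <= dot (P w) (P (w + pi)).
      rewrite leNgt; apply/negP => dn; move: le; rewrite leNgt => /negP; apply.
      have db' := db; rewrite in_itv /= in db'.
      have aI : acos (dot (P w) (P (w + pi))) \in `[0, pi] by rewrite in_itv /= acos_ge0// acos_lepi.
      have hI : pi / 2 \in `[(0 : R), pi] by rewrite in_itv /=; apply/andP; split; lra.
      by rewrite -(ltr_cos hI aI) acosK// cos_pihalf.
    move: d0; rewrite dE pmulr_lge0 ?invr_gt0 ?exprn_gt0// subr_ge0 => h.
    by rewrite -(ler_pXn2r (n := 2))// ?nnegrE ?(ltW (f0 w))// expr1n.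
  have [c0 c2] := @sqr_cos_pi4 R; set r := cos (pi / 4) in c0 c2.
  (* Where f >= 1 one has f^2 / (1 + f^2) >= 1/2 = r^2, so the integrand of [m] is pointwise at
     least [r]. *)
  have rm : r <= m.
    rewrite /m ler_pdivlMr//.
    have -> : r * (pi *+ 2) = itg 0 (pi *+ 2) (fun=> r) by rewrite itg_cst ?subr0// ltW.
    apply: le_itg => //; first exact: continuous_cstfun.
    move=> w; have s0 : 0 < slant f w by exact: slant_gt0.
    have fw := f0 w; have S2 := sqr_slant f w; have fw1 := f1 w.
    rewrite ler_pdivlMr// -(ler_pXn2r (n := 2))// ?nnegrE ?mulr_ge0 ?(ltW fw) ?(ltW s0) ?(ltW c0)//.
    have ff : 1 <= f w ^+ 2 by rewrite expr_ge1// ltW.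
    rewrite exprMn S2.
    have -> : r ^+ 2 = 1 / 2 by lra.
    lra.
  have := ler_pM (ltW c0) (ltW c0) rm rm; rewrite -!expr2; lra.
Qed.
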